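(* Let $\mathsf{M}\in\mathbb{N}\setminus\{1\}$, $r\in\mathbb{N}$, $m\in\mathbb{N}_0$ and $u\in(l_0(\mathbb{Z}^d))^{r\times1}$. Let $a\in(l_0(\mathbb{Z}^d))^{r\times r}$ be a finitely supported filter and let $\upsilon_a\in(l_0(\mathbb{Z}^d))^{1\times r}$ be an order $m+1$ matching filter of $a$ with respect to $\mathsf{M}I_d$. Suppose there exist $\tau\in[0,\infty)$, $\mu\in\mathbb{N}_0^d$ with $|\mu|=m_0$ for some $m_0\in\{0,\dots,m\}$, and $\eta\in(C^{m_0}(\mathbb{R}^d))^{r\times1}$ such that $$\lim_{n\to\infty}\left\|\mathsf{M}^{\tau n}[\mathcal{S}_{a,\mathsf{M}I_d}^n(\boldsymbol{\delta}I_r)]*u-\partial^\mu\eta(\mathsf{M}^{-n}\cdot)\right\|_{(l_\infty(\mathbb{Z}^d))^{r\times1}}=0 .$$ Then the following statements hold: (1) For all $\nu\in\mathbb{N}_0^d$ with $|\nu|\le m$ that satisfy $|\nu|\le\tau$, $$\partial^\nu[\widehat{\upsilon_a}\widehat{u}](0)=\begin{cases}0,&\text{if }|\nu|<\tau,\\ \partial^\nu[\widehat{\upsilon_a}\widehat{\partial^\mu\eta}](0),&\text{if }|\nu|=\tau\in\mathbb{N}_0.\end{cases}$$ (2) The function $\partial^\mu\eta$ is compactly supported and is given by $$\widehat{\partial^\mu\eta}(\xi)=\lim_{n\to\infty}\left[\mathsf{M}^{\tau n}\Big(\prod_{j=1}^n\widehat{a}(\mathsf{M}^{-j}\xi)\Big)\widehat{u}(\mathsf{M}^{-n}\xi)\right],\quad\xi\in\mathbb{R}^d,$$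 where $\prod_{j=1}^n\widehat a(\mathsf{M}^{-j}\xi)=\widehat a(\mathsf{M}^{-1}\xi)\widehat a(\mathsf{M}^{-2}\xi)\cdots\widehat a(\mathsf{M}^{-n}\xi)$. Moreover, $\partial^\mu\eta$ satisfies the refinable relation $\widehat{\partial^\mu\eta}(\mathsf{M}\xi)=\mathsf{M}^{\tau}\widehat{a}(\xi)\widehat{\partial^\mu\eta}(\xi)$ for all $\xi\in\mathbb{R}^d$. (3) For all $w\in l_0(\mathbb{Z}^d)$, $\displaystyle\lim_{n\to\infty}\left\|\mathsf{M}^{\tau n}[\mathcal{S}_{a,\mathsf{M}I_d}^n(\boldsymbol{\delta}I_r)]*(u*w)-\widehat{w}(0)\,\partial^\mu\eta(\mathsf{M}^{-n}\cdot)\right\|_{(l_\infty(\mathbb{Z}^d))^{r\times1}}=0.$ Suppose, in addition, that $\tau\in[0,m]$, that $\partial^\mu\eta$ is not identically zero, and that $1$ is a simple eigenvalue of $\widehat a(0)$ and all other eigenvalues of $\widehat a(0)$ are smaller than $\mathsf{M}^{-m}$ in modulus. Let $\phi$ be the unique $r\times1$ vector of compactly supported distributions that satisfies $\widehat\phi(\mathsf{M}\xi)=\widehat a(\xi)\widehat\phi(\xi)$ and $\widehat{\upsilon_a}(0)\widehat\phi(0)=1$. Then: (4) $\tau\ge|\mu|=m_0$ is given by $$\tau=\inf\{N\in\mathbb{N}_0:\ \partial^\nu[\widehat{\partial^\mu\eta}](0)\ne0\text{ for some }\nu\in\mathbb{N}_0^d\text{ with }|\nu|=N,\text{ and }\partial^\alpha[\widehat{\partial^\mu\eta}](0)=0\text{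 for all }\alpha\in\mathbb{N}_0^d\text{ with }|\alpha|\le N-1\}.$$ In particular, $\tau=|\mu|$ if $\widehat\eta(0)\ne0$, and in this case $\phi\in(C^{m_0}(\mathbb{R}^d))^{r\times1}$ and $\eta=c\phi$ for some $c\in\mathbb{C}\setminus\{0\}$. (5) The filter $u$ must satisfy $$\widehat{\upsilon_a}(\xi)\widehat u(\xi)=\beta_{\upsilon_a,u,\mu}(i\xi)^\mu+O(\|\xi\|^{m_0+1}),\quad\xi\to0,\qquad\text{where }\beta_{\upsilon_a,u,\mu}:=\frac{\partial^\mu[\widehat{\upsilon_a}\widehat u](0)}{i^{m_0}\mu!}.$$ Moreover, for every input data $v\in(l_0(\mathbb{Z}^d))^{1\times r}$, $$\lim_{n\to\infty}\left\|\mathsf{M}^{\tau n}[\mathcal{S}_{a,\mathsf{M}I_d}^nv]*u-\partial^\mu[v*\eta](\mathsf{M}^{-n}\cdot)\right\|_{l_\infty(\mathbb{Z}^d)}=0 .$$ In particular, when $\widehat\eta(0)\ne0$, we have $\eta=\beta_{\upsilon_a,u,\mu}\phi$ and, for every $v\in(l_0(\mathbb{Z}^d))^{1\times r}$, $$\lim_{n\to\infty}\left\|\mathsf{M}^{|\mu|n}[\mathcal{S}_{a,\mathsf{M}I_d}^nv]*u-\beta_{\upsilon_a,u,\mu}\partial^\mu[v*\phi](\mathsf{M}^{-n}\cdot)\right\|_{l_\infty(\mathbb{Z}^d)}=0 .$$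
   Context: Notation. $\mathbb{N}_0=\mathbb{N}\cup\{0\}$; for $\mu=(\mu_1,\dots,\mu_d)\in\mathbb{N}_0^d$, $|\mu|=\mu_1+\dots+\mu_d$, $\mu!=\mu_1!\cdots\mu_d!$, $\partial^\mu=\partial_1^{\mu_1}\cdots\partial_d^{\mu_d}$. $I_r$ is the $r\times r$ identity matrix. $(l_0(\mathbb{Z}^d))^{r\times s}$ is the space of finitely supported sequences (filters) $u:\mathbb{Z}^d\to\mathbb{C}^{r\times s}$; $\widehat{u}(\xi)=\sum_{k\in\mathbb{Z}^d}u(k)e^{-ik\cdot\xi}$. For functions, $\widehat f(\xi)=\int_{\mathbb{R}^d}f(x)e^{-ix\cdot\xi}dx$, extended to tempered distributions, entrywise for vectors. The norm on $(l_\infty(\mathbb{Z}^d))^{r\times s}$ is the sum of the sup norms of the entries; functions $f(\mathsf{M}^{-n}\cdot)$ appearing in such norms are restricted to $\mathbb{Z}^d$. $C^{m_0}(\mathbb{R}^d)$ is the space of $m_0$-times continuously differentiable functions. $\boldsymbol{\delta}(0)=1$ and $\boldsymbol{\delta}(k)=0$ for $k\neq0$ (also used for its restriction to $\mathbb{Z}^d$). Convolution of filters: $[v*w](k)=\sum_{z\in\mathbb{Z}^d}v(z)w(k-z)$; semi-convolution of a filter $v$ with a matrix-valued function $f$: $[v*f](x)=\sum_{k\in\mathbb{Z}^d}v(k)f(x-k)$. For matrices of smooth functions, $f(\xi)=g(\xi)+O(\|\xi\|^{j})$, $\xi\to0$, means $\partial^\nu f(0)=\partial^\nu g(0)$ for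 all $\nu\in\mathbb{N}_0^d$ with $|\nu|\le j-1$. The subdivision operator is $[\mathcal{S}_{a,\mathsf{M}I_d}v](k)=\mathsf{M}^d\sum_{z\in\mathbb{Z}^d}v(z)a(k-\mathsf{M}z)$ for $v\in(l_0(\mathbb{Z}^d))^{s\times r}$, $k\in\mathbb{Z}^d$. Let $\Omega_{\mathsf{M}I_d}=[\mathsf{M}^{-1}\mathbb{Z}^d]\cap[0,1)^d$. A filter $\upsilon_a\in(l_0(\mathbb{Z}^d))^{1\times r}$ is an order $m+1$ matching filter of $a$ with respect to $\mathsf{M}I_d$ if $\widehat{\upsilon_a}(0)\neq0$ and $\widehat{\upsilon_a}(\mathsf{M}\xi)\widehat{a}(\xi+2\pi\omega)=\boldsymbol{\delta}(\omega)\widehat{\upsilon_a}(\xi)+O(\|\xi\|^{m+1})$, $\xi\to0$, for all $\omega\in\Omega_{\mathsf{M}I_d}$. It is known that under the stated eigenvalue condition on $\widehat a(0)$ the vector $\phi$ exists and is unique.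
   Formalization: The bound τ ≥ |μ| in (4), every claim made under η̂(0) ≠ 0 in (4) and (5), and the expansion of υ̂_a û in (5) are stated for η integrable on R^d; without this they fail, e.g. for η an antiderivative of the hat function with μ = 1, τ = 0. *)

(* Defs.v *)
From HB Require Import structures.
From mathcomp Require Import all_boot all_order all_algebra.
From mathcomp Require Import complex.
From mathcomp Require Import all_classical all_reals all_analysis.

Set Implicit Arguments.
Unset Strict Implicit.
Unset Printing Implicit Defensive.

Import Order.TTheory GRing.Theory Num.Theory.
Import numFieldNormedType.Exports.

Local Open Scope classical_set_scope.
Local Open Scope ring_scope.

(* Lebesgue measure on R^n, on the product sigma-algebra of n.-tuple R: the
   n-fold product of the one-dimensional Lebesgue measure, transported along
   (x, t) |-> x :: t. *)
Section LebesgueRn.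
Variable R : realType.

Definition consT n (p : measurableTypeR R * n.-tuple (measurableTypeR R)) :
  n.+1.-tuple (measurableTypeR R) := [tuple of p.1 :: p.2].

Lemma measurable_consT n : measurable_fun [set: _] (@consT n).
Proof. exact: measurable_cons. Qed.

Section Step.
Variables (n : nat)
  (mu : {sigma_finite_measure set (n.-tuple (measurableTypeR R)) -> \bar R}).

Definition leb_step : set (n.+1.-tuple (measurableTypeR R)) -> \bar R :=
  pushforward (@lebesgue_measure R \x mu)%E (@consT n).

Let leb_step0 : leb_step set0 = 0%E.
Proof. by rewrite /leb_step /pushforward preimage_set0 measure0. Qed.

Let leb_step_ge0 A : (0 <= leb_step A)%E.
Proof. by rewrite /leb_step /pushforward; exact: measure_ge0. Qed.

Let leb_step_sigma_additive : semi_sigma_additive leb_step.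
Proof.
move=> F mF tF mUF; rewrite /leb_step /pushforward preimage_bigcup.
have mp A : measurable A -> measurable (@consT n @^-1` A).
  by move=> mA; rewrite -[X in measurable X]setTI; exact: measurable_consT.
apply: measure_semi_sigma_additive.
- by move=> k; exact: mp.
- apply/trivIsetP => /= i j _ _ ij; rewrite -preimage_setI.
  by move/trivIsetP : tF => /(_ _ _ _ _ ij) ->//; rewrite preimage_set0.
- by rewrite -preimage_bigcup; exact: mp.
Qed.

HB.instance Definition _ := isMeasure.Build _ _ _
  leb_step leb_step0 leb_step_ge0 leb_step_sigma_additive.

Let leb_step_sigma_finite : sigma_finite setT leb_step.
Proof.
pose uncons (t : n.+1.-tuple (measurableTypeR R)) :
  measurableTypeR R * n.-tuple (measurableTypeR R) := (thead t, [tuple of behead t]).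
have consK p : uncons (consT p) = p.
  by case: p => x t; congr pair; apply/val_inj.
have muncons : measurable_fun setT uncons.
  by apply/measurable_fun_pair; [exact: measurable_tnth | exact: measurable_behead].
have /sigma_finiteP[F [TF ndF Foo]] := sigma_finiteT (@lebesgue_measure R).
have /sigma_finiteP[G [TG ndG Goo]] := sigma_finiteT mu.
exists (fun k => uncons @^-1` (F k `*` G k)).
  apply/seteqP; split => // t _ /=.
  have [k _ Fk] : (\bigcup_k F k) (uncons t).1 by rewrite -TF.
  have [l _ Gl] : (\bigcup_k G k) (uncons t).2 by rewrite -TG.
  exists (maxn k l) => //; split.
  - by move: Fk; exact/subsetPset/ndF/leq_maxl.
  - by move: Gl; exact/subsetPset/ndG/leq_maxr.
move=> k; have [? ?] := Foo k; have [? ?] := Goo k; split.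
  by rewrite -[X in measurable X]setTI; apply: muncons => //; exact: measurableX.
rewrite /leb_step /pushforward -comp_preimage.
rewrite (_ : uncons \o @consT n = id); last by apply/funext => p; exact: consK.
by rewrite preimage_id product_measure1E// lte_mul_pinfty// ge0_fin_numE.
Qed.

HB.instance Definition _ := Measure_isSigmaFinite.Build _ _ _
  leb_step leb_step_sigma_finite.

End Step.

Fixpoint lebesgue_Rn n :
    {sigma_finite_measure set (n.-tuple (measurableTypeR R)) -> \bar R} :=
  match n with
  | 0 => \d_([tuple] : 0.-tuple (measurableTypeR R))
  | n'.+1 => leb_step (lebesgue_Rn n')
  end.

End LebesgueRn.

Section Calculus.
Variables (R : realType) (d : nat).
Local Notation reC := (@complex.Re R).
Local Notation imC := (@complex.Im R).
Local Notation C := R[i].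
Local Notation V := 'rV[R]_d.

Definition mabs (mu : 'I_d -> nat) : nat := (\sum_i mu i)%N.

Definition mfact (mu : 'I_d -> nat) : nat := (\prod_i (mu i)`!)%N.

Definition pderiv (i : 'I_d) (f : V -> R) : V -> R :=
  fun x => 'D_(delta_mx 0 i) f x.

Definition mderiv (mu : 'I_d -> nat) (f : V -> R) : V -> R :=
  foldr (fun i g => iter (mu i) (pderiv i) g) f (enum 'I_d).

Fixpoint Cn (k : nat) (f : V -> R) : Prop :=
  match k with
  | 0 => continuous f
  | k'.+1 => continuous f /\
      forall i, (forall x, derivable f x (delta_mx 0 i)) /\ Cn k' (pderiv i f)
  end.

(* Complex-valued functions of real variables are differentiated and integrated
   through their real and imaginary parts. *)
Definition CnC (k : nat) (f : V -> C) : Prop :=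
  Cn k (reC \o f) /\ Cn k (imC \o f).

Definition mderivC (mu : 'I_d -> nat) (f : V -> C) : V -> C :=
  fun x => Complex (mderiv mu (reC \o f) x) (mderiv mu (imC \o f) x).

Definition CnM r s (k : nat) (F : V -> 'M[C]_(r, s)) : Prop :=
  forall i j, CnC k (fun x => F x i j).

Definition mderivM r s (mu : 'I_d -> nat) (F : V -> 'M[C]_(r, s)) :
    V -> 'M[C]_(r, s) :=
  fun x => \matrix_(i, j) mderivC mu (fun y => F y i j) x.

(* F(xi) = G(xi) + O(|xi|^j) as xi -> 0 *)
Definition eq_bigO r s (F G : V -> 'M[C]_(r, s)) (j : nat) : Prop :=
  forall nu : 'I_d -> nat, (mabs nu < j)%N -> mderivM nu F 0 = mderivM nu G 0.

Definition compact_support (T : nmodType) (f : V -> T) : Prop :=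
  exists B : R, forall x, B < `|x| -> f x = 0.

Definition row_of_tuple (t : d.-tuple (measurableTypeR R)) : V :=
  \row_i (tnth t i : R).

Definition intRn (f : V -> C) : C :=
  Complex (\int[lebesgue_Rn R d]_t reC (f (row_of_tuple t)))
          (\int[lebesgue_Rn R d]_t imC (f (row_of_tuple t))).

(* fourier F is meaningful only for integrable F: the integral of a
   non-integrable function takes a junk value. A C^k function eta whose
   derivative of order mu has compact support need not be integrable, e.g. an
   antiderivative on the line of a bump function with nonzero integral. *)
Definition integrableM r s (F : V -> 'M[C]_(r, s)) : Prop :=
  forall i j,
    (lebesgue_Rn R d).-integrable setT
      (fun t => (reC (F (row_of_tuple t) i j))%:E) /\
    (lebesgue_Rn R d).-integrable setT
      (fun t => (imC (F (row_of_tuple t) i j))%:E).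

Definition dotp (x y : V) : R := \sum_j x 0 j * y 0 j.

Definition expi (t : R) : C := Complex (cos t) (sin t).

Definition fourier r s (F : V -> 'M[C]_(r, s)) : V -> 'M[C]_(r, s) :=
  fun xi => \matrix_(i, j) intRn (fun x => F x i j * expi (- dotp x xi)).

(* A compactly supported distribution is a continuous linear functional on
   C^oo(R^d); only its values on smooth functions are meaningful. *)
Definition smooth (f : V -> C) : Prop := forall k, CnC k f.

Definition compact_distribution (T : (V -> C) -> C) : Prop :=
  (forall (c : C) (f g : V -> C), smooth f -> smooth g ->
    T (fun x => c * f x + g x) = c * T f + T g) /\
  (exists (B : R) (N : nat) (K : R), forall (f : V -> C) (b : R), smooth f ->
    (forall (al : 'I_d -> nat) (x : V), (mabs al <= N)%N -> `|x| <= B ->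
       ComplexField.Normc.normc (mderivC al f x) <= b) ->
    ComplexField.Normc.normc (T f) <= K * b).

Definition fourier_dist r (phi : 'I_r -> (V -> C) -> C) : V -> 'cV[C]_r :=
  fun xi => \col_i phi i (fun x => expi (- dotp x xi)).

(* phi is the vector of regular distributions given by the function g *)
Definition represented_by r (phi : 'I_r -> (V -> C) -> C) (g : V -> 'cV[C]_r) :
    Prop :=
  forall i (psi : V -> C), smooth psi -> compact_support psi ->
    phi i psi = intRn (fun x => g x i 0 * psi x).

End Calculus.

Section Filters.
Variables (R : realType) (d : nat).
Local Notation C := R[i].
Local Notation V := 'rV[R]_d.
Local Notation Zd := 'rV[int]_d.

(* Filters are functions on Z^d together with the hypothesis l0; the sums
   \sum_(k \in setT) below have finitely many nonzero terms for such filters. *)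
Definition l0 r s (u : Zd -> 'M[C]_(r, s)) : Prop :=
  finite_set [set k | u k != 0].

Definition zvec (k : Zd) : V := map_mx intr k.

Definition symbol r s (u : Zd -> 'M[C]_(r, s)) : V -> 'M[C]_(r, s) :=
  fun xi => \sum_(k \in [set: Zd]) expi (- dotp (zvec k) xi) *: u k.

Definition fconv r s t (v : Zd -> 'M[C]_(r, s)) (w : Zd -> 'M[C]_(s, t)) :
    Zd -> 'M[C]_(r, t) :=
  fun k => \sum_(z \in [set: Zd]) v z *m w (k - z).

Definition semiconv r s t (v : Zd -> 'M[C]_(r, s)) (f : V -> 'M[C]_(s, t)) :
    V -> 'M[C]_(r, t) :=
  fun x => \sum_(k \in [set: Zd]) v k *m f (x - zvec k).

Definition deltaI r : Zd -> 'M[C]_r := fun k => if k == 0 then 1%:M else 0.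

Definition subdiv M r s (a : Zd -> 'M[C]_r) (v : Zd -> 'M[C]_(s, r)) :
    Zd -> 'M[C]_(s, r) :=
  fun k => (M%:R ^+ d) *: \sum_(z \in [set: Zd]) v z *m a (k - z *+ M).

Definition Omega (M : nat) : set V :=
  [set w | (exists k : Zd, w = M%:R^-1 *: zvec k) /\
           forall j, 0 <= w 0 j < 1].

Definition matching_filter M r (a : Zd -> 'M[C]_r) (ups : Zd -> 'rV[C]_r)
    (N : nat) : Prop :=
  [/\ l0 ups, symbol ups 0 != 0 &
    forall w, Omega M w ->
      eq_bigO (fun xi => symbol ups (M%:R *: xi) *m
                         symbol a (xi + (2 * pi) *: w))
              (fun xi => (w == 0)%:R *: symbol ups xi) N].

(* Extended-real valued: the real sup of an unbounded set is 0. *)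
Definition linf_norm r s (f : Zd -> 'M[C]_(r, s)) : \bar R :=
  (\sum_(i < r) \sum_(j < s)
    ereal_sup [set (ComplexField.Normc.normc (f k i j))%:E | k in [set: Zd]])%E.

Definition rescaled_cvg M (tau : R) r s (F : nat -> Zd -> 'M[C]_(r, s))
    (g : V -> 'M[C]_(r, s)) : Prop :=
  (fun n => linf_norm (fun k =>
     (real_complex R (M%:R `^ (tau * n%:R))) *: F n k
       - g (M%:R ^- n *: zvec k))) @ \oo --> 0%E.

Definition cvg_mx r s (F : nat -> 'M[C]_(r, s)) (L : 'M[C]_(r, s)) : Prop :=
  forall i j, (fun n => ComplexField.Normc.normc (F n i j - L i j)) @ \oo
    --> (0 : R).

(* 1 is an algebraically simple eigenvalue of A and every other eigenvalue has
   modulus smaller than rho. *)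
Definition simple_dominant_one r (A : 'M[C]_r) (rho : R) : Prop :=
  mup 1 (char_poly A) = 1%N /\
  forall lam, eigenvalue A lam -> lam != 1 -> ComplexField.Normc.normc lam < rho.

Definition refinable_vector M r (a : Zd -> 'M[C]_r) (ups : Zd -> 'rV[C]_r)
    (phi : 'I_r -> (V -> C) -> C) : Prop :=
  [/\ forall i, compact_distribution (phi i),
      forall xi, fourier_dist phi (M%:R *: xi) = symbol a xi *m fourier_dist phi xi
    & symbol ups 0 *m fourier_dist phi 0 = 1%:M].

Definition ipow (mu : 'I_d -> nat) (xi : V) : C :=
  \prod_j (Complex 0 1 * real_complex R (xi 0 j)) ^+ mu j.

Definition beta_coef r (ups : Zd -> 'rV[C]_r) (u : Zd -> 'cV[C]_r)
    (mu : 'I_d -> nat) : C :=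
  mderivM mu (fun xi => symbol ups xi *m symbol u xi) 0 0 0
    / (Complex 0 1 ^+ mabs mu * (mfact mu)%:R).

End Filters.

(* Main.v *)
(** Write g for the derivative of eta of order mu. The supports of the filters S_a^n(delta I_r) * u lie in
    M^n K for a fixed cube K, and the M-adic points are dense, so g has compact support, and pairing
    the uniform limit with a continuous function p turns sums M^(-dn) sum_k p(M^(-n) k) (...) into
    integrals of g p. Exponentials p give (2) and (3); monomials p give (1), because the subdivision
    operator acts on the moments of the matching filter of order at most m by a scalar.
    Since g <> 0 has a nonzero moment, its moments of lowest order N form an eigenvector of a^(0) for the
    eigenvalue M^(N - tau) >= M^(-m); hence N = tau, which is (4).
    If eta is integrable, iterated differences in directions going to infinity along a half-space show
    that eta vanishes where g does; so g^(xi) = (i xi)^mu eta^(xi), which gives (5) by Leibniz' rule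
    at 0 and, when eta^(0) <> 0, makes eta^ a solution of the refinement equation of phi^. Solutions
    that are Lipschitz at 0 are determined by their value there, since the powers of a^(0) grow slower
    than M^n, and simplicity of the eigenvalue 1 determines that value up to a factor. Finally, a compactly
    supported distribution is determined by its exponential moments: test functions are
    mollified by the trigonometric kernels prod_j ((1 + cos (y_j / D)) / 2)^n. *)

Require Import Defs.
From HB Require Import structures.
From mathcomp Require Import all_boot all_order all_algebra.
From mathcomp Require Import complex.
From mathcomp Require Import all_classical all_reals all_analysis.
From mathcomp Require Import measurable_realfun.
From mathcomp Require Import zify ring lra.

Set Implicit Arguments.
Unset Strict Implicit.
Unset Printing Implicit Defensive.

Import Order.TTheory GRing.Theory Num.Theory.
Import numFieldNormedType.Exports.

Local Open Scope classical_set_scope.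
Local Open Scope ring_scope.

(** The hypothesis controls the limit only on M-adic points, through finite lattice sums. The
    integral is therefore handled as a limit of Riemann sums: linearity, translation and dilation
    are inherited from sums over Z^d, and pairing a cascade with a function is itself nearly a
    Riemann sum of mesh M^(-n). Derivatives and moments are indexed by words in the coordinates,
    which turns statements about mixed derivatives into inductions on lists and keeps the order of
    differentiation of the definition. Half-spaces enter because the complement of a cube is not
    convex, while each of its points lies in a half-space that avoids the cube and is stable under
    the moves that integrate a vanishing mixed derivative. For phi only exponential moments are
    known, so the mollifier has to be a trigonometric polynomial; it has to commute with derivatives
    because phi may have any finite order. The rate (3/2)^n follows from eigenvalues of modulus at
    most 1, without a spectral decomposition, and against M^(-n) with M >= 2 it leaves the ratio
    3/4. *)

Local Notation normc := ComplexField.Normc.normc.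
Local Notation zabs k i := (absz (fun_of_matrix k 0%R i)).

(** * Complex moduli, limits and sums over the lattice *)

Section ComplexModulus.
Variable R : realType.
Local Notation C := R[i].
Local Notation rc := (real_complex R).
Implicit Types z w : C.

Lemma cReD z w : complex.Re (z + w) = complex.Re z + complex.Re w.
Proof. by case: z; case: w. Qed.

Lemma cImD z w : complex.Im (z + w) = complex.Im z + complex.Im w.
Proof. by case: z; case: w. Qed.

Lemma cReN z : complex.Re (- z) = - complex.Re z.
Proof. by case: z. Qed.

Lemma cImN z : complex.Im (- z) = - complex.Im z.
Proof. by case: z. Qed.

Lemma cReM z w :
  complex.Re (z * w) = complex.Re z * complex.Re w - complex.Im z * complex.Im w.
Proof. by case: z; case: w. Qed.

Lemma cImM z w :
  complex.Im (z * w) = complex.Re z * complex.Im w + complex.Im z * complex.Re w.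
Proof. by case: z; case: w. Qed.

Lemma cRe_sum I (s : seq I) (F : I -> C) :
  complex.Re (\sum_(i <- s) F i) = \sum_(i <- s) complex.Re (F i).
Proof. by elim/big_rec2: _ => //= i y1 y2 _ <-; rewrite cReD. Qed.

Lemma cIm_sum I (s : seq I) (F : I -> C) :
  complex.Im (\sum_(i <- s) F i) = \sum_(i <- s) complex.Im (F i).
Proof. by elim/big_rec2: _ => //= i y1 y2 _ <-; rewrite cImD. Qed.

Lemma complexP z w : complex.Re z = complex.Re w -> complex.Im z = complex.Im w ->
  z = w.
Proof. by case: z => a b; case: w => c e /= -> ->. Qed.

Lemma normc_ge0 z : 0 <= normc z.
Proof. by case: z => a b; exact: sqrtr_ge0. Qed.

Lemma normc_eq0 z : (normc z == 0) = (z == 0).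
Proof.
by apply/eqP/eqP => [/ComplexField.Normc.eq0_normc //|->]; rewrite ComplexField.Normc.normc0.
Qed.

Lemma normc_rc (x : R) : normc (rc x) = `|x|.
Proof. by rewrite /ComplexField.Normc.normc /= expr0n addr0 sqrtr_sqr. Qed.

Lemma normc_Re z : `|complex.Re z| <= normc z.
Proof.
by case: z => a b /=; rewrite -sqrtr_sqr ler_wsqrtr// lerDl sqr_ge0.
Qed.

Lemma normc_Im z : `|complex.Im z| <= normc z.
Proof.
by case: z => a b /=; rewrite -sqrtr_sqr ler_wsqrtr// lerDr sqr_ge0.
Qed.

Lemma normc_le_ReIm z : normc z <= `|complex.Re z| + `|complex.Im z|.
Proof.
case: z => a b /=; rewrite -(@ler_pXn2r _ 2) ?nnegrE ?sqrtr_ge0 ?addr_ge0//.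
rewrite sqr_sqrtr ?addr_ge0 ?sqr_ge0// sqrrD !real_normK ?num_real//.
by rewrite -addrA lerD2l lerDr mulrn_wge0// mulr_ge0.
Qed.

Lemma normcB_sym z w : normc (z - w) = normc (w - z).
Proof. by rewrite -normcN opprB. Qed.

Lemma normc_distD (x z w : C) : normc (x - w) <= normc (x - z) + normc (z - w).
Proof. by rewrite -[x - w](subrKA z); exact: le_normcD. Qed.

Lemma normc_sum I (s : seq I) (P : pred I) (F : I -> C) :
  normc (\sum_(i <- s | P i) F i) <= \sum_(i <- s | P i) normc (F i).
Proof.
elim/big_rec2: _ => [|i y1 y2 _ ih]; first by rewrite ComplexField.Normc.normc0.
by apply: (le_trans (le_normcD _ _)); rewrite lerD2l.
Qed.

Lemma normcX z n : normc (z ^+ n) = normc z ^+ n.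
Proof.
elim: n => [|n ih]; first by rewrite !expr0 ComplexField.Normc.normc1.
by rewrite !exprS ComplexField.Normc.normcM ih.
Qed.

Lemma rcD (x y : R) : rc (x + y) = rc x + rc y. Proof. exact: rmorphD. Qed.
Lemma rcN (x : R) : rc (- x) = - rc x. Proof. exact: rmorphN. Qed.
Lemma rcB (x y : R) : rc (x - y) = rc x - rc y. Proof. exact: rmorphB. Qed.
Lemma rcM (x y : R) : rc (x * y) = rc x * rc y. Proof. exact: rmorphM. Qed.
Lemma rcX (x : R) n : rc (x ^+ n) = rc x ^+ n. Proof. exact: rmorphXn. Qed.
Lemma rcV (x : R) : rc x^-1 = (rc x)^-1. Proof. exact: fmorphV. Qed.

Lemma rc_sum I (s : seq I) (F : I -> R) :
  rc (\sum_(i <- s) F i) = \sum_(i <- s) rc (F i).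
Proof. exact: rmorph_sum. Qed.

Lemma rc_inj (x y : R) : rc x = rc y -> x = y.
Proof. by case. Qed.

Lemma normc_small z : (forall e : R, 0 < e -> normc z <= e) -> z = 0.
Proof.
move=> h; apply/eqP; rewrite -normc_eq0 eq_le normc_ge0 andbT.
by apply/ler_addgt0Pr => e /h; rewrite add0r.
Qed.

Lemma rc_natr n : rc n%:R = n%:R :> C.
Proof. by rewrite rmorph_nat. Qed.

End ComplexModulus.

Section ComplexLimits.
Variable R : realType.
Local Notation C := R[i].
Implicit Types (z w : nat -> C).

Definition cvgC z (l : C) := forall e : R, 0 < e ->
  exists N, forall n, (N <= n)%N -> normc (z n - l) <= e.

Lemma cvgC_cvg z l : cvgC z l <-> (fun n => normc (z n - l)) @ \oo --> (0 : R).
Proof.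
split=> [h|/cvgrPdist_le h e e0].
  apply/cvgrPdist_le => e /h[N hN]; near=> n.
  rewrite sub0r normrN ger0_norm ?normc_ge0//; apply: hN.
  by near: n; exact: nbhs_infty_ge.
have [N _ hN] := h e e0; exists N => n Nn.
by have := hN n Nn; rewrite sub0r normrN ger0_norm ?normc_ge0.
Unshelve. all: by end_near. Qed.

Lemma cvgC_unique z l l' : cvgC z l -> cvgC z l' -> l = l'.
Proof.
move=> h h'; apply/eqP; rewrite -subr_eq0; apply/eqP; apply: normc_small => e e0.
have e2 : 0 < e / 2 by rewrite divr_gt0.
have [N hN] := h _ e2; have [N' hN'] := h' _ e2.
have := hN _ (leq_maxl N N'); have := hN' _ (leq_maxr N N').
rewrite (normcB_sym _ l) => h1 h2; apply: (le_trans (normc_distD _ (z (maxn N N')) _)).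
by rewrite [leRHS]splitr lerD.
Qed.

Lemma cvgC_cst (l : C) : cvgC (fun=> l) l.
Proof.
by move=> e e0; exists 0%N => n _; rewrite subrr ComplexField.Normc.normc0 ltW.
Qed.

Lemma cvgC_ext z w l : (forall n, z n = w n) -> cvgC z l -> cvgC w l.
Proof. by move=> /funext->. Qed.

Lemma cvgC_ext_pos z w l : (forall n, (0 < n)%N -> z n = w n) -> cvgC z l -> cvgC w l.
Proof.
move=> zw h e /h[N hN]; exists N.+1 => n Nn; rewrite -zw; last exact: leq_trans Nn.
by apply: hN; exact: ltnW.
Qed.

Lemma cvgCD z w l l' : cvgC z l -> cvgC w l' -> cvgC (fun n => z n + w n) (l + l').
Proof.
move=> h h' e e0; have e2 : 0 < e / 2 by rewrite divr_gt0.
have [N hN] := h _ e2; have [N' hN'] := h' _ e2.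
exists (maxn N N') => n; rewrite geq_max => /andP[/hN h1 /hN' h2].
rewrite opprD addrACA (le_trans (le_normcD _ _))//.
by rewrite [leRHS]splitr lerD.
Qed.

Lemma cvgCMl (c : C) z l : cvgC z l -> cvgC (fun n => c * z n) (c * l).
Proof.
move=> h e e0; have c0 : 0 < normc c + 1 by rewrite ltr_wpDl ?normc_ge0.
have [N hN] := h _ (divr_gt0 e0 c0); exists N => n /hN hn.
rewrite -mulrBr ComplexField.Normc.normcM.
apply: (le_trans (ler_wpM2l (normc_ge0 c) hn)).
rewrite mulrCA ger_pMr// ler_pdivrMr// mul1r lerDl//.
Qed.

Lemma cvgC_near z w l : cvgC z l -> cvgC (fun n => w n - z n) 0 -> cvgC w l.
Proof.
move=> h h'; rewrite -[l]addr0; apply: cvgC_ext (cvgCD h h') => n.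
by rewrite addrC subrK.
Qed.

Lemma cvgC_bound z l (K : R) : (forall n, normc (z n) <= K) -> cvgC z l ->
  normc l <= K.
Proof.
move=> zK h; apply/ler_addgt0Pr => e /h[N /(_ N (leqnn N)) hN].
rewrite -[l](subrKC (z N)) (le_trans (le_normcD _ _))// lerD//.
by rewrite normcB_sym.
Qed.

Lemma cvgC_sub z l (f : nat -> nat) : (forall n, (n <= f n)%N) -> cvgC z l ->
  cvgC (z \o f) l.
Proof.
move=> hf h e /h[N hN]; exists N => n Nn; apply: hN; exact: leq_trans (hf n).
Qed.

End ComplexLimits.

Section LatticeSums.
Variable d : nat.
Local Notation Zd := 'rV[int]_d.

(** The lattice cube of radius [L], encoded as the image of a finite function space: its cardinality
    (2L+1)^d and the absence of repetitions are then immediate. *)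
Definition box L : seq Zd :=
  [seq \row_i ((f i)%:Z - L%:Z) | f : {ffun 'I_d -> 'I_(L.*2.+1)}].

Lemma mem_box L (k : Zd) : (k \in box L) = [forall i, (zabs k i <= L)%N].
Proof.
apply/idP/forallP => [/mapP[f _ ->] i|h].
  by rewrite mxE; case: (f i) => n /=; lia.
apply/(@mapP {ffun 'I_d -> 'I_(L.*2.+1)}); exists [ffun i => inord (absz (k 0 i + L%:Z))]; first by rewrite mem_enum.
apply/rowP => i; rewrite mxE ffunE.
have hz (z : int) : (absz z <= L)%N ->
  (absz (z + L%:Z)%R < L.*2.+1)%N /\ z = (absz (z + L%:Z))%:Z - L%:Z by lia.
by have [h1 h2] := hz _ (h i); rewrite inordK.
Qed.

Lemma box_uniq L : uniq (box L).
Proof.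
rewrite map_inj_uniq ?enum_uniq// => f g /rowP fg.
apply/ffunP => i; apply/val_inj; have := fg i; rewrite !mxE /=.
by case: (f i) => ? ? /=; case: (g i) => ? ? /=; lia.
Qed.

Lemma size_box L : size (box L) = (L.*2.+1 ^ d)%N.
Proof. by rewrite size_map -cardE card_ffun !card_ord. Qed.

Lemma box_sub L L' k : (L <= L')%N -> k \in box L -> k \in box L'.
Proof.
by rewrite !mem_box => LL' /forallP h; apply/forallP => i; exact: leq_trans (h i) LL'.
Qed.

Lemma boxD L L' (k k' : Zd) : k \in box L -> k' \in box L' -> k + k' \in box (L + L').
Proof.
rewrite !mem_box => /forallP h /forallP h'; apply/forallP => i.
by rewrite mxE; move: (h i) (h' i); move: (k 0 i) (k' 0 i) => a b; lia.
Qed.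

Lemma boxN L (k : Zd) : (- k \in box L) = (k \in box L).
Proof. by rewrite !mem_box; apply: eq_forallb => i; rewrite mxE abszN. Qed.

Lemma boxMn L n (k : Zd) : k \in box L -> k *+ n \in box (n * L).
Proof.
rewrite !mem_box => /forallP h; apply/forallP => i; rewrite mulmxnE.
by rewrite -mulr_natr natz abszM absz_nat mulnC leq_mul2l h orbT.
Qed.

Lemma mem_box0 k : (k \in box 0) = (k == 0).
Proof.
rewrite mem_box; apply/forallP/eqP => [h|-> i]; last by rewrite mxE.
by apply/rowP => i; have := h i; rewrite leqn0 absz_eq0 mxE => /eqP.
Qed.

Lemma big_box0 (V : nmodType) (F : Zd -> V) : \sum_(k <- box 0) F k = F 0.
Proof.
rewrite (perm_big [:: 0]) ?big_seq1//.
by apply: uniq_perm; rewrite ?box_uniq// => k; rewrite mem_box0 inE.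
Qed.

(** Finite support with an explicit radius: radii can be added, multiplied by M and compared along
    iterations, and sums over the lattice become sums over a list. *)
Definition fsupp (V : nmodType) (F : Zd -> V) :=
  exists L, forall k, k \notin box L -> F k = 0.

Section Generic.
Variable V : nmodType.
Implicit Types F G : Zd -> V.

Lemma fsum_box F L : (forall k, k \notin box L -> F k = 0) ->
  \sum_(k \in [set: Zd]) F k = \sum_(k <- box L) F k.
Proof.
move=> h; rewrite (@fsbigE _ _ _ _ _ (box L)) ?box_uniq//; last by move=> k _; exact: h.
by apply: eq_bigl => k; rewrite in_setT.
Qed.

Lemma fsuppP F : finite_set [set k | F k != 0] <-> fsupp F.
Proof.
split=> [fin|[L h]].
  have /finite_seqP[t Et] := fin.
  exists (\max_(k <- t) \max_i zabs k i)%N => k.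
  apply: contraNeq => Fk; rewrite mem_box; apply/forallP => i.
  have kin : k \in t by have : [set k | F k != 0] k by []; rewrite Et.
  rewrite (big_rem k)//= leq_max; apply/orP; left.
  exact: (@leq_bigmax _ (fun i => zabs k i) i).
apply: (@sub_finite_set _ _ [set` box L]); last by apply/finite_seqP; exists (box L).
by move=> k /=; apply: contraNT => /h ->; rewrite eqxx.
Qed.

Lemma fsupp_bound F G : fsupp F -> (forall k, F k = 0 -> G k = 0) -> fsupp G.
Proof. by move=> [L h] hG; exists L => k /h /hG. Qed.

Lemma fsuppD F G : fsupp F -> fsupp G -> fsupp (fun k => F k + G k).
Proof.
move=> [L h] [L' h']; exists (maxn L L') => k kb.
rewrite h ?h' ?addr0//.
  by apply: contraNN kb; exact/box_sub/leq_maxr.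
by apply: contraNN kb; exact/box_sub/leq_maxl.
Qed.

Lemma fsumD F G : fsupp F -> fsupp G ->
  \sum_(k \in [set: Zd]) (F k + G k) =
  \sum_(k \in [set: Zd]) F k + \sum_(k \in [set: Zd]) G k.
Proof.
move=> [L h] [L' h'].
have h1 k : k \notin box (maxn L L') -> F k = 0.
  by move=> kb; apply/h; apply: contraNN kb; exact/box_sub/leq_maxl.
have h2 k : k \notin box (maxn L L') -> G k = 0.
  by move=> kb; apply/h'; apply: contraNN kb; exact/box_sub/leq_maxr.
rewrite (fsum_box h1) (fsum_box h2) (@fsum_box _ (maxn L L')) ?big_split//.
by move=> k kb; rewrite h1// h2// addr0.
Qed.

Lemma fsum_shift F z :
  \sum_(k \in [set: Zd]) F (k + z) = \sum_(k \in [set: Zd]) F k.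
Proof.
rewrite [RHS](reindex_fsbigT (fun k => k + z))//.
by exists (fun k => k - z) => k; rewrite ?addrK ?subrK.
Qed.

Lemma fsum_shiftB F z :
  \sum_(k \in [set: Zd]) F (k - z) = \sum_(k \in [set: Zd]) F k.
Proof. exact: fsum_shift. Qed.

Lemma fsum_opp F :
  \sum_(k \in [set: Zd]) F (- k) = \sum_(k \in [set: Zd]) F k.
Proof.
by rewrite [RHS](reindex_fsbigT (fun k => - k)).
Qed.

Lemma fsupp_shift F z : fsupp F -> fsupp (fun k => F (k + z)).
Proof.
move=> [L h]; exists (L + \max_i zabs z i)%N => k kb; apply: h.
apply: contraNN kb => kb; rewrite -[k](addrK z); apply: boxD => //.
by rewrite boxN mem_box; apply/forallP => i; exact: (leq_bigmax i).
Qed.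

Lemma fsupp_sum I (s : seq I) (F : I -> Zd -> V) : (forall i, fsupp (F i)) ->
  fsupp (fun k => \sum_(i <- s) F i k).
Proof.
move=> h; elim: s => [|i s ih]; first by exists 0%N => k _; rewrite big_nil.
have [L hL] := fsuppD (h i) ih; exists L => k kb; rewrite big_cons; exact: hL.
Qed.

Lemma fsum_sum I (s : seq I) (F : I -> Zd -> V) : (forall i, fsupp (F i)) ->
  \sum_(k \in [set: Zd]) \sum_(i <- s) F i k =
  \sum_(i <- s) \sum_(k \in [set: Zd]) F i k.
Proof.
move=> h; elim: s => [|i s ih].
  by rewrite big_nil fsbig1// => k _; rewrite big_nil.
rewrite big_cons -ih -fsumD//; last exact: fsupp_sum.
by apply: eq_fsbigr => k _; rewrite big_cons.
Qed.

End Generic.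

Lemma fsum_morph (V W : nmodType) (f : V -> W) (F : Zd -> V) :
  f 0 = 0 -> {morph f : x y / x + y} -> fsupp F ->
  f (\sum_(k \in [set: Zd]) F k) = \sum_(k \in [set: Zd]) f (F k).
Proof.
move=> f0 fD [L h]; rewrite (fsum_box h) (@fsum_box _ _ L); last by move=> k /h ->.
exact: big_morph.
Qed.

End LatticeSums.
Arguments box {d}.

(** * Lebesgue measure on cubes and Riemann sums *)

Section SupNorm.
Variables (R : realType) (d : nat).
Local Notation V := 'rV[R]_d.

Lemma rV_norm_coord (x : V) i : `|x 0 i| <= `|x|.
Proof.
rewrite [leRHS]/Num.norm /= mx_normrE; apply/bigmax_geP; right => /=.
by exists (0, i).
Qed.

Lemma rV_norm_le (x : V) (c : R) : 0 <= c -> (forall i, `|x 0 i| <= c) -> `|x| <= c.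
Proof.
move=> c0 h; rewrite [leLHS]/Num.norm /= mx_normrE; apply/bigmax_leP; split => // -[i j] _ /=.
by rewrite (ord1 i).
Qed.

Lemma rV_norm_ltP (x : V) (c : R) : 0 <= c -> c < `|x| -> exists i, c < `|x 0 i|.
Proof.
move=> c0 cx; apply/not_existsP => h; move: cx; apply/negP; rewrite -leNgt.
by apply: rV_norm_le => // i; rewrite leNgt; apply/negP/h.
Qed.

(** Only [x] is confined to the ball, [y] may lie outside; this one-sided form spares a discussion
    of the boundary. It follows from compactness of the ball in its near-covering form. *)
Lemma unif_cont_compact (u : V -> R) (B : R) : continuous u ->
  forall e : R, 0 < e -> exists2 dl, 0 < dl & forall x y, `|x| <= B -> `|x - y| < dl ->
    `|u x - u y| <= e.
Proof.
move=> cu e e0.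
have Kc : compact [set x : V | `|x| <= B].
  apply: bounded_closed_compact.
    by exists B; split; [exact: num_real|move=> M BM x /= xB; exact: le_trans xB (ltW BM)].
  apply: (@closed_comp _ _ (fun x : V => `|x|) [set r | r <= B]) => [x _|].
    exact: norm_continuous.
  exact: closed_le.
move/compact_near_coveringP : Kc => /(_ R (0 : R)^'+
  (fun dl x => forall y, `|x - y| < dl -> `|u x - u y| <= e)) [].
  move=> x _; have e2 : 0 < e / 2 by rewrite divr_gt0.
  have /cvgrPdist_le/(_ _ e2)/nbhs_ballP[r /= r0 hr] := cu x.
  (* Halving the radius leaves room for [y]: it stays within [r] of the centre [x] when [z] is
     within [r / 2] of [x]. *)
  exists (ball x (r / 2), [set dl | dl <= r / 2]) => /=.
    split; first by apply: nbhsx_ballx; rewrite divr_gt0.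
    by apply: nbhs_right_le; rewrite divr_gt0.
  case=> z dl /= [zx dlr] y zy.
  move: zx; rewrite -ball_normE /= => zx.
  have h1 : `|u x - u z| <= e / 2.
    apply: hr; rewrite -ball_normE /=; apply: (lt_trans zx).
    by rewrite ltr_pdivrMr// ltr_pMr// ltr1n.
  have h2 : `|u x - u y| <= e / 2.
    apply: hr; rewrite -ball_normE /= -(subrKA z) (le_lt_trans (ler_normD _ _))//.
    by rewrite [ltRHS]splitr ltrD// (lt_le_trans zy).
  rewrite -(subrKA (u x)) (le_trans (ler_normD _ _))// [leRHS]splitr lerD//.
  by rewrite distrC.
move=> dl /= dl0 h; exists (dl / 2); first by rewrite divr_gt0.
move=> x y xB xy; apply: (h (dl / 2)) => //=.
  rewrite /= sub0r normrN ger0_norm ?divr_ge0 ?ltW//.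
  by rewrite ltr_pdivrMr// ltr_pMr// ltr1n.
by rewrite divr_gt0.
Qed.

Lemma cont_bounded_compact (u : V -> R) (B : R) : continuous u ->
  exists K, forall x, `|x| <= B -> `|u x| <= K.
Proof.
move=> cu; have [B0|B0] := ltP B 0.
  by exists 0 => x xB; have := le_lt_trans xB B0; rewrite ltNge normr_ge0.
have Kc : compact [set x : V | `|x| <= B].
  apply: bounded_closed_compact.
    by exists B; split; [exact: num_real|move=> M BM x /= xB; exact: le_trans xB (ltW BM)].
  apply: (@closed_comp _ _ (fun x : V => `|x|) [set r | r <= B]) => [x _|].
    exact: norm_continuous.
  exact: closed_le.
have : compact (u @` [set x : V | `|x| <= B]).
  by apply: continuous_compact => //; apply: continuous_subspaceT.
move/compact_bounded => -[K [_ h]]; exists (K + 1) => x xB.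
by apply: (h (K + 1)); [rewrite ltrDl|exists x].
Qed.

End SupNorm.

Section CubeMeasure.
Variable R : realType.

Lemma measurable_tuple_box n (I : 'I_n -> set (measurableTypeR R)) :
  (forall j, measurable (I j)) ->
  measurable [set t : n.-tuple (measurableTypeR R) | forall j, I j (tnth t j)].
Proof.
move=> mI; rewrite (_ : [set _ | _] = \bigcap_(j in [set: 'I_n]) ((fun t => tnth t j) @^-1` I j)).
  apply: fin_bigcap_measurable => // j _.
  by rewrite -[X in measurable X]setTI; exact: measurable_tnth.
by apply/seteqP; split => t /= h j; [move=> _; exact: h|exact: h].
Qed.

(** Induction on the dimension: the preimage of a box under [consT] is the product of its first side
    and the box of the remaining sides. *)
Lemma lebesgue_Rn_box n (I : 'I_n -> set (measurableTypeR R)) :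
  (forall j, measurable (I j)) ->
  lebesgue_Rn R n [set t : n.-tuple (measurableTypeR R) | forall j, I j (tnth t j)] =
  (\prod_(j < n) lebesgue_measure (I j))%E.
Proof.
elim: n I => [|n ih] I mI.
  by rewrite big_ord0 /= diracE mem_set// => -[].
rewrite big_ord_recl /= /leb_step /pushforward.
rewrite (_ : _ @^-1` _ = I ord0 `*` [set t | forall j, I (lift ord0 j) (tnth t j)]).
  rewrite product_measure1E//; last first.
    by apply: (@measurable_tuple_box n (fun j => I (lift ord0 j))) => j.
  by congr (_ * _)%E; rewrite -ih.
apply/seteqP; split => -[x t] /=.
  by move=> h; split => [|j]; [have := h ord0|have := h (lift ord0 j)]; rewrite ?tnth0 ?tnthS.
by move=> [h1 h2] j; case: (unliftP ord0 j) => [i ->|->]; rewrite ?tnth0 ?tnthS.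
Qed.

End CubeMeasure.

Lemma Rintegral_lincomb dd (T : measurableType dd) (R : realType)
    (m : {measure set T -> \bar R}) I (s : seq I) (c : I -> R) (h : I -> T -> R) :
  (forall i, m.-integrable setT (EFin \o h i)) ->
  m.-integrable setT (EFin \o (fun t => \sum_(i <- s) c i * h i t)) /\
  \int[m]_t (\sum_(i <- s) c i * h i t) = \sum_(i <- s) c i * \int[m]_t h i t.
Proof.
move=> ih; elim: s => [|k s [ih1 ih2]].
  rewrite big_nil; split.
    by apply: (eq_integrable measurableT _ _ _ (integrable0 _ _)) => // t _ /=; rewrite big_nil.
  rewrite (@eq_Rintegral _ _ _ m setT (fun=> 0)); last by move=> t _; rewrite big_nil.
  by rewrite Rintegral_cst// mul0r.
have ik : m.-integrable setT (EFin \o (fun t => c k * h k t)).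
  by apply: (eq_integrable measurableT _ _ _ (integrableZl measurableT (c k) (ih k))).
split.
  by apply: (eq_integrable measurableT _ _ _ (integrableD measurableT ik ih1)) => // t _ /=; rewrite big_cons EFinD.
rewrite (@eq_Rintegral _ _ _ m setT (fun t => c k * h k t +
   \sum_(i <- s) c i * h i t)); last first.
  by move=> t _; rewrite big_cons.
by rewrite (RintegralD measurableT ik ih1) ih2 big_cons (RintegralZl (c k) measurableT (ih k)).
Qed.

Section RealRiemannSums.
Variables (R : realType) (d : nat).
Local Notation V := 'rV[R]_d.
Local Notation Zd := 'rV[int]_d.
Local Notation T := (d.-tuple (measurableTypeR R)).
Local Notation mu := (lebesgue_Rn R d).
Local Notation rt := (@row_of_tuple R d).

Lemma zvecD (k l : Zd) : zvec R (k + l) = zvec R k + zvec R l.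
Proof. exact: map_mxD. Qed.

Lemma zvecN (k : Zd) : zvec R (- k) = - zvec R k.
Proof. exact: map_mxN. Qed.

Lemma zvecB (k l : Zd) : zvec R (k - l) = zvec R k - zvec R l.
Proof. exact: map_mxB. Qed.

Lemma zvecMn (k : Zd) n : zvec R (k *+ n) = n%:R *: zvec R k.
Proof. by rewrite scaler_nat /zvec raddfMn. Qed.

Lemma zvec0 : zvec R (0 : Zd) = 0.
Proof. exact: map_mx0. Qed.

Lemma in_box_norm L (k : Zd) : (k \in box L) = (`|zvec R k| <= L%:R).
Proof.
have h i : `|zvec R k 0 i| = (zabs k i)%:R :> R by rewrite mxE -intr_norm -natr_absz.
rewrite mem_box; apply/forallP/idP => [hk|hk i].
  by apply: rV_norm_le => // i; rewrite h ler_nat.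
by have := le_trans (rV_norm_coord _ i) hk; rewrite h ler_nat.
Qed.

Lemma notin_box_norm L (k : Zd) : k \notin box L -> L%:R < `|zvec R k|.
Proof. by rewrite in_box_norm ltNge. Qed.

Lemma notin_box_scaled (B N : nat) (k : Zd) : (0 < N)%N -> k \notin box (N * B) ->
  B%:R < `|N%:R^-1 *: zvec R k|.
Proof.
move=> N0 /notin_box_norm; rewrite natrM normrZ gtr0_norm ?invr_gt0 ?ltr0n//.
by move=> h; rewrite ltr_pdivlMl ?ltr0n.
Qed.

Lemma grid_approx (N : nat) (x : V) : (0 < N)%N ->
  `|x - N%:R^-1 *: zvec R (\row_j Num.floor (N%:R * x 0 j))| <= N%:R^-1.
Proof.
move=> N0; have N0' : (0 : R) < N%:R by rewrite ltr0n.
apply: rV_norm_le => [|i]; first by rewrite invr_ge0.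
have := floor_itv (N%:R * x 0 i); rewrite !mxE intrD.
set y := x 0 i; set f := (Num.floor _)%:~R => /andP[h1 h2].
rewrite -[y](mulKf (lt0r_neq0 N0')) -mulrBr normrM gtr0_norm ?invr_gt0//.
rewrite ger_pMr ?invr_gt0// ger0_norm ?subr_ge0//.
lra.
Qed.

Lemma invn_lt (e : R) (N : nat) : 0 < e -> (Num.bound e^-1 < N)%N -> N%:R^-1 < e.
Proof.
move=> e0 eN; have N0' : (0 : R) < N%:R by rewrite ltr0n (leq_trans _ eN).
rewrite invf_plt ?posrE//; apply: (lt_le_trans (archi_boundP _)).
  by rewrite invr_ge0 ltW.
by rewrite ler_nat ltnW.
Qed.

Definition lfloor (N : nat) (t : T) : Zd := \row_j Num.floor (N%:R * (tnth t j : R)).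

(** Half-open sides make the cubes of mesh 1/N a partition, so that a point lies in exactly the cube
    indexed by its [lfloor]. *)
Definition cube (N : nat) (k : Zd) : set T :=
  [set t | forall j, `[((k 0 j)%:~R / N%:R : R), ((k 0 j)%:~R + 1) / N%:R[%classic
     (tnth t j)].

Lemma lfloor_cube N k t : (0 < N)%N -> cube N k t <-> lfloor N t = k.
Proof.
move=> N0; have N0' : (0 : R) < N%:R by rewrite ltr0n.
split => [h|<- j].
  apply/rowP => j; rewrite mxE; apply/eqP; rewrite floor_eq.
  have := h j; rewrite /= in_itv/= ler_pdivrMr// ltr_pdivlMr// => /andP[h1 h2].
  by rewrite mulrC h1 intrD.
rewrite /= in_itv /= mxE ler_pdivrMr// ltr_pdivlMr//.
by have := floor_itv (N%:R * (tnth t j : R)); rewrite mulrC intrD.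
Qed.

Lemma measurable_cube N k : measurable (cube N k).
Proof.
apply: (@measurable_tuple_box R d (fun j => `[((k 0 j)%:~R / N%:R : R), ((k 0 j)%:~R + 1) / N%:R[%classic)).
by move=> j; exact: measurable_itv.
Qed.

Lemma prod_EFin (I : finType) (F : I -> R) :
  (\prod_(i : I) (F i)%:E)%E = (\prod_(i : I) F i)%:E.
Proof. by elim/big_rec2: _ => // i x y _ ->; rewrite EFinM. Qed.

Lemma cube_measure N k : (0 < N)%N -> mu (cube N k) = (N%:R ^- d)%:E.
Proof.
move=> N0; have N0' : (0 : R) < N%:R by rewrite ltr0n.
rewrite /cube (lebesgue_Rn_box (I := fun j => `[((k 0 j)%:~R / N%:R : R), ((k 0 j)%:~R + 1) / N%:R[%classic)); last first.
  by move=> j; exact: measurable_itv.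
under eq_bigr => j _.
  rewrite lebesgue_measure_itv /= lte_fin ltr_pM2r ?invr_gt0// ltrDl ltr01.
  rewrite -EFinB -mulrBl addrAC subrr add0r mul1r. over.
by rewrite prod_EFin prodr_const card_ord exprVn.
Qed.

Definition tbox (B : nat) : set T := [set t | forall j, `[- (B%:R : R), B%:R]%classic (tnth t j)].

Lemma measurable_tbox B : measurable (tbox B).
Proof.
apply: (@measurable_tuple_box R d (fun=> `[- (B%:R : R), B%:R]%classic)).
by move=> j; exact: measurable_itv.
Qed.

Lemma tbox_measure B : (mu (tbox B) < +oo)%E.
Proof.
rewrite /tbox (lebesgue_Rn_box (I := fun=> `[- (B%:R : R), B%:R]%classic)); last first.
  by move=> j; exact: measurable_itv.
under eq_bigr => j _.
  rewrite lebesgue_measure_itv /= (_ : (if _ then _ else _) = ((B%:R : R) *+ 2)%:E). over.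
  case: ifPn; rewrite lte_fin; first by rewrite -EFinB opprK mulr2n.
  rewrite -leNgt => h; congr (_%:E); have : (0 : R) <= B%:R by [].
  lra.
by rewrite prod_EFin ltry.
Qed.

Lemma tboxP B t : tbox B t <-> `|rt t| <= B%:R.
Proof.
split=> [h|h j].
  apply: rV_norm_le => // i; have := h i; rewrite /= in_itv /= mxE ler_norml.
  by [].
rewrite /= in_itv /= -ler_norml.
by have := le_trans (rV_norm_coord (rt t) j) h; rewrite mxE.
Qed.

(** The step function whose integral is exactly the Riemann sum of [u] of mesh 1/N. *)
Definition stepf (u : V -> R) N (t : T) : R := u (N%:R^-1 *: zvec R (lfloor N t)).

Section AbstractMeasure.
(* The integral is estimated for an arbitrary measure with the right values on
   cubes: unification is much cheaper than with [lebesgue_Rn]. *)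
Variable m : {measure set T -> \bar R}.
Hypothesis m_cube : forall N k, (0 < N)%N -> m (cube N k) = (N%:R ^- d)%:E.
Hypothesis m_tbox : forall B, (m (tbox B) < +oo)%E.

Lemma tbox_integrable B : m.-integrable setT (fun t => (\1_(tbox B) t)%:E).
Proof.
apply/integrableP; split.
  by apply/measurable_EFinP; exact: measurable_indic (measurable_tbox B).
rewrite (eq_integral (fun t => (\1_(tbox B) t)%:E)); last first.
  by move=> t _; rewrite gee0_abs// lee_fin.
by rewrite (integral_indic _ measurableT (measurable_tbox B)) setIT m_tbox.
Qed.

Section Step.
Variables (u : V -> R) (B N : nat).
Hypothesis (uB : forall x, B%:R < `|x| -> u x = 0) (N0 : (0 < N)%N).

Lemma stepfE t : stepf u N t =
  \sum_(k <- box (N * B)) u (N%:R^-1 *: zvec R k) * \1_(cube N k) t.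
Proof.
rewrite /stepf; set k0 := lfloor N t.
have h k : \1_(cube N k) t = (k == k0)%:R :> R.
  rewrite indicE; congr (_ %:R); congr nat_of_bool.
  by apply/idP/eqP => [/set_mem/(lfloor_cube _ _ N0)//|->]; apply/mem_set/lfloor_cube.
under eq_bigr do rewrite h.
have [kb|kb] := boolP (k0 \in box (N * B)).
  rewrite (bigD1_seq k0)//= ?box_uniq// eqxx mulr1 big1 ?addr0//.
  by move=> k /negbTE ->; rewrite mulr0.
rewrite uB ?notin_box_scaled// big_seq big1// => k kb'.
case: eqP => [kk|]; last by rewrite mulr0.
by rewrite -kk kb' in kb.
Qed.

Lemma integrable_cube k : m.-integrable setT (fun t => (\1_(cube N k) t)%:E).
Proof.
apply/integrableP; split.
  by apply/measurable_EFinP; exact: measurable_indic (measurable_cube N k).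
rewrite (eq_integral (fun t => (\1_(cube N k) t)%:E)); last first.
  by move=> t _; rewrite gee0_abs// lee_fin.
rewrite (integral_indic _ measurableT (measurable_cube N k)) setIT.
by rewrite m_cube// ltry.
Qed.

Lemma stepf_sum_integrable (s : seq Zd) :
  m.-integrable setT (EFin \o (fun t =>
    \sum_(k <- s) u (N%:R^-1 *: zvec R k) * \1_(cube N k) t)) /\
  \int[m]_t (\sum_(k <- s) u (N%:R^-1 *: zvec R k) * \1_(cube N k) t) =
  N%:R ^- d * \sum_(k <- s) u (N%:R^-1 *: zvec R k).
Proof.
have [h1 h2] := @Rintegral_lincomb _ _ _ m _ s (fun k => u (N%:R^-1 *: zvec R k))
  (fun k => \1_(cube N k)) integrable_cube.
split=> //; rewrite h2 mulr_sumr; apply: eq_bigr => k _; rewrite mulrC; congr (_ * _).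
by rewrite /Rintegral (integral_indic _ measurableT (measurable_cube N k)) setIT m_cube.
Qed.

Lemma stepf_integrable : m.-integrable setT (EFin \o stepf u N).
Proof.
apply: (eq_integrable measurableT _ _ _ (stepf_sum_integrable (box (N * B))).1) => // t _.
by rewrite /= stepfE.
Qed.

Lemma stepf_integral : \int[m]_t stepf u N t =
  N%:R ^- d * \sum_(k \in [set: Zd]) u (N%:R^-1 *: zvec R k).
Proof.
rewrite (eq_Rintegral m (fun t _ => stepfE t)) (stepf_sum_integrable _).2.
rewrite (@fsum_box _ _ _ (N * B))// => k kb.
by rewrite uB// notin_box_scaled.
Qed.

Lemma lfloor_close t : `|rt t - N%:R^-1 *: zvec R (lfloor N t)| <= N%:R^-1.
Proof.
have -> : lfloor N t = \row_j Num.floor (N%:R * rt t 0 j).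
  by apply/rowP => j; rewrite !mxE.
exact: grid_approx.
Qed.

End Step.

Section Cvg.
Variables (u : V -> R) (B : nat).
Hypothesis (uB : forall x, B%:R < `|x| -> u x = 0) (cu : continuous u).

(** The bound is uniform over the whole space: up to radius B + 1 by uniform continuity, and beyond
    it both values vanish because the mesh is at most 1. *)
Lemma stepf_unif (e : R) : 0 < e -> exists2 N0, (0 < N0)%N &
  forall N t, (N0 <= N)%N -> `|stepf u N t - u (rt t)| <= e.
Proof.
move=> e0; have [dl dl0 h] := unif_cont_compact B.+1%:R cu e0.
exists (Num.bound dl^-1).+1 => // N t NN.
have N0 : (0 < N)%N by apply: leq_trans NN.
have N0' : (0 : R) < N%:R by rewrite ltr0n.
have Ndl : N%:R^-1 < dl by exact: invn_lt.
have hd := lfloor_close N0 t.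
have [tB|tB] := leP `|rt t| B.+1%:R.
  by rewrite distrC; apply: h => //; exact: le_lt_trans hd Ndl.
rewrite (uB (lt_trans _ tB)) ?ltr_nat// subr0 /stepf uB ?normr0 ?ltW//.
have : N%:R^-1 <= 1 :> R by rewrite invf_le1// ler1n.
move: tB; have := lerB_normD (rt t) (N%:R^-1 *: zvec R (lfloor N t) - rt t).
by rewrite subrKC distrC; move: hd; rewrite -natr1; lra.
Qed.

(** The sigma-algebra on tuples is a product one; measurability comes from the step functions,
    finite combinations of cube indicators that converge pointwise. *)
Lemma rcs_measurable : measurable_fun setT (fun t => u (rt t)).
Proof.
apply: (@measurable_fun_cvg _ _ _ _ (fun N => stepf u N.+1)).
  move=> N; have /integrableP[/measurable_EFinP //] := stepf_integrable uB (ltn0Sn N).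
move=> t _; apply/cvgrPdist_le => e /stepf_unif[N0 _ h]; exists N0 => // N /= NN.
by rewrite distrC; apply: h; exact: leqW.
Qed.

Lemma rcs_bounded : exists K, forall x, `|u x| <= K.
Proof.
have [K hK] := cont_bounded_compact B%:R cu.
exists (Num.max K 0) => x; rewrite le_max.
have [xB|xB] := leP `|x| B%:R; first by rewrite hK.
by rewrite uB// normr0 lexx orbT.
Qed.

Lemma rcs_integrable : m.-integrable setT (EFin \o (fun t => u (rt t))).
Proof.
have [K hK] := rcs_bounded.
apply: (le_integrable measurableT _ _ (integrableZl measurableT K (tbox_integrable B))).
  by apply/measurable_EFinP; exact: rcs_measurable.
move=> t _; rewrite /= lee_fin indicE normrM.
have K0 : 0 <= K by apply: le_trans (hK 0).
have [tB|tB] := leP `|rt t| B%:R.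
  by rewrite mem_set ?normr1 ?mulr1 ?(ger0_norm K0)//; exact/tboxP.
by rewrite uB// normr0 mulr_ge0.
Qed.

(** The Riemann sum is the integral of a step function that differs from [u] uniformly little, and
    only on a fixed box of finite measure. *)
Lemma riemann_cvg_abs (e : R) : 0 < e -> exists2 N0, (0 < N0)%N & forall N, (N0 <= N)%N ->
  `|N%:R ^- d * \sum_(k \in [set: Zd]) u (N%:R^-1 *: zvec R k) - \int[m]_t u (rt t)| <= e.
Proof.
(* Dividing by [v + 1] instead of [v] avoids a proof that the box has positive measure. *)
move=> e0; pose A := tbox B.+1; pose v := fine (m A).
have v0 : 0 < v + 1 by rewrite ltr_wpDl// fine_ge0.
have [N0 N00 h] := stepf_unif (divr_gt0 e0 v0); exists N0 => // N NN.
have Npos : (0 < N)%N by exact: leq_trans NN.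
rewrite -(stepf_integral uB Npos).
have is1 := stepf_integrable uB Npos; have is2 := rcs_integrable.
rewrite -RintegralB//.
have is3 : m.-integrable setT (EFin \o (fun t => stepf u N t - u (rt t))).
  by apply: (eq_integrable measurableT _ _ _ (integrableB measurableT is1 is2)) => // t _; rewrite /= EFinB.
apply: le_trans (le_normr_Rintegral measurableT is3) _.
have uB1 x : B.+1%:R < `|x| -> u x = 0 by move=> xB; apply: uB; rewrite (lt_trans _ xB)// ltr_nat.
have iA : m.-integrable setT (EFin \o (fun t => e / (v + 1) * \1_A t)).
  apply: (eq_integrable measurableT _ _ _ (integrableZl measurableT (e / (v + 1)) (tbox_integrable B.+1))) => // t _.
apply: (@le_trans _ _ (\int[m]_t (e / (v + 1) * \1_A t))).
  apply: le_Rintegral => //.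
    by apply: (eq_integrable measurableT _ _ _ (integrable_abse is3)).
  move=> t _; rewrite indicE.
  have [tA|tA] := boolP (t \in A); first by rewrite mulr1 h.
  have tn : B.+1%:R < `|rt t| by rewrite ltNge; apply: contra tA => /tboxP/mem_set.
  rewrite mulr0 uB1// subr0 /stepf uB ?normr0//.
  have : N%:R^-1 <= 1 :> R by rewrite invf_le1 ?ler1n ?ltr0n.
  have := lerB_normD (rt t) (N%:R^-1 *: zvec R (lfloor N t) - rt t).
  rewrite subrKC distrC; move: tn; rewrite -natr1; have := lfloor_close Npos t; lra.
rewrite RintegralZl//; last exact: tbox_integrable.
rewrite /Rintegral integral_indic ?setIT//; last exact: measurable_tbox.
rewrite -/A -/v -mulrA ger_pMr// mulrC ler_pdivrMr// mul1r; lra.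
Qed.

End Cvg.
End AbstractMeasure.

Definition rint (u : V -> R) : R := \int[mu]_t u (rt t).

Lemma riemann_cvg (u : V -> R) (B : nat) : (forall x, B%:R < `|x| -> u x = 0) ->
  continuous u -> forall e : R, 0 < e -> exists2 N0, (0 < N0)%N & forall N, (N0 <= N)%N ->
  `|N%:R ^- d * \sum_(k \in [set: Zd]) u (N%:R^-1 *: zvec R k) - rint u| <= e.
Proof. exact: (riemann_cvg_abs cube_measure tbox_measure). Qed.

Lemma rcs_rintegrable (u : V -> R) (B : nat) : (forall x, B%:R < `|x| -> u x = 0) ->
  continuous u -> mu.-integrable setT (EFin \o (fun t => u (rt t))).
Proof. exact: (rcs_integrable cube_measure tbox_measure). Qed.

End RealRiemannSums.

(** * Integration of continuous compactly supported functions *)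

Section ComplexIntegral.
Variables (R : realType) (d : nat).
Local Notation C := R[i].
Local Notation V := 'rV[R]_d.
Local Notation Zd := 'rV[int]_d.
Local Notation rc := (real_complex R).
Local Notation reC := (@complex.Re R).
Local Notation imC := (@complex.Im R).
Implicit Types (F G : V -> C) (u v : V -> R).

Definition csupp (T : nmodType) (B : nat) (f : V -> T) :=
  forall x, B%:R < `|x| -> f x = 0.

Definition cc F := CnC 0 F /\ exists B, csupp B F.

Lemma csupp_le (T : nmodType) B B' (f : V -> T) : (B <= B')%N -> csupp B f -> csupp B' f.
Proof. by move=> BB h x xB; apply: h; apply: le_lt_trans xB; rewrite ler_nat. Qed.

Lemma compact_supportP (T : nmodType) (f : V -> T) :
  compact_support f <-> exists B, csupp B f.
Proof.
split=> [[B h]|[B h]]; last by exists B%:R.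
exists (Num.bound `|B|) => x xB; apply: h; apply: le_lt_trans xB.
by apply: (le_trans (ler_norm B)); rewrite ltW// archi_boundP.
Qed.

Lemma contM u v : continuous u -> continuous v -> continuous (fun x => u x * v x).
Proof. by move=> cu cv x; exact: (@continuousM _ _ u v x (cu x) (cv x)). Qed.

Lemma contD u v : continuous u -> continuous v -> continuous (fun x => u x + v x).
Proof. by move=> cu cv x; exact: (@continuousD _ _ _ u v x (cu x) (cv x)). Qed.

Lemma contB u v : continuous u -> continuous v -> continuous (fun x => u x - v x).
Proof. by move=> cu cv x; exact: (@continuousB _ _ _ u v x (cu x) (cv x)). Qed.

Lemma cont_cst (c : R) : continuous (fun _ : V => c).
Proof. by move=> x; exact: cst_continuous. Qed.

Lemma CnC0_mul F G : CnC 0 F -> CnC 0 G -> CnC 0 (fun x => F x * G x).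
Proof.
move=> [f1 f2] [g1 g2]; split; rewrite /Cn.
  rewrite (_ : _ \o _ = fun x => reC (F x) * reC (G x) - imC (F x) * imC (G x)).
    by apply: contB; apply: contM.
  apply/funext => y; rewrite /comp. by rewrite cReM.
rewrite (_ : _ \o _ = fun x => reC (F x) * imC (G x) + imC (F x) * reC (G x)).
  by apply: contD; apply: contM.
by apply/funext => y; rewrite /comp cImM.
Qed.

Lemma CnC0_add F G : CnC 0 F -> CnC 0 G -> CnC 0 (fun x => F x + G x).
Proof.
move=> [f1 f2] [g1 g2]; split; rewrite /Cn.
  rewrite (_ : _ \o _ = fun x => reC (F x) + reC (G x)); first exact: contD.
  by apply/funext => y; rewrite /comp cReD.
rewrite (_ : _ \o _ = fun x => imC (F x) + imC (G x)); first exact: contD.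
by apply/funext => y; rewrite /comp cImD.
Qed.

Lemma CnC0_cst (c : C) : CnC 0 (fun _ : V => c).
Proof. by split; exact: cont_cst. Qed.

Lemma CnC0_scale (c : C) F : CnC 0 F -> CnC 0 (fun x => c * F x).
Proof. by apply: CnC0_mul; exact: CnC0_cst. Qed.

Lemma CnC0_sub F G : CnC 0 F -> CnC 0 G -> CnC 0 (fun x => F x - G x).
Proof.
move=> cF cG; rewrite (_ : (fun x => _) = (fun x => F x + (-1) * G x)).
  by apply: CnC0_add => //; exact: CnC0_scale.
by apply/funext => x; rewrite mulN1r.
Qed.

Lemma CnC0_comp F (h : V -> V) : continuous h -> CnC 0 F -> CnC 0 (fun x => F (h x)).
Proof.
move=> ch [f1 f2]; split => x.
  exact: (@continuous_comp V V R h (reC \o F) x (ch x) (f1 (h x))).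
exact: (@continuous_comp V V R h (imC \o F) x (ch x) (f2 (h x))).
Qed.

Lemma CnC0_rc u : continuous u -> CnC 0 (fun x => rc (u x)).
Proof. by move=> cu; split; [exact: cu|exact: cont_cst]. Qed.

Lemma CnC0_sum I (s : seq I) (f : I -> V -> C) : (forall i, CnC 0 (f i)) ->
  CnC 0 (fun x => \sum_(i <- s) f i x).
Proof.
move=> h; elim: s => [|i s ih].
  by rewrite (_ : (fun x => _) = fun=> 0); [exact: CnC0_cst|apply/funext => x; rewrite big_nil].
rewrite (_ : (fun x => _) = (fun x => f i x + \sum_(j <- s) f j x)).
  exact: CnC0_add.
by apply/funext => x; rewrite big_cons.
Qed.

Lemma cont_shift (y : V) : continuous (fun x : V => x - y).
Proof. by move=> x; apply: continuousB; [by []|exact: cst_continuous]. Qed.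

Lemma cont_opp : continuous (fun x : V => - x).
Proof. by move=> x; exact: opp_continuous. Qed.

Lemma cont_scale (c : R) : continuous (fun x : V => c *: x).
Proof. exact: scaler_continuous. Qed.

Lemma cont_coord i : continuous (fun x : V => x 0 i).
Proof. by move=> x; exact: coord_continuous. Qed.

Lemma CnC0_shift F y : CnC 0 F -> CnC 0 (fun x => F (x - y)).
Proof. exact/CnC0_comp/cont_shift. Qed.

Lemma cc_mul F G : cc F -> CnC 0 G -> cc (fun x => F x * G x).
Proof.
move=> [cF [B hB]] cG; split; first exact: CnC0_mul.
by exists B => x /hB ->; rewrite mul0r.
Qed.

Lemma cc_scale c F : cc F -> cc (fun x => c * F x).
Proof.
move=> [cF [B hB]]; split; first exact: CnC0_scale.
by exists B => x /hB ->; rewrite mulr0.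
Qed.

Lemma cc_add F G : cc F -> cc G -> cc (fun x => F x + G x).
Proof.
move=> [cF [B hB]] [cG [B' hB']]; split; first exact: CnC0_add.
exists (maxn B B') => x xB.
by rewrite (csupp_le (leq_maxl B B') hB)// (csupp_le (leq_maxr B B') hB')// addr0.
Qed.

Lemma cc_sub F G : cc F -> cc G -> cc (fun x => F x - G x).
Proof.
move=> cF cG; rewrite (_ : (fun x => _) = (fun x => F x + (-1) * G x)).
  by apply: cc_add => //; exact: cc_scale.
by apply/funext => x; rewrite mulN1r.
Qed.

Lemma csupp_shift (T : nmodType) B (y : V) (f : V -> T) : csupp B f ->
  csupp (B + Num.bound `|y|) (fun x => f (x - y)).
Proof.
move=> h x xB; apply: h; have := lerB_normD x (- y); rewrite natrD in xB.
by rewrite normrN; have := archi_boundP (normr_ge0 y); move: xB; lra.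
Qed.

Lemma cc_shift F y : cc F -> cc (fun x => F (x - y)).
Proof.
move=> [cF [B hB]]; split; first exact: CnC0_shift.
by exists (B + Num.bound `|y|)%N; exact: csupp_shift.
Qed.

Lemma cc_opp F : cc F -> cc (fun x => F (- x)).
Proof.
move=> [cF [B hB]]; split; first exact/CnC0_comp/cF/cont_opp.
by exists B => x xB; apply: hB; rewrite normrN.
Qed.

Lemma cc_refl F y : cc F -> cc (fun x => F (y - x)).
Proof.
move=> cF; have := cc_shift y (cc_opp cF); congr cc.
by apply/funext => x; rewrite opprB.
Qed.

Lemma cc0 : cc (fun=> 0).
Proof. by split; [exact: CnC0_cst|exists 0%N]. Qed.

Lemma cc_sum I (s : seq I) (f : I -> V -> C) : (forall i, cc (f i)) ->
  cc (fun x => \sum_(i <- s) f i x).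
Proof.
move=> h; elim: s => [|i s ih].
  by rewrite (_ : (fun x => _) = fun=> 0); [exact: cc0|apply/funext => x; rewrite big_nil].
rewrite (_ : (fun x => _) = (fun x => f i x + \sum_(j <- s) f j x)).
  exact: cc_add.
by apply/funext => x; rewrite big_cons.
Qed.

Lemma CnC0_unif F (B : R) : CnC 0 F -> forall e : R, 0 < e ->
  exists2 dl, 0 < dl & forall x y, `|x| <= B -> `|x - y| < dl -> normc (F x - F y) <= e.
Proof.
move=> [f1 f2] e e0; have e2 : 0 < e / 2 by rewrite divr_gt0.
have [d1 d10 h1] := unif_cont_compact B f1 e2.
have [d2 d20 h2] := unif_cont_compact B f2 e2.
exists (Num.min d1 d2); first by rewrite lt_min d10.
move=> x y xB; rewrite lt_min => /andP[/h1 - /(_ xB) a1 /h2 - /(_ xB) a2].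
apply: (le_trans (normc_le_ReIm _)); rewrite cReD cImD cReN cImN [leRHS]splitr.
exact: lerD.
Qed.

Lemma cc_unif F : cc F -> forall e : R, 0 < e ->
  exists2 dl, 0 < dl & forall x y, `|x - y| < dl -> normc (F x - F y) <= e.
Proof.
move=> [cF [B hB]] e e0; have [dl dl0 h] := CnC0_unif B.+1%:R cF e0.
exists (Num.min dl 1); first by rewrite lt_min dl0 ltr01.
move=> x y; rewrite lt_min => /andP[h1 h2].
have [xB|xB] := leP `|x| B.+1%:R; first exact: h.
have h3 := lerB_normD x (y - x); rewrite subrKC distrC in h3.
rewrite !hB ?subrr ?ComplexField.Normc.normc0 ?ltW//; move: xB; rewrite -natr1; lra.
Qed.

Lemma CnC0_bounded F (B : R) : CnC 0 F ->
  exists2 K, 0 <= K & forall x, `|x| <= B -> normc (F x) <= K.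
Proof.
move=> [f1 f2]; have [K1 h1] := cont_bounded_compact B f1.
have [K2 h2] := cont_bounded_compact B f2.
exists (Num.max 0 (K1 + K2)); first by rewrite le_max lexx.
move=> x xB; rewrite le_max; apply/orP; right; apply: (le_trans (normc_le_ReIm _)).
by apply: lerD; [exact: h1|exact: h2].
Qed.

Lemma cc_bounded F : cc F -> exists2 K, 0 <= K & forall x, normc (F x) <= K.
Proof.
move=> [cF [B hB]]; have [K K0 h] := CnC0_bounded B%:R cF; exists K => // x.
have [xB|xB] := leP `|x| B%:R; first exact: h.
by rewrite hB// ComplexField.Normc.normc0.
Qed.

Definition riem (N : nat) F : C :=
  N%:R ^- d * \sum_(k \in [set: Zd]) F (N%:R^-1 *: zvec R k).

Lemma riem_fsupp (N : nat) F : (0 < N)%N -> cc F ->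
  fsupp (fun k => F (N%:R^-1 *: zvec R k)).
Proof.
move=> N0 [_ [B hB]]; exists (N * B)%N => k kb.
by rewrite hB// notin_box_scaled.
Qed.

Lemma intRnE F : intRn F = Complex (rint (reC \o F)) (rint (imC \o F)).
Proof. by []. Qed.

Lemma rc_natX (N : nat) : (N%:R ^- d : C) = rc (N%:R ^- d).
Proof. by rewrite rcV rcX rc_natr. Qed.

(** Source of the rules of integration below: an identity between lattice sums passes to the
    integrals by uniqueness of limits. *)
Lemma riem_cvg F : cc F -> cvgC (riem ^~ F) (intRn F).
Proof.
move=> ccF; have [[f1 f2] [B hB]] := ccF => e e0.
have e2 : 0 < e / 2 by rewrite divr_gt0.
have hB1 x : B%:R < `|x| -> (reC \o F) x = 0 by move=> /hB /= ->.
have hB2 x : B%:R < `|x| -> (imC \o F) x = 0 by move=> /hB /= ->.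
have [N1 N10 h1] := riemann_cvg hB1 f1 e2.
have [N2 N20 h2] := riemann_cvg hB2 f2 e2.
exists (maxn N1 N2) => N; rewrite geq_max => /andP[n1 n2].
have N0 : (0 < N)%N by exact: leq_trans n1.
have fs := riem_fsupp N0 ccF.
apply: (le_trans (normc_le_ReIm _)); rewrite [leRHS]splitr intRnE cReD cImD cReN cImN /=.
rewrite /riem rc_natX cReM cImM /= !mul0r subr0 addr0.
rewrite (fsum_morph (f := reC))//; last exact: cReD.
rewrite (fsum_morph (f := imC))//; last exact: cImD.
by apply: lerD; [exact: h1|exact: h2].
Qed.

Lemma intRn_add F G : cc F -> cc G -> intRn (fun x => F x + G x) = intRn F + intRn G.
Proof.
move=> cF cG; apply: (cvgC_unique (riem_cvg (cc_add cF cG))).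
apply: cvgC_ext_pos (cvgCD (riem_cvg cF) (riem_cvg cG)) => n n0.
by rewrite /riem fsumD ?mulrDr//; exact: riem_fsupp.
Qed.

Lemma intRn_scale c F : cc F -> intRn (fun x => c * F x) = c * intRn F.
Proof.
move=> cF; apply: (cvgC_unique (riem_cvg (cc_scale c cF))).
apply: cvgC_ext_pos (cvgCMl c (riem_cvg cF)) => n n0; rewrite /riem mulrCA; congr (_ * _).
rewrite (fsum_morph (f := fun z => c * z)) ?mulr0//; last exact: riem_fsupp.
by move=> x y; rewrite mulrDr.
Qed.

Lemma intRn0 : intRn (fun _ : V => 0 : C) = 0 :> C.
Proof.
rewrite -[RHS](mul0r (intRn (fun _ : V => 0))) -(intRn_scale 0 cc0).
by congr intRn; apply/funext => x; rewrite mul0r.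
Qed.

Lemma intRn_sub F G : cc F -> cc G -> intRn (fun x => F x - G x) = intRn F - intRn G.
Proof.
move=> cF cG; rewrite -mulN1r -intRn_scale// -intRn_add//; last exact: cc_scale.
by congr intRn; apply/funext => x; rewrite mulN1r.
Qed.

Lemma intRn_sum I (s : seq I) (f : I -> V -> C) : (forall i, cc (f i)) ->
  intRn (fun x => \sum_(i <- s) f i x) = \sum_(i <- s) intRn (f i).
Proof.
move=> h; elim: s => [|i s ih].
  by rewrite big_nil -[RHS]intRn0; congr intRn; apply/funext => x; rewrite big_nil.
rewrite big_cons -ih -intRn_add//; last exact: cc_sum.
by congr intRn; apply/funext => x; rewrite big_cons.
Qed.

(** The mesh 1/N has (2NB+1)^d points in the cube of radius B, hence at most N^d (2B+1)^d, which the
    normalisation N^(-d) compensates. *)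
Lemma riem_bound (N B : nat) F (b : R) : (0 < N)%N -> csupp B F -> 0 <= b ->
  (forall k, normc (F (N%:R^-1 *: zvec R k)) <= b) ->
  normc (riem N F) <= (B.*2.+1 ^ d)%:R * b.
Proof.
move=> N0 hB b0 hb; have N0' : (0 : R) < N%:R by rewrite ltr0n.
rewrite /riem (@fsum_box _ _ _ (N * B)); last first.
  by move=> k kb; rewrite hB// notin_box_scaled.
rewrite rc_natX ComplexField.Normc.normcM normc_rc ger0_norm ?invr_ge0 ?exprn_ge0//.
rewrite ler_pdivrMl ?exprn_gt0//; apply: (le_trans (normc_sum _ _ _)).
apply: (@le_trans _ _ (\sum_(k <- box (d := d) (N * B)) b)); first by apply: ler_sum => k _.
rewrite big_const_seq count_predT iter_addr_0 size_box -[leLHS]mulr_natl mulrA.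
apply: ler_wpM2r; first exact: b0.
rewrite -natrX -natrM ler_nat -expnMn.
by case: (posnP d) => [->|d0]; rewrite ?expn0// leq_exp2r//; lia.
Qed.

Lemma intRn_bound (B : nat) F (b : R) : cc F -> csupp B F -> 0 <= b ->
  (forall x, normc (F x) <= b) -> normc (intRn F) <= (B.*2.+1 ^ d)%:R * b.
Proof.
move=> ccF hB b0 hb; apply: (cvgC_bound (z := fun n => riem n.+1 F)).
  by move=> n; apply: riem_bound.
by apply: (cvgC_sub (f := S)) (riem_cvg ccF).
Qed.

Lemma intRn_rc u : intRn (fun x => rc (u x)) = rc (rint u).
Proof.
rewrite intRnE; congr Complex; rewrite /rint.
by rewrite (_ : (fun t => _) = fun=> 0) ?Rintegral_cst ?mul0r//; apply/funext.
Qed.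

(** On the meshes 1/(N0 n) a translation by a multiple of 1/N0 permutes the mesh points, so the
    Riemann sums coincide. *)
Lemma intRn_shift_rat F (N0 : nat) (z : Zd) : (0 < N0)%N -> cc F ->
  intRn (fun x => F (x - N0%:R^-1 *: zvec R z)) = intRn F.
Proof.
move=> N00 cF; have hf n : (n <= N0 * n)%N by rewrite leq_pmull.
apply: (cvgC_unique (cvgC_sub hf (riem_cvg (cc_shift _ cF)))).
apply: cvgC_ext_pos (cvgC_sub hf (riem_cvg cF)) => n n0 /=.
rewrite /riem; congr (_ * _).
rewrite -[LHS](fsum_shiftB (fun k => F ((N0 * n)%:R^-1 *: zvec R k)) (z *+ n)).
apply: eq_fsbigr => k _; congr (F _); rewrite zvecB zvecMn scalerBr scalerA natrM invfM.
by rewrite mulfVK// pnatr_eq0 -lt0n.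
Qed.

(** An arbitrary translation is compared with a nearby rational one: by uniform continuity the two
    integrands differ little, on a common bounded support. *)
Lemma intRn_shift F y : cc F -> intRn (fun x => F (x - y)) = intRn F.
Proof.
move=> cF; have [_ [B hB]] := cF.
apply/eqP; rewrite -subr_eq0; apply/eqP; apply: normc_small => e e0.
(* This radius contains the supports of both translates; the extra 1 covers the rational vector,
   which is within 1 of [y]. *)
set B' := (B + Num.bound `|y| + 1)%N; pose K := (B'.*2.+1 ^ d)%:R : R.
have K0 : 0 < K by rewrite ltr0n expn_gt0.
have [dl dl0 h] := cc_unif cF (divr_gt0 e0 K0).
pose N := (Num.bound dl^-1).+1; pose z : Zd := \row_j Num.floor (N%:R * y 0 j).
have yz : `|y - N%:R^-1 *: zvec R z| <= N%:R^-1 by exact: grid_approx.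
have Ndl : N%:R^-1 < dl by exact: invn_lt.
rewrite -(@intRn_shift_rat F N z (ltn0Sn _) cF) -intRn_sub; try exact: cc_shift.
have -> : e = K * (e / K) by rewrite mulrC divfK// lt0r_neq0.
apply: intRn_bound.
- by apply: cc_sub; exact: cc_shift.
- move=> x xB; rewrite !hB ?subr0//.
    have := lerB_normD x (- (N%:R^-1 *: zvec R z)); rewrite normrN.
    have := ler_normD y (N%:R^-1 *: zvec R z - y); rewrite subrKC distrC.
    have : N%:R^-1 <= 1 :> R by rewrite invf_le1// ler1n.
    have := archi_boundP (normr_ge0 y); move: xB yz; rewrite /B' !natrD.
    set a := _%:R^-1; lra.
  have := lerB_normD x (- y); rewrite normrN; have := archi_boundP (normr_ge0 y).
  move: xB; rewrite /B' !natrD; lra.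
- by rewrite divr_ge0// ltW.
- move=> x; apply: h; rewrite opprB addrC subrKA distrC.
  exact: le_lt_trans yz Ndl.
Qed.

Lemma intRn_opp F : cc F -> intRn (fun x => F (- x)) = intRn F.
Proof.
move=> cF; apply: (cvgC_unique (riem_cvg (cc_opp cF))).
apply: cvgC_ext_pos (riem_cvg cF) => n n0; rewrite /riem; congr (_ * _).
rewrite -[LHS](fsum_opp (fun k => F (n%:R^-1 *: zvec R k))).
by apply: eq_fsbigr => k _; rewrite zvecN scalerN.
Qed.

Lemma intRn_refl F y : cc F -> intRn (fun x => F (y - x)) = intRn F.
Proof.
move=> cF; rewrite -(intRn_opp cF) -(intRn_shift y (cc_opp cF)).
by congr intRn; apply/funext => x; rewrite opprB.
Qed.

Lemma cc_dilate F (M : nat) : (0 < M)%N -> cc F -> cc (fun x => F (M%:R^-1 *: x)).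
Proof.
move=> M0 [cF [B hB]]; split; first exact/CnC0_comp/cF/cont_scale.
exists (M * B)%N => x xB; apply: hB; rewrite normrZ gtr0_norm ?invr_gt0 ?ltr0n//.
by rewrite ltr_pdivlMl ?ltr0n// -natrM.
Qed.

(** Mesh 1/n for the dilated function is mesh 1/(M n) for [F], and the two normalisations differ by
    M^d. *)
Lemma intRn_dilate F (M : nat) : (0 < M)%N -> cc F ->
  intRn (fun x => F (M%:R^-1 *: x)) = M%:R ^+ d * intRn F.
Proof.
move=> M0 cF; apply: (cvgC_unique (riem_cvg (cc_dilate M0 cF))).
have hf n : (n <= M * n)%N by rewrite leq_pmull.
apply: cvgC_ext_pos (cvgCMl (M%:R ^+ d) (cvgC_sub hf (riem_cvg cF))) => n n0 /=.
rewrite /riem mulrA natrM exprMn invfM mulrA divff ?expf_neq0 ?pnatr_eq0 -?lt0n//.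
rewrite mul1r; congr (_ * _).
by apply: eq_fsbigr => k _; rewrite scalerA natrM invfM.
Qed.

Lemma rint_add u v : cc (fun x => rc (u x)) -> cc (fun x => rc (v x)) ->
  rint (fun x => u x + v x) = rint u + rint v.
Proof.
move=> cu cv; apply: rc_inj; rewrite rcD -!intRn_rc -intRn_add//.
by congr intRn; apply/funext => x; rewrite rcD.
Qed.

Lemma rint_scale (c : R) u : cc (fun x => rc (u x)) ->
  rint (fun x => c * u x) = c * rint u.
Proof.
move=> cu; apply: rc_inj; rewrite rcM -!intRn_rc -intRn_scale//.
by congr intRn; apply/funext => x; rewrite rcM.
Qed.

Lemma rint_sum I (s : seq I) (u : I -> V -> R) : (forall i, cc (fun x => rc (u i x))) ->
  rint (fun x => \sum_(i <- s) u i x) = \sum_(i <- s) rint (u i).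
Proof.
move=> cu; apply: rc_inj; rewrite rc_sum -intRn_rc.
under [RHS]eq_bigr do rewrite -intRn_rc.
by rewrite -intRn_sum//; congr intRn; apply/funext => x; rewrite rc_sum.
Qed.

Lemma rint_riem u : cc (fun x => rc (u x)) -> forall e, 0 < e ->
  exists2 N0, (0 < N0)%N & forall N, (N0 <= N)%N ->
  `|N%:R ^- d * \sum_(k \in [set: Zd]) u (N%:R^-1 *: zvec R k) - rint u| <= e.
Proof.
move=> [[cu _] [B hB]] e e0; apply: (@riemann_cvg _ _ u B) => // x /hB.
by case.
Qed.

Lemma intRn_le F u : cc F -> cc (fun x => rc (u x)) ->
  (forall x, normc (F x) <= u x) -> normc (intRn F) <= rint u.
Proof.
move=> cF cu Fu; apply/ler_addgt0Pr => e e0; have e2 : 0 < e / 2 by rewrite divr_gt0.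
have [N1 N10 h1] := rint_riem cu e2; have [N2 h2] := riem_cvg cF e2.
pose N := maxn N1 N2; have N0 : (0 < N)%N by rewrite (leq_trans N10)// leq_maxl.
have {}h1 := h1 N (leq_maxl _ _); have {}h2 := h2 N (leq_maxr _ _).
have h3 : normc (riem N F) <= N%:R ^- d * \sum_(k \in [set: Zd]) u (N%:R^-1 *: zvec R k).
  have [_ [B hB]] := cu; have [_ [B' hB']] := cF.
  rewrite /riem rc_natX ComplexField.Normc.normcM normc_rc ger0_norm ?invr_ge0 ?exprn_ge0//.
  apply: ler_wpM2l; first by rewrite invr_ge0 exprn_ge0.
  rewrite !(@fsum_box _ _ _ (N * maxn B B')).
  - by apply: (le_trans (normc_sum _ _ _)); apply: ler_sum => k _.
  - by move=> k kb; have [] := csupp_le (leq_maxl B B') hB (notin_box_scaled R N0 kb).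
  - by move=> k kb; apply: (csupp_le (leq_maxr B B') hB' (notin_box_scaled R N0 kb)).
have h4 := le_normcD (intRn F - riem N F) (riem N F); rewrite subrK normcB_sym in h4.
move: h1; rewrite ler_norml => /andP[h5 h6]; lra.
Qed.

Lemma rint_le u v : cc (fun x => rc (u x)) -> cc (fun x => rc (v x)) ->
  (forall x, u x <= v x) -> rint u <= rint v.
Proof.
move=> cu cv uv; have cuv : cc (fun x => rc (v x - u x)).
  by have := cc_sub cv cu; congr cc; apply/funext => x; rewrite rcB.
have := @intRn_le (fun x => rc (v x - u x)) (fun x => v x - u x) cuv cuv.
rewrite intRn_rc normc_rc => h.
have {}h : 0 <= rint (fun x => v x - u x).
  by apply: le_trans (normr_ge0 _) (h _) => x; rewrite normc_rc ger0_norm// subr_ge0.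
suff -> : rint v = rint (fun x => v x - u x) + rint u by rewrite lerDr.
by rewrite -rint_add//; congr rint; apply/funext => x; rewrite subrK.
Qed.

(** Only the mesh points in the cube of radius 1/N0 are kept: on the mesh 1/(N0 N1) there are (2 N1
    + 1)^d of them, hence at least N1^d. *)
Lemma rint_lower u (N0 : nat) (c : R) : (0 < N0)%N -> cc (fun x => rc (u x)) ->
  (forall x, 0 <= u x) -> 0 <= c -> (forall x, `|x| <= N0%:R^-1 -> c <= u x) ->
  N0%:R ^- d * c <= rint u.
Proof.
move=> N00 cu u0 c0 uc; apply/ler_addgt0Pr => e e0.
have [N1 N10 h1] := rint_riem cu e0.
have := h1 (N0 * N1)%N; rewrite leq_pmull// => /(_ isT); rewrite ler_norml => /andP[h2 h3].
have NN : (0 < N0 * N1)%N by rewrite muln_gt0 N00.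
suff h4 : N0%:R ^- d * c <= (N0 * N1)%:R ^- d *
  \sum_(k \in [set: Zd]) u ((N0 * N1)%:R^-1 *: zvec R k) by lra.
(* The summand [N1] makes the summation box contain the small box of radius [N1] even when [B] is
   0. *)
have [_ [B hB]] := cu; rewrite (@fsum_box _ _ _ (N0 * N1 * B + N1)); last first.
  move=> k kb; apply: rc_inj; apply: hB.
  apply: (notin_box_scaled R NN); apply: contraNN kb; exact/box_sub/leq_addr.
have E : (N0 * N1)%:R ^+ d = N0%:R ^+ d * N1%:R ^+ d :> R by rewrite natrM exprMn.
rewrite E invfM -mulrA ler_pM2l ?invr_gt0 ?exprn_gt0 ?ltr0n//.
rewrite ler_pdivlMl ?exprn_gt0 ?ltr0n//.
apply: (@le_trans _ _ (\sum_(k <- box (d := d) N1) c)).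
  rewrite big_const_seq count_predT iter_addr_0 size_box -[leRHS]mulr_natl.
  apply: ler_wpM2r; first exact: c0.
  by rewrite -natrX ler_nat; case: (posnP d) => [->|d0]; rewrite ?expn0// leq_exp2r//; lia.
rewrite (@le_trans _ _ (\sum_(k <- box (d := d) N1) u ((N0 * N1)%:R^-1 *: zvec R k)))//.
  rewrite big_seq [leRHS]big_seq; apply: ler_sum => k kb; apply: uc.
  rewrite normrZ gtr0_norm ?invr_gt0 ?ltr0n// natrM invfM -mulrA ger_pMr ?invr_gt0 ?ltr0n//.
  by rewrite ler_pdivrMl ?ltr0n// mulr1 -in_box_norm.
have P : perm_eq (box (d := d) N1) [seq k <- box (N0 * N1 * B + N1) | k \in box N1].
  apply: uniq_perm; rewrite ?filter_uniq ?box_uniq// => k; rewrite mem_filter.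
  by case: (boolP (k \in box N1)) => //= /(box_sub (leq_addl (N0 * N1 * B) _)) ->.
rewrite (perm_big _ P) big_filter [leRHS](bigID (fun k => k \in box N1)) /=.
by rewrite lerDl sumr_ge0.
Qed.

End ComplexIntegral.

(** * Iterated partial derivatives *)

Section Derivatives.
Variables (R : realType) (d : nat).
Local Notation C := R[i].
Local Notation V := 'rV[R]_d.
Local Notation Zd := 'rV[int]_d.
Local Notation rc := (real_complex R).
Local Notation reC := (@complex.Re R).
Local Notation imC := (@complex.Im R).
Implicit Types (F G : V -> C) (u v : V -> R).
Local Notation ej j := (delta_mx 0 j : V).

(** Reduces directional derivatives to functions of one real variable, where the chain rule and the
    mean value theorem are available. *)
Lemma is_derive_line (W : normedModType R) (u : W -> R) (x v : W) (t l : R) :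
  is_derive (t *: v + x) v u l <-> is_derive t 1 (fun h : R => u (h *: v + x)) l.
Proof.
have E : (fun h : R => h^-1 *: ((u \o shift (t *: v + x)) (h *: v) - u (t *: v + x))) =
  (fun h : R => h^-1 *: (((fun s : R => u (s *: v + x)) \o shift t) (h *: 1) - u (t *: v + x))).
  by apply/funext => h /=; rewrite [_%:A]mulr1 scalerDl addrA.
by split=> -[h1 h2]; apply: DeriveDef; move: h1 h2; rewrite /derivable /derive E.
Qed.

Lemma is_derive_dir (g : R -> R) (y g' l : R) :
  is_derive y 1 g g' -> is_derive y l g (l * g').
Proof.
move=> [dg <-]; have dfg : differentiable g y by exact/derivable1_diffP.
apply: DeriveDef; first exact: diff_derivable.
by rewrite !deriveE// -[in LHS](mulr1 l) linearZ.
Qed.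

Lemma is_derive_comp_affine (g g' : R -> R) (L : V -> R) (x v : V) (l : R) :
  (forall y : R, is_derive y 1 g (g' y)) -> (forall h, L (h *: v + x) = h * l + L x) ->
  is_derive x v (fun z => g (L z)) (l * g' (L x)).
Proof.
move=> dg hL; have := is_derive_line (fun z => g (L z)) x v 0 (l * g' (L x)).
rewrite scale0r add0r => ->.
rewrite (_ : (fun h : R => _) = (fun h : R => g (h *: (l : R^o) + L x))).
  have := is_derive_line g (L x) l 0 (l * g' (L x)); rewrite scale0r add0r => <-.
  by apply: is_derive_dir; exact: dg.
by apply/funext => h; rewrite hL.
Qed.

(** Existence and value of the partial derivative in one relation, so that the rules compose without
    evaluating [derive]. *)
Definition isD (j : 'I_d) u u' := forall x, is_derive x (ej j) u (u' x).

Lemma isD_pderiv j u u' : isD j u u' -> pderiv j u = u'.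
Proof. by move=> h; apply/funext => x; have [_ <-] := h x. Qed.

Lemma isD_ex j u : (forall x, derivable u x (ej j)) <-> isD j u (pderiv j u).
Proof.
by split=> h x; [exact: DeriveDef (h x) _|have [] := h x].
Qed.

Lemma isD_add j u u' v v' : isD j u u' -> isD j v v' ->
  isD j (fun x => u x + v x) (fun x => u' x + v' x).
Proof. by move=> hu hv x; exact: (is_deriveD (hu x) (hv x)). Qed.

Lemma isD_mul j u u' v v' : isD j u u' -> isD j v v' ->
  isD j (fun x => u x * v x) (fun x => u' x * v x + u x * v' x).
Proof.
move=> hu hv x; have [h1 h2] := is_deriveM (hu x) (hv x); apply: DeriveDef; first exact: h1.
by rewrite [LHS]h2 addrC; congr (_ + _); exact: mulrC.
Qed.

Lemma isD_cst j (c : R) : isD j (fun=> c) (fun=> 0).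
Proof. by move=> x; exact: is_derive_cst. Qed.

Lemma isD_scale j (c : R) u u' : isD j u u' -> isD j (fun x => c * u x) (fun x => c * u' x).
Proof.
move=> hu; have := isD_mul (isD_cst j c) hu; congr isD.
by apply/funext => x; rewrite mul0r add0r.
Qed.

Lemma isD_opp j u u' : isD j u u' -> isD j (fun x => - u x) (fun x => - u' x).
Proof.
by move=> /(isD_scale (- 1)); congr isD; apply/funext => x; rewrite mulN1r.
Qed.

Lemma isD_sub j u u' v v' : isD j u u' -> isD j v v' ->
  isD j (fun x => u x - v x) (fun x => u' x - v' x).
Proof. by move=> hu /isD_opp; exact: isD_add. Qed.

Lemma isD_coord j i : isD j (fun x => x 0 i) (fun=> (i == j)%:R).
Proof.
move=> x; have h (y : R) : is_derive y 1 id ((fun=> 1) y) by exact: is_derive_id.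
have := @is_derive_comp_affine id (fun=> 1) (fun z => z 0 i) x (ej j) (i == j)%:R h.
by rewrite mulr1; apply => t; rewrite !mxE.
Qed.

Lemma isD_shift j u u' y : isD j u u' -> isD j (fun x => u (x - y)) (fun x => u' (x - y)).
Proof.
move=> hu x; have := is_derive_line (fun z => u (z - y)) x (ej j) 0 (u' (x - y)).
rewrite scale0r add0r => ->.
have := is_derive_line u (x - y) (ej j) 0 (u' (x - y)).
rewrite scale0r add0r => -[h _]; have := h (hu _).
by congr (is_derive _ _ _ _); apply/funext => t; rewrite addrA.
Qed.

Definition pderivC j F : V -> C := fun x => Complex (pderiv j (reC \o F) x) (pderiv j (imC \o F) x).

Definition DC j F F' := isD j (reC \o F) (reC \o F') /\ isD j (imC \o F) (imC \o F').

Lemma DC_pderivC j F F' : DC j F F' -> pderivC j F = F'.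
Proof.
move=> [h1 h2]; apply/funext => x; rewrite /pderivC (isD_pderiv h1) (isD_pderiv h2) /=.
by case: (F' x).
Qed.

Lemma DC_add j F F' G G' : DC j F F' -> DC j G G' ->
  DC j (fun x => F x + G x) (fun x => F' x + G' x).
Proof.
move=> [h1 h2] [k1 k2]; split.
  have := isD_add h1 k1; congr isD; apply/funext => x; rewrite /comp cReD//.
have := isD_add h2 k2; congr isD; apply/funext => x; rewrite /comp cImD//.
Qed.

Lemma DC_mul j F F' G G' : DC j F F' -> DC j G G' ->
  DC j (fun x => F x * G x) (fun x => F' x * G x + F x * G' x).
Proof.
move=> [h1 h2] [k1 k2]; split.
  have := isD_sub (isD_mul h1 k1) (isD_mul h2 k2); congr isD; apply/funext => x.
    by rewrite /comp cReM.
  by rewrite /comp cReD !cReM opprD addrACA.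
have := isD_add (isD_mul h1 k2) (isD_mul h2 k1); congr isD; apply/funext => x.
  by rewrite /comp cImM.
by rewrite /comp cImD !cImM addrACA.
Qed.

Lemma DC_cst j (c : C) : DC j (fun=> c) (fun=> 0).
Proof. by split; exact: isD_cst. Qed.

Lemma DC_scale j (c : C) F F' : DC j F F' -> DC j (fun x => c * F x) (fun x => c * F' x).
Proof.
move=> h; have := DC_mul (DC_cst j c) h; congr DC.
by apply/funext => x; rewrite mul0r add0r.
Qed.

Lemma DC_shift j F F' y : DC j F F' -> DC j (fun x => F (x - y)) (fun x => F' (x - y)).
Proof. by move=> [h1 h2]; split; [exact: (isD_shift y h1)|exact: (isD_shift y h2)]. Qed.

Lemma DC_rc j u u' : isD j u u' -> DC j (fun x => rc (u x)) (fun x => rc (u' x)).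
Proof. by move=> h; split; [exact: h|exact: isD_cst]. Qed.

Lemma DC_sum j I (s : seq I) (f f' : I -> V -> C) : (forall i, DC j (f i) (f' i)) ->
  DC j (fun x => \sum_(i <- s) f i x) (fun x => \sum_(i <- s) f' i x).
Proof.
move=> h; elim: s => [|i s ih].
  have := DC_cst j 0; congr DC; apply/funext => x; rewrite big_nil//.
have := DC_add (h i) ih; congr DC; apply/funext => x; rewrite big_cons//.
Qed.

Lemma dotpC (x y : V) : dotp x y = dotp y x.
Proof. by apply: eq_bigr => i _; rewrite mulrC. Qed.

Lemma dotpDl (x y z : V) : dotp (x + y) z = dotp x z + dotp y z.
Proof. by rewrite -big_split; apply: eq_bigr => i _; rewrite mxE mulrDl. Qed.

Lemma dotpZl (c : R) (x z : V) : dotp (c *: x) z = c * dotp x z.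
Proof. by rewrite mulr_sumr; apply: eq_bigr => i _; rewrite mxE mulrA. Qed.

Lemma dotpZr (c : R) (x z : V) : dotp x (c *: z) = c * dotp x z.
Proof. by rewrite dotpC dotpZl dotpC. Qed.

Lemma dotp0l (x : V) : dotp 0 x = 0.
Proof. by rewrite /dotp big1// => i _; rewrite mxE mul0r. Qed.

Lemma dotpNl (x z : V) : dotp (- x) z = - dotp x z.
Proof. by rewrite -scaleN1r dotpZl mulN1r. Qed.

Lemma dotp_ej j (z : V) : dotp (ej j) z = z 0 j.
Proof.
rewrite /dotp (bigD1 j)//= big1 ?addr0 ?mxE ?eqxx ?mul1r// => i ij.
by rewrite mxE eqxx (negbTE ij) mul0r.
Qed.

Lemma dotp_bound (x y : V) : `|dotp x y| <= d%:R * (`|x| * `|y|).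
Proof.
apply: (le_trans (ler_norm_sum _ _ _)).
apply: (@le_trans _ _ (\sum_(j < d) `|x| * `|y|)); last by rewrite sumr_const card_ord mulr_natl.
by apply: ler_sum => i _; rewrite normrM ler_pM// rV_norm_coord.
Qed.

Lemma cont_dotp (z : V) : continuous (fun x => dotp x z).
Proof.
have h (s : seq 'I_d) : continuous (fun x : V => \sum_(j <- s) x 0 j * z 0 j).
  elim: s => [|i s ih].
    by rewrite (_ : (fun x : V => _) = fun=> 0); [exact: cont_cst|apply/funext => x; rewrite big_nil].
  rewrite (_ : (fun x : V => _) = fun x : V => x 0 i * z 0 i + \sum_(j <- s) x 0 j * z 0 j).
    by apply: contD => //; apply: contM; [exact: cont_coord|exact: cont_cst].
  by apply/funext => x; rewrite big_cons.
exact: h.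
Qed.

Local Notation iC := (Complex 0 1 : C).

Lemma expiD (s t : R) : expi (s + t) = expi s * expi t.
Proof.
by apply: complexP; rewrite ?cReM ?cImM /= ?cosD// sinD addrC.
Qed.

Lemma expi0 : expi 0 = 1 :> C.
Proof. by rewrite /expi cos0 sin0. Qed.

Lemma normc_expi (t : R) : normc (expi t) = 1.
Proof. by rewrite /ComplexField.Normc.normc /expi cos2Dsin2 sqrtr1. Qed.

Lemma DC_expi j (z : V) :
  DC j (fun x => expi (- dotp x z)) (fun x => - iC * rc (z 0 j) * expi (- dotp x z)).
Proof.
have hL x h : - dotp (h *: ej j + x) z = h * (- z 0 j) + - dotp x z.
  by rewrite dotpDl dotpZl dotp_ej opprD mulrN.
split=> x.
  have [h1 h2] := @is_derive_comp_affine _ _ (fun y => - dotp y z) _ _ _ (fun y => is_derive_cos y) (hL x).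
  by apply: DeriveDef => //; rewrite h2 /comp !cReM !cImM /=; ring.
have [h1 h2] := @is_derive_comp_affine _ _ (fun y => - dotp y z) _ _ _ (fun y => is_derive_sin y) (hL x).
by apply: DeriveDef => //; rewrite h2 /comp !cImM /=; ring.
Qed.

Lemma DC_expi' j (z : V) :
  DC j (fun x => expi (- dotp z x)) (fun x => - iC * rc (z 0 j) * expi (- dotp z x)).
Proof.
have := DC_expi j z; congr DC; apply/funext => x; rewrite dotpC//.
Qed.

Lemma cont_cos_line (z : V) : CnC 0 (fun x => expi (- dotp x z)).
Proof.
have h : continuous (fun x : V => - dotp x z).
  by move=> x; apply: (@continuousN _ _ _ (fun x : V => dotp x z)); exact: cont_dotp.
split=> x /=.
  apply: (@continuous_comp V R R (fun x => - dotp x z) (@cos R)); first exact: h.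
  exact: continuous_cos.
apply: (@continuous_comp V R R (fun x => - dotp x z) (@sin R)); first exact: h.
exact: continuous_sin.
Qed.

Lemma CnC_S k F : CnC k.+1 F <->
  CnC 0 F /\ forall j, DC j F (pderivC j F) /\ CnC k (pderivC j F).
Proof.
split.
  move=> [[c1 h1] [c2 h2]]; split; first by [].
  move=> j; have [d1 k1] := h1 j; have [d2 k2] := h2 j.
  by split; [split; exact/isD_ex|split].
move=> [[c1 c2] h]; split; split => // j; have [[d1 d2] [k1 k2]] := h j.
  by split => //; apply/isD_ex => x; have := d1 x.
by split => //; apply/isD_ex => x; have := d2 x.
Qed.

Lemma CnC_DC k F : CnC 0 F -> (forall j, exists2 F', DC j F F' & CnC k F') ->
  CnC k.+1 F.
Proof.
move=> c h; apply/CnC_S; split => // j; have [F' dF cF'] := h j.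
by rewrite (DC_pderivC dF).
Qed.

Lemma CnC_0 k F : CnC k F -> CnC 0 F.
Proof. by case: k => // k /CnC_S[]. Qed.

Lemma CnC_mono k k' F : (k <= k')%N -> CnC k' F -> CnC k F.
Proof.
elim: k k' F => [k' F _|k ih [//|k'] F kk /CnC_S[cF h]]; first exact: CnC_0.
apply/CnC_S; split => // j; have [h1 h2] := h j; split => //.
exact: ih h2.
Qed.

Lemma CnC_add k F G : CnC k F -> CnC k G -> CnC k (fun x => F x + G x).
Proof.
elim: k F G => [|k ih] F G; first exact: CnC0_add.
move=> /CnC_S[cF hF] /CnC_S[cG hG]; apply: CnC_DC; first exact: CnC0_add.
move=> j; have [h1 h2] := hF j; have [k1 k2] := hG j.
by exists (fun x => pderivC j F x + pderivC j G x); [exact: DC_add|exact: ih].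
Qed.

Lemma CnC_cst k (c : C) : CnC k (fun _ : V => c).
Proof.
elim: k c => [|k ih] c; first exact: CnC0_cst.
by apply: CnC_DC; [exact: CnC0_cst|move=> j; exists (fun=> 0); [exact: DC_cst|exact: ih]].
Qed.

Lemma CnC_mul k F G : CnC k F -> CnC k G -> CnC k (fun x => F x * G x).
Proof.
elim: k F G => [|k ih] F G; first exact: CnC0_mul.
move=> cFk cGk; have /CnC_S[cF hF] := cFk; have /CnC_S[cG hG] := cGk.
apply: CnC_DC; first exact: CnC0_mul.
move=> j; have [h1 h2] := hF j; have [k1 k2] := hG j.
exists (fun x => pderivC j F x * G x + F x * pderivC j G x); first exact: DC_mul.
by apply: CnC_add; apply: ih => //; apply: CnC_mono (leqnSn k) _.
Qed.

Lemma CnC_scale k (c : C) F : CnC k F -> CnC k (fun x => c * F x).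
Proof. by apply: CnC_mul; exact: CnC_cst. Qed.

Lemma CnC_sub k F G : CnC k F -> CnC k G -> CnC k (fun x => F x - G x).
Proof.
move=> cF cG; rewrite (_ : (fun x => _) = (fun x => F x + (-1) * G x)).
  by apply: CnC_add => //; exact: CnC_scale.
by apply/funext => x; rewrite mulN1r.
Qed.

Lemma CnC_shift k F y : CnC k F -> CnC k (fun x => F (x - y)).
Proof.
elim: k F => [|k ih] F; first exact: CnC0_shift.
move=> /CnC_S[cF hF]; apply: CnC_DC; first exact: CnC0_shift.
move=> j; have [h1 h2] := hF j; exists (fun x => pderivC j F (x - y)); last exact: ih.
exact: DC_shift.
Qed.

Lemma CnC_sum k I (s : seq I) (f : I -> V -> C) : (forall i, CnC k (f i)) ->
  CnC k (fun x => \sum_(i <- s) f i x).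
Proof.
move=> h; elim: s => [|i s ih].
  by have := CnC_cst k 0; congr CnC; apply/funext => x; rewrite big_nil.
by have := CnC_add (h i) ih; congr CnC; apply/funext => x; rewrite big_cons.
Qed.

(** A multi-index as a word in the coordinates, in the order in which [mderiv] nests the partial
    derivatives. *)
Definition word_of (mu : 'I_d -> nat) : seq 'I_d := flatten [seq nseq (mu i) i | i <- enum 'I_d].

Definition wderiv (s : seq 'I_d) F := foldr pderivC F s.

Lemma foldr_word_of (T : Type) (op : 'I_d -> T -> T) (mu : 'I_d -> nat) t :
  foldr op t (word_of mu) = foldr (fun i g => iter (mu i) (op i) g) t (enum 'I_d).
Proof.
rewrite /word_of; elim: (enum _) => //= i s <-; rewrite foldr_cat.
by elim: (mu i) => //= n ->.
Qed.

Lemma size_word_of (mu : 'I_d -> nat) : size (word_of mu) = mabs mu.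
Proof.
rewrite size_flatten /shape -map_comp sumnE big_map /mabs big_enum /=.
by apply: eq_bigr => i _; rewrite size_nseq.
Qed.

Lemma count_word_of (mu : 'I_d -> nat) j : count_mem j (word_of mu) = mu j.
Proof.
rewrite count_flatten -map_comp sumnE big_map big_enum /=.
rewrite (bigD1 j)//= count_nseq /= eqxx mul1n big1 ?addn0// => i ij.
by rewrite count_nseq /= (negbTE ij) mul0n.
Qed.

Lemma mderivC_word (mu : 'I_d -> nat) F : mderivC mu F = wderiv (word_of mu) F.
Proof.
have h s : reC \o wderiv s F = foldr (@pderiv R d) (reC \o F) s /\
           imC \o wderiv s F = foldr (@pderiv R d) (imC \o F) s.
  elim: s => [//|j s [ih1 ih2]] /=; rewrite -ih1 -ih2; split; exact/funext.
apply/funext => x; rewrite /mderivC /mderiv -!foldr_word_of.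
have [<- <-] := h (word_of mu); rewrite /=.
by case: (wderiv _ _ _).
Qed.

(** Common induction for iterated derivatives: [k] counts the orders of regularity still available
    and drops by one at each derivative, while a companion object is transported by [op]. *)
Lemma wderiv_rel (X : Type) (Rl : nat -> (V -> C) -> X -> Prop) (op : 'I_d -> X -> X) :
  (forall k f h, Rl k.+1 f h -> forall j, Rl k (pderivC j f) (op j h)) ->
  forall s k f h, Rl (size s + k)%N f h -> Rl k (wderiv s f) (foldr op h s).
Proof.
move=> hR; elim=> [//|j s ih] k f h /= hk; apply: hR; apply: ih.
by rewrite addnS -addSn.
Qed.

Lemma wderiv_CnC s k F : CnC (size s + k) F -> CnC k (wderiv s F).
Proof.
apply: (@wderiv_rel unit (fun k f _ => CnC k f) (fun _ h => h) _ s k F tt).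
by move=> l f _ /CnC_S[_ h] j; have [] := h j.
Qed.

(** The complement of the closed cube is open, so near each of its points the function is
    identically zero and so is its derivative. *)
Lemma wderiv_csupp s B F : CnC (size s) F -> csupp B F -> csupp B (wderiv s F).
Proof.
rewrite -[size s]addn0 => cF hB.
have [] // := @wderiv_rel unit (fun k f _ => CnC k f /\ csupp B f) (fun _ h => h) _ s 0 F tt (conj cF hB).
move=> k f _ [/CnC_S[cf hf] fB] j; have [df ck] := hf j; split => // x xB.
have E : \forall y \near x, f y = 0.
  have : \forall y \near x, B%:R < `|y|.
    by have := @norm_continuous R V x; move/cvgr_gt; apply.
  by apply: filterS => y; exact: fB.
have hz (g : C -> R) : g 0 = 0 -> 'D_(ej j) (g \o f) x = 0.
  move=> g0; rewrite (@near_eq_derive _ _ _ _ (cst 0)) ?derive_cst//.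
  by apply: filterS E => y /= ->.
by apply: complexP; rewrite /pderivC /=; exact: hz.
Qed.

Lemma wderiv_comm (P : nat -> (V -> C) -> Prop) (T : (V -> C) -> V -> C) :
  (forall k f, P k.+1 f -> forall j, P k (pderivC j f) /\ pderivC j (T f) = T (pderivC j f)) ->
  forall s f, P (size s) f -> wderiv s (T f) = T (wderiv s f).
Proof.
move=> hP s f; rewrite -[size s]addn0 => Pf.
have [] // := @wderiv_rel (V -> C) (fun k f' f => P k f /\ f' = T f) (@pderivC) _ s 0 (T f) f (conj Pf erefl).
by move=> k f' f1 [Pf1 ->] j; have [p1 p2] := hP _ _ Pf1 j.
Qed.

(** For families of functions stable under differentiation, whose parameter is transformed by [op]:
    Fourier transforms, symbols of filters, multiples of a character. *)
Lemma wderiv_family (X : Type) (ok : X -> Prop) (op : 'I_d -> X -> X) (fam : X -> V -> C) :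
  (forall h, ok h -> forall j, ok (op j h) /\ DC j (fam h) (fam (op j h))) ->
  forall s h, ok h -> wderiv s (fam h) = fam (foldr op h s).
Proof.
move=> hf s h okh.
have [] // := @wderiv_rel X (fun k f h => ok h /\ f = fam h) op _ s 0 (fam h) h (conj okh erefl).
by move=> k f h' [ok' ->] j; have [? /DC_pderivC ->] := hf _ ok' j.
Qed.

Lemma smooth_family (X : Type) (ok : X -> Prop) (op : 'I_d -> X -> X) (fam : X -> V -> C) :
  (forall h, ok h -> forall j, ok (op j h) /\ DC j (fam h) (fam (op j h))) ->
  (forall h, ok h -> CnC 0 (fam h)) ->
  forall h, ok h -> smooth (fam h).
Proof.
move=> hf hc h okh k; elim: k h okh => [|k ih] h okh; first exact: hc.
apply: CnC_DC; first exact: hc.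
move=> j; have [ok' dj] := hf _ okh j; exists (fam (op j h)) => //; exact: ih.
Qed.

(** Mean value theorem for increments of either sign; the intermediate point is located by its
    modulus only. *)
Lemma MVT_from0 (f df : R -> R) (h : R) : (forall t : R, is_derive t 1 f (df t)) ->
  exists2 t : R, `|t| <= `|h| & f h - f 0 = h * df t.
Proof.
move=> hf; have cf (a b : R) : {within `[a, b], continuous f}.
  by apply: derivable_within_continuous => t _; have [] := hf t.
have [h0|h0] := leP 0 h.
  have [t] := MVT_segment h0 (fun t _ => hf t) (cf _ _).
  rewrite in_itv /= => /andP[t0 th] E; exists t; first by rewrite !ger0_norm.
  by rewrite E subr0 mulrC.
have [t] := MVT_segment (ltW h0) (fun t _ => hf t) (cf _ _).
rewrite in_itv /= => /andP[t0 th] E; exists t; first by rewrite !ler0_norm ?lerN2// ltW.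
by rewrite -opprB E sub0r mulrN opprK mulrC.
Qed.

Lemma isD_MVT j u u' x (h : R) : isD j u u' ->
  exists2 t : R, `|t| <= `|h| & u (x + h *: ej j) - u x = h * u' (x + t *: ej j).
Proof.
move=> hu; pose f (t : R) := u (t *: ej j + x).
have df (t : R) : is_derive t 1 f (u' (t *: ej j + x)).
  exact: ((is_derive_line u x (ej j) t _).1 (hu _)).
have [t th] := MVT_from0 h df; rewrite /f scale0r add0r ![_ + x]addrC => E.
by exists t.
Qed.

(** A quadratic remainder determines the derivative. This is how transforms are differentiated under
    the integral sign without a limit theorem for integrals. *)
Lemma is_derive_of_bound (W : normedModType R) (u : W -> R) (x v : W) (l K : R) :
  (forall t : R, `|u (x + t *: v) - u x - t * l| <= K * t ^+ 2) -> is_derive x v u l.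
Proof.
move=> h; have K0 : 0 <= K by have := h 1; rewrite expr1n mulr1; apply: le_trans.
have c : (fun t : R => t^-1 *: ((u \o shift x) (t *: v) - u x)) @ 0^' --> l.
  apply/cvgrPdist_le => e e0; have K1 : 0 < K + 1 by rewrite ltr_wpDl.
  near=> t.
  have t0 : t != 0 by near: t; exact: nbhs_dnbhs_neq.
  have te : `|t| <= e / (K + 1).
    near: t; apply: dnbhs0_le; exact: divr_gt0.
  rewrite /= [t *: v + x]addrC distrC -[l](mulKf t0) -mulrBr normrM normfV.
  rewrite ler_pdivrMl ?normr_gt0//.
  apply: (le_trans (h t)); rewrite -real_normK ?num_real// expr2 mulrCA ler_wpM2l//.
  by move: te; rewrite ler_pdivlMr//; have := normr_ge0 t; nra.
by apply: DeriveDef; [apply/cvg_ex; exists l|exact: cvg_lim].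
Unshelve. all: by end_near. Qed.

Lemma DC_of_bound j F F' : (forall x, exists K : R, forall t : R,
    normc (F (x + t *: ej j) - F x - rc t * F' x) <= K * t ^+ 2) -> DC j F F'.
Proof.
move=> h; split => x; have [K hK] := h x; apply: (is_derive_of_bound (K := K)) => t.
  apply: le_trans (hK t); apply: le_trans (normc_Re _).
  by rewrite !cReD !cReN cReM /= mul0r subr0.
apply: le_trans (hK t); apply: le_trans (normc_Im _).
by rewrite !cImD !cImN cImM /= mul0r addr0.
Qed.

Lemma CnC0_of_bound F (K : R) :
  (forall x y, normc (F x - F y) <= K * `|x - y|) -> CnC 0 F.
Proof.
move=> h.
have g (p : C -> R) : (forall z w, `|p z - p w| <= normc (z - w)) -> continuous (p \o F).
  move=> hp x; apply/(@cvgrPdist_le _ _ _ (nbhs x) _ (p \o F) (p (F x))) => e e0.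
  have K1 : 0 < `|K| + 1 by rewrite ltr_wpDl.
  apply/nbhs_ballP; exists (e / (`|K| + 1)); first exact: divr_gt0.
  move=> y; rewrite -ball_normE /= ltr_pdivlMr// => xy.
  apply: (le_trans (hp _ _)); apply: (le_trans (h _ _)).
  have := ler_norm K; have := normr_ge0 (x - y); nra.
split; apply: g => z w.
  by rewrite -cReN -cReD; exact: normc_Re.
by rewrite -cImN -cImD; exact: normc_Im.
Qed.

Lemma expi_sub1 (s : R) : normc (expi s - 1) <= 2 * `|s|.
Proof.
apply: (le_trans (normc_le_ReIm _)); rewrite !cReD !cImD !cReN !cImN /= subr0.
have [t _] := MVT_from0 s (fun y => is_derive_cos y); rewrite cos0 => ->.
have [t' _] := MVT_from0 s (fun y => is_derive_sin y); rewrite sin0 subr0 => ->.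
rewrite mulr2n mulrDl mul1r !normrM normrN lerD// ler_piMr//; last exact: cos_max.
exact: sin_max.
Qed.

(** The mean value theorem is used twice on the real part and twice on the imaginary part; the
    factor 2 adds the two bounds. *)
Lemma expi_taylor1 (s : R) : normc (expi s - 1 - iC * rc s) <= 2 * s ^+ 2.
Proof.
apply: (le_trans (normc_le_ReIm _)); rewrite !cReD !cImD !cReN !cImN cReM cImM /=.
rewrite !mul0r mulr0 mul1r ?oppr0 ?addr0 ?add0r ?subr0 mulr2n mulrDl mul1r. rewrite lerD//.
  have [t ts] := MVT_from0 s (fun y => is_derive_cos y); rewrite cos0 => ->.
  have [t' tt'] := MVT_from0 t (fun y => is_derive_sin y); rewrite sin0 subr0 => ->.
  rewrite mulrN normrN !normrM -[leRHS]real_normK ?num_real// expr2 ler_wpM2l//.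
  by rewrite (le_trans _ ts)// ler_piMr// cos_max.
have hd (y : R) : is_derive y 1 (fun t : R => sin t - t) (cos y - 1).
  exact: is_deriveB.
have [t ts] := MVT_from0 s hd; rewrite sin0 subrr subr0 => ->.
have [t' tt'] := MVT_from0 t (fun y => is_derive_cos y); rewrite cos0 => ->.
rewrite mulrN mulrN normrN !normrM -[leRHS]real_normK ?num_real// expr2 ler_wpM2l//.
by rewrite (le_trans _ ts)// ler_piMr// sin_max.
Qed.

End Derivatives.

(** * Fourier transforms and moments *)

Section FourierMoments.
Variables (R : realType) (d : nat).
Local Notation C := R[i].
Local Notation V := 'rV[R]_d.
Local Notation Zd := 'rV[int]_d.
Local Notation rc := (real_complex R).
Local Notation reC := (@complex.Re R).
Local Notation imC := (@complex.Im R).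
Local Notation ej j := (delta_mx 0 j : V).
Local Notation iC := (Complex 0 1 : C).
Implicit Types (F G h : V -> C) (s : seq 'I_d).

(** Monomials indexed by words: products are concatenations, and the degree is the length. *)
Definition wmono s (x : V) : C := \prod_(i <- s) rc (x 0 i).

Lemma wmono_cons j s x : wmono (j :: s) x = rc (x 0 j) * wmono s x.
Proof. by rewrite /wmono big_cons. Qed.

Lemma wmono_nil x : wmono [::] x = 1.
Proof. by rewrite /wmono big_nil. Qed.

Lemma CnC0_coord j : CnC 0 (fun x : V => rc (x 0 j)).
Proof. exact/CnC0_rc/cont_coord. Qed.

Lemma CnC0_wmono s : CnC 0 (wmono s).
Proof.
elim: s => [|j s ih].
  by have := @CnC0_cst R d 1; congr CnC; apply/funext => x; rewrite wmono_nil.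
have := CnC0_mul (CnC0_coord j) ih; congr CnC.
by apply/funext => x; rewrite wmono_cons.
Qed.

Lemma wmonoZ s (c : R) x : wmono s (c *: x) = rc c ^+ size s * wmono s x.
Proof.
elim: s => [|j s ih]; first by rewrite !wmono_nil mulr1.
by rewrite !wmono_cons ih mxE rcM exprS mulrACA.
Qed.

(** Binomial expansion with its lower terms gathered in an unspecified list, of which only the
    smaller degrees matter later. *)
Lemma wmono_shift s (y : V) : exists2 L : seq (C * seq 'I_d),
  all (fun p => size p.2 < size s)%N L &
  forall x, wmono s (x + y) = wmono s x + \sum_(p <- L) p.1 * wmono p.2 x.
Proof.
elim: s => [|j s [L hL h]].
  by exists [::] => // x; rewrite !wmono_nil big_nil addr0.
exists ((rc (y 0 j), s) :: [seq (p.1, j :: p.2) | p <- L] ++ [seq (rc (y 0 j) * p.1, p.2) | p <- L]).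
  rewrite /= ltnSn /= all_cat !all_map; apply/andP; split.
    by apply: sub_all hL => p.
  by apply: sub_all hL => p /= ps; exact: ltnW.
move=> x; rewrite !wmono_cons mxE rcD h mulrDl !mulrDr big_cons big_cat !big_map /=.
rewrite !mulr_sumr -!addrA; congr (_ + _); rewrite addrCA; congr (_ + _).
congr (_ + _); apply: eq_bigr => p _; first by rewrite wmono_cons mulrCA.
by rewrite mulrA.
Qed.

Lemma wmono_perm s t x : perm_eq s t -> wmono s x = wmono t x.
Proof. by move=> st; apply: perm_big. Qed.

Lemma perm_word_of s : perm_eq s (word_of (fun j => count_mem j s)).
Proof. by apply/allP => j _ /=; rewrite count_word_of. Qed.

Definition ft h (xi : V) : C := intRn (fun x => h x * expi (- dotp x xi)).

Lemma fourierE r q (G : V -> 'M[C]_(r, q)) xi i j : fourier G xi i j = ft (fun x => G x i j) xi.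
Proof. by rewrite mxE. Qed.

Lemma cc_ft h xi : cc h -> cc (fun x => h x * expi (- dotp x xi)).
Proof. by move=> ch; apply: cc_mul => //; exact: cont_cos_line. Qed.

Lemma expi_sub_sym (s t : R) : expi s - expi t = expi t * (expi (s - t) - 1) :> C.
Proof. by rewrite mulrBr mulr1 -expiD subrKC. Qed.

Lemma ft_cont h : cc h -> CnC 0 (ft h).
Proof.
move=> ch; have [_ [B hB]] := ch; have [K K0 hK] := cc_bounded ch.
apply: (@CnC0_of_bound _ _ _ ((B.*2.+1 ^ d)%:R * (K * (2 * (d%:R * B%:R))))) => x y.
rewrite -intRn_sub; try exact: cc_ft.
rewrite -mulrA; apply: intRn_bound.
- by apply: cc_sub; exact: cc_ft.
- by move=> z zB; rewrite hB// !mul0r subrr.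
- by rewrite !mulr_ge0.
move=> z; have [zB|zB] := leP `|z| B%:R; last first.
  by rewrite hB// !mul0r subrr ComplexField.Normc.normc0 !mulr_ge0.
rewrite -mulrBr ComplexField.Normc.normcM expi_sub_sym ComplexField.Normc.normcM normc_expi mul1r.
rewrite -mulrA; apply: ler_pM; rewrite ?normc_ge0//.
apply: (le_trans (expi_sub1 _)); rewrite -mulrA ler_wpM2l//.
rewrite opprK addrC !(dotpC z) -dotpNl -dotpDl.
apply: (le_trans (dotp_bound _ _)); rewrite -mulrA ler_wpM2l// [leLHS]mulrC distrC.
by rewrite ler_wpM2r.
Qed.

(** Differentiation under the integral: the Taylor bound of the exponential is uniform on the
    support of [h], so the remainder is quadratic in the increment. *)
Lemma DC_ft j h : cc h -> DC j (ft h) (ft (fun x => - iC * rc (x 0 j) * h x)).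
Proof.
move=> ch; have [_ [B hB]] := ch; have [K K0 hK] := cc_bounded ch.
have ch' : cc (fun x => - iC * rc (x 0 j) * h x).
  have := cc_scale (- iC) (cc_mul ch (CnC0_coord j)); congr cc.
  by apply/funext => x; rewrite -mulrA [h x * _]mulrC.
apply: DC_of_bound => xi; exists ((B.*2.+1 ^ d)%:R * (K * (2 * B%:R ^+ 2))) => t.
rewrite -intRn_scale; last exact: cc_ft.
have c1 := cc_sub (cc_ft (xi + t *: ej j) ch) (cc_ft xi ch).
have c2 := cc_scale (rc t) (cc_ft xi ch').
rewrite -intRn_sub; try exact: cc_ft.
rewrite -intRn_sub//.
rewrite -mulrA; apply: intRn_bound.
- exact: cc_sub.
- by move=> z zB; rewrite hB// !mul0r !mulr0 !mul0r mulr0 !subrr.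
- by rewrite mulr_ge0 ?sqr_ge0// mulr_ge0// mulr_ge0// sqr_ge0.
move=> z; have [zB|zB] := leP `|z| B%:R; last first.
  rewrite hB// !(mul0r, mulr0) !subrr ComplexField.Normc.normc0.
  by rewrite mulr_ge0 ?sqr_ge0// mulr_ge0// mulr_ge0// sqr_ge0.
have -> : h z * expi (- dotp z (xi + t *: ej j)) - h z * expi (- dotp z xi) -
   rc t * (- iC * rc (z 0 j) * h z * expi (- dotp z xi)) =
   h z * expi (- dotp z xi) * (expi (- (t * z 0 j)) - 1 - iC * rc (- (t * z 0 j))).
  rewrite dotpC dotpDl dotpZl dotp_ej opprD expiD (dotpC xi) rcN rcM; ring.
rewrite !ComplexField.Normc.normcM normc_expi mulr1 -mulrA; apply: ler_pM; rewrite ?normc_ge0//.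
apply: (le_trans (expi_taylor1 _)); rewrite -mulrA ler_wpM2l// sqrrN exprMn mulrC.
rewrite ler_wpM2r ?sqr_ge0// -[leLHS]real_normK ?num_real// lerXn2r ?nnegrE//.
exact: (le_trans (rV_norm_coord _ _)).
Qed.

Definition ft_op (j : 'I_d) h : V -> C := fun x => - iC * rc (x 0 j) * h x.

Lemma foldr_ft_op s h : foldr ft_op h s = fun x => (- iC) ^+ size s * wmono s x * h x.
Proof.
elim: s => [|j s ih] /=; apply/funext => x; first by rewrite wmono_nil !mul1r.
rewrite /ft_op ih wmono_cons exprS; ring.
Qed.

Lemma cc_ft_op j h : cc h -> cc (ft_op j h).
Proof.
move=> ch; have := cc_scale (- iC) (cc_mul ch (CnC0_coord j)); congr cc.
by apply/funext => x; rewrite /ft_op -mulrA [h x * _]mulrC.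
Qed.

Lemma wderiv_ft s h : cc h ->
  wderiv s (ft h) = ft (fun x => (- iC) ^+ size s * wmono s x * h x).
Proof.
move=> ch; rewrite -foldr_ft_op.
apply: (@wderiv_family R d _ (@cc R d) ft_op ft) => // h' ch' j.
by split; [exact: cc_ft_op|exact: DC_ft].
Qed.

Definition mom s h : C := intRn (fun x => wmono s x * h x).

Lemma cc_wmono s h : cc h -> cc (fun x => wmono s x * h x).
Proof.
move=> ch; have := cc_mul ch (CnC0_wmono s); congr cc.
by apply/funext => x; rewrite mulrC.
Qed.

Lemma wderiv_ft0 s h : cc h -> wderiv s (ft h) 0 = (- iC) ^+ size s * mom s h.
Proof.
move=> ch; rewrite wderiv_ft// /ft /mom -intRn_scale; last exact: cc_wmono.
by congr intRn; apply/funext => x; rewrite dotpC dotp0l oppr0 expi0 mulr1 mulrA.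
Qed.

Definition sy (c : Zd -> C) (xi : V) : C :=
  \sum_(k \in [set: Zd]) expi (- dotp (zvec R k) xi) * c k.

Definition fmom s (c : Zd -> C) : C := \sum_(k \in [set: Zd]) wmono s (zvec R k) * c k.

Definition sy_op (j : 'I_d) (c : Zd -> C) : Zd -> C :=
  fun k => - iC * rc (zvec R k 0 j) * c k.

Lemma foldr_sy_op s c :
  foldr sy_op c s = fun k => (- iC) ^+ size s * wmono s (zvec R k) * c k.
Proof.
elim: s => [|j s ih] /=; apply/funext => x; first by rewrite wmono_nil !mul1r.
rewrite /sy_op ih wmono_cons exprS; ring.
Qed.

Lemma DC_sy j c : fsupp c -> DC j (sy c) (sy (sy_op j c)).
Proof.
move=> [L hL]; pose f (c : Zd -> C) xi := \sum_(k <- box L) expi (- dotp (zvec R k) xi) * c k.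
have E (c' : Zd -> C) : (forall k, k \notin box L -> c' k = 0) -> sy c' = f c'.
  by move=> h; apply/funext => xi; rewrite /sy (@fsum_box _ _ _ L)// => k /h ->; rewrite mulr0.
rewrite !E//; last by move=> k /hL; rewrite /sy_op => ->; rewrite mulr0.
rewrite /f; apply: (@DC_sum _ _ _ _ _ (fun k xi => expi (- dotp (zvec R k) xi) * c k)
  (fun k xi => expi (- dotp (zvec R k) xi) * sy_op j c k)) => k.
have := DC_scale (c k) (DC_expi' j (zvec R k)); congr DC; apply/funext => xi.
  by rewrite mulrC.
rewrite /sy_op; ring.
Qed.

Lemma fsupp_sy_op j c : fsupp c -> fsupp (sy_op j c).
Proof. by move=> fc; apply: fsupp_bound fc _ => k; rewrite /sy_op => ->; rewrite mulr0. Qed.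

Lemma wderiv_sy s c : fsupp c ->
  wderiv s (sy c) = sy (fun k => (- iC) ^+ size s * wmono s (zvec R k) * c k).
Proof.
move=> fc; rewrite -foldr_sy_op.
apply: (@wderiv_family _ _ _ (@fsupp d C) sy_op sy) => // c' fc' j.
by split; [exact: fsupp_sy_op|exact: DC_sy].
Qed.

Lemma wderiv_sy0 s c : fsupp c -> wderiv s (sy c) 0 = (- iC) ^+ size s * fmom s c.
Proof.
move=> fc; rewrite wderiv_sy// /sy /fmom mulr_fsumr.
by apply: eq_fsbigr => k _; rewrite dotpC dotp0l oppr0 expi0 mul1r mulrA.
Qed.

Lemma sy_cont c : fsupp c -> CnC 0 (sy c).
Proof.
move=> [L hL].
have -> : sy c = fun xi => \sum_(k <- box L) expi (- dotp (zvec R k) xi) * c k.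
  by apply/funext => xi; rewrite /sy (@fsum_box _ _ _ L)// => k /hL ->; rewrite mulr0.
apply: CnC0_sum => k; apply: CnC0_mul; last exact: CnC0_cst.
have := cont_cos_line (zvec R k); congr CnC; apply/funext => x; rewrite dotpC//.
Qed.

(** Difference quotients have integral zero by translation invariance, and the mean value theorem
    brings them uniformly close to the derivative. *)
Lemma DC_intRn0 (B : nat) j F : CnC 1 F -> csupp B F -> intRn (pderivC j F) = 0.
Proof.
move=> c1 hB; have /CnC_S[cF hF] := c1; have [dF cF'] := hF j.
have fc : cc F by split => //; exists B.
have fB' : csupp B (pderivC j F) by exact: (@wderiv_csupp _ _ [:: j] B F c1 hB).
have fc' : cc (pderivC j F) by split => //; exists B.
(* The radius is B + 1 because the translation vector of the difference quotient has norm at most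
   1. *)
apply: normc_small => e e0; pose K := ((B + 1).*2.+1 ^ d)%:R : R.
have K0 : 0 < K by rewrite ltr0n expn_gt0.
have e1 : 0 < e / K / 2 by rewrite !divr_gt0.
have [dl dl0 hdl] := cc_unif fc' e1.
pose N := (Num.bound dl^-1).+1; have N0' : (0 : R) < N%:R by rewrite ltr0n.
have Ndl : N%:R^-1 < dl by exact: invn_lt.
pose y : V := - (N%:R^-1 *: ej j).
have ejz : N%:R^-1 *: ej j = N%:R^-1 *: zvec R (delta_mx 0 j : Zd).
  by congr (_ *: _); rewrite /zvec map_delta_mx.
have fcy := cc_shift y fc.
have I0 : intRn (fun x => rc N%:R * (F (x - y) - F x)) = 0.
  rewrite intRn_scale; last exact: cc_sub.
  rewrite intRn_sub//.
  by rewrite intRn_shift// subrr mulr0.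
have fcN : cc (fun x => rc N%:R * (F (x - y) - F x)) by apply/cc_scale/cc_sub.
rewrite -[intRn _]subr0 -I0 -intRn_sub//.
have -> : e = K * (e / K) by rewrite mulrC divfK// lt0r_neq0.
have y1 : `|y| <= 1.
  rewrite normrN normrZ ger0_norm ?invr_ge0// mulr_ile1 ?invr_ge0// ?invf_le1 ?ler1n//.
  by apply: rV_norm_le => // i; rewrite mxE eqxx /=; case: (_ == _); rewrite ?normr1 ?normr0.
apply: intRn_bound; first exact: cc_sub.
- move=> x; rewrite natrD => xB; have xB' : B%:R < `|x| by apply: le_lt_trans xB; rewrite lerDl.
  have := lerB_normD x (- y); rewrite normrN => h.
  rewrite fB'// !hB ?subrr ?mulr0 ?subrr//.
  lra.
- by rewrite divr_ge0// ltW.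
move=> x; rewrite [leRHS]splitr; apply: (le_trans (normc_le_ReIm _)).
have [d1 d2] := dF; have Exy : x - y = x + N%:R^-1 *: ej j by rewrite opprK.
have tN (t : R) : `|t| <= `|N%:R^-1| -> `|x - (x + t *: ej j)| < dl.
  move=> tN; rewrite opprD addrA subrr add0r normrN normrZ.
  apply: le_lt_trans Ndl; rewrite -[leRHS]mulr1; move: tN; rewrite ger0_norm ?invr_ge0// => tN.
  apply: ler_pM => //; apply: rV_norm_le => // i; rewrite mxE eqxx /=.
  by case: (_ == _); rewrite ?normr1 ?normr0.
apply: lerD.
  have [t /tN tx E] := isD_MVT x N%:R^-1 d1.
  rewrite Exy cReD cReN cReM [imC (rc _)]/= [reC (rc _)]/= mul0r subr0 cReD cReN.
  move: E; rewrite /comp => ->; rewrite mulrA divff ?lt0r_neq0// mul1r -cReN -cReD.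
  exact: (le_trans (normc_Re _) (hdl _ _ tx)).
have [t /tN tx E] := isD_MVT x N%:R^-1 d2.
rewrite Exy cImD cImN cImM [imC (rc _)]/= [reC (rc _)]/= mul0r addr0 cImD cImN.
move: E; rewrite /comp => ->; rewrite mulrA divff ?lt0r_neq0// mul1r -cImN -cImD.
exact: (le_trans (normc_Im _) (hdl _ _ tx)).
Qed.

Lemma intRn_by_parts (B : nat) j F G : CnC 1 F -> csupp B F -> CnC 1 G ->
  intRn (fun x => pderivC j F x * G x) = - intRn (fun x => F x * pderivC j G x).
Proof.
move=> cF hB cG; have /CnC_S[cF0 /(_ j)[dF cF']] := cF.
have /CnC_S[cG0 /(_ j)[dG cG']] := cG.
have fB' : csupp B (pderivC j F) by exact: (@wderiv_csupp _ _ [:: j] B F cF hB).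
have h1 : cc (fun x => pderivC j F x * G x) by apply: cc_mul => //; split => //; exists B.
have h2 : cc (fun x => F x * pderivC j G x) by apply: cc_mul => //; split => //; exists B.
apply/eqP; rewrite -addr_eq0 -intRn_add//; apply/eqP.
rewrite -[RHS](@DC_intRn0 B j (fun x => F x * G x)).
- by congr intRn; rewrite (DC_pderivC (DC_mul dF dG)).
- exact: CnC_mul.
- by move=> x /hB ->; rewrite mul0r.
Qed.

End FourierMoments.

(** * Filters and subdivision *)

Section FilterAlgebra.
Variables (R : realType) (d : nat).
Local Notation C := R[i].
Local Notation V := 'rV[R]_d.
Local Notation Zd := 'rV[int]_d.
Local Notation rc := (real_complex R).
Implicit Types (k z y : Zd).

Lemma l0P p q (v : Zd -> 'M[C]_(p, q)) : l0 v <-> fsupp v.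
Proof. exact: fsuppP. Qed.

Lemma fconv_box p q t (v : Zd -> 'M[C]_(p, q)) (w : Zd -> 'M[C]_(q, t)) L k :
  (forall z, z \notin box L -> v z = 0) ->
  fconv v w k = \sum_(z <- box L) v z *m w (k - z).
Proof. by move=> h; rewrite /fconv (@fsum_box _ _ _ L)// => z /h ->; rewrite mul0mx. Qed.

Lemma fconv_boxr p q t (v : Zd -> 'M[C]_(p, q)) (w : Zd -> 'M[C]_(q, t)) L k :
  (forall z, z \notin box L -> w z = 0) ->
  fconv v w k = \sum_(z <- box L) v (k - z) *m w z.
Proof.
move=> h; rewrite /fconv.
rewrite -(fsum_shift (fun z => v z *m w (k - z)) k) -fsum_opp.
rewrite (@fsum_box _ _ _ L).
  by apply: eq_bigr => z _; rewrite addrC opprD opprK addrA subrr add0r.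
by move=> z /h h0; rewrite opprD opprK subrKC h0 mulmx0.
Qed.

Lemma fconvA p q t o (a : Zd -> 'M[C]_(p, q)) (u : Zd -> 'M[C]_(q, t))
    (w : Zd -> 'M[C]_(t, o)) : fsupp a -> fsupp w ->
  fconv a (fconv u w) = fconv (fconv a u) w.
Proof.
move=> [La ha] [Lw hw]; apply/funext => k.
rewrite (fconv_box _ _ ha) (fconv_boxr _ _ hw).
under eq_bigr => z _ do rewrite (fconv_boxr _ _ hw) mulmx_sumr.
rewrite exchange_big; apply: eq_bigr => y _ /=.
rewrite (fconv_box _ _ ha) mulmx_suml; apply: eq_bigr => z _.
by rewrite mulmxA addrAC.
Qed.

Lemma fconv_supp p q t (v : Zd -> 'M[C]_(p, q)) (w : Zd -> 'M[C]_(q, t)) L L' :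
  (forall z, z \notin box L -> v z = 0) -> (forall z, z \notin box L' -> w z = 0) ->
  forall k, k \notin box (L + L') -> fconv v w k = 0.
Proof.
move=> hv hw k kb; rewrite (fconv_box _ _ hv) big_seq big1// => z zb.
rewrite (hw (k - z)) ?mulmx0//; apply: contraNN kb => kz.
by rewrite -(subrKC z k) boxD.
Qed.

(** Treats symbols and moments together: [f] is an exponential or a monomial, and the filter
    identities are proved once for arbitrary [f]. *)
Definition pairing p q (f : Zd -> C) (v : Zd -> 'M[C]_(p, q)) : 'M[C]_(p, q) :=
  \sum_(k \in [set: Zd]) f k *: v k.

Lemma pairing_box p q f (v : Zd -> 'M[C]_(p, q)) L :
  (forall z, z \notin box L -> v z = 0) ->
  pairing f v = \sum_(k <- box L) f k *: v k.
Proof. by move=> h; rewrite /pairing (@fsum_box _ _ _ L)// => z /h ->; rewrite scaler0. Qed.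

Lemma pairing_entry p q f (v : Zd -> 'M[C]_(p, q)) i j : fsupp v ->
  pairing f v i j = \sum_(k \in [set: Zd]) f k * v k i j.
Proof.
move=> [L h]; rewrite (pairing_box _ h) summxE (@fsum_box _ _ _ L).
  by apply: eq_bigr => k _; rewrite mxE.
by move=> k /h ->; rewrite mxE mulr0.
Qed.

Lemma pairing_fconv p q t f (v : Zd -> 'M[C]_(p, q)) (w : Zd -> 'M[C]_(q, t)) Lv Lw :
  (forall z, z \notin box Lv -> v z = 0) -> (forall z, z \notin box Lw -> w z = 0) ->
  pairing f (fconv v w) =
  \sum_(y <- box Lw) \sum_(z <- box Lv) f (z + y) *: (v z *m w y).
Proof.
move=> hv hw; rewrite /pairing.
transitivity (\sum_(k \in [set: Zd]) \sum_(z <- box Lv) f k *: (v z *m w (k - z))).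
  by apply: eq_fsbigr => k _; rewrite (fconv_box _ _ hv) scaler_sumr.
rewrite fsum_sum; last first.
  move=> z; have [L h] : fsupp (fun k => w (k - z)) by apply: fsupp_shift; exists Lw.
  by exists L => k /h ->; rewrite mulmx0 scaler0.
rewrite [RHS]exchange_big; apply: eq_bigr => z _.
rewrite -(fsum_shift _ z) (@fsum_box _ _ _ Lw).
  by apply: eq_bigr => y _; rewrite addrK addrC.
by move=> y yb; rewrite addrK hw// mulmx0 scaler0.
Qed.

Lemma symbol_pairing p q (v : Zd -> 'M[C]_(p, q)) xi :
  symbol v xi = pairing (fun k => expi (- dotp (zvec R k) xi)) v.
Proof. by []. Qed.

Lemma symbol_entry p q (v : Zd -> 'M[C]_(p, q)) xi i j : fsupp v ->
  symbol v xi i j = sy (fun k => v k i j) xi.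
Proof. exact: pairing_entry. Qed.

Lemma symbol_fconv p q t (v : Zd -> 'M[C]_(p, q)) (w : Zd -> 'M[C]_(q, t)) xi :
  fsupp v -> fsupp w -> symbol (fconv v w) xi = symbol v xi *m symbol w xi.
Proof.
move=> [Lv hv] [Lw hw]; rewrite !symbol_pairing (pairing_fconv _ hv hw).
rewrite (pairing_box _ hv) (pairing_box _ hw) mulmx_sumr.
apply: eq_bigr => y _; rewrite mulmx_suml; apply: eq_bigr => z _.
by rewrite -scalemxAl -scalemxAr scalerA zvecD dotpDl opprD expiD.
Qed.

Section Subdivision.
Variables (M r : nat) (a : Zd -> 'M[C]_r).
Hypotheses (hM : (1 < M)%N) (ha : fsupp a).

Let M0 : (0 < M)%N. Proof. exact: ltnW. Qed.

Lemma subdiv_box q (v : Zd -> 'M[C]_(q, r)) L k : (forall z, z \notin box L -> v z = 0) ->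
  subdiv M a v k = M%:R ^+ d *: \sum_(z <- box L) v z *m a (k - z *+ M).
Proof.
by move=> h; rewrite /subdiv (@fsum_box _ _ _ L)// => z /h ->; rewrite mul0mx.
Qed.

Lemma subdiv_supp q (v : Zd -> 'M[C]_(q, r)) La L :
  (forall z, z \notin box La -> a z = 0) -> (forall z, z \notin box L -> v z = 0) ->
  forall k, k \notin box (M * L + La) -> subdiv M a v k = 0.
Proof.
move=> h hv k kb; rewrite (subdiv_box _ hv) big_seq big1 ?scaler0// => z zb.
rewrite (h (k - z *+ M)) ?mulmx0//; apply: contraNN kb => kz.
by rewrite -(subrKC (z *+ M) k) boxD// boxMn.
Qed.

(** One step enlarges a support radius from L to M L + La, so that n steps give at most a constant
    times M^n. *)
Lemma iter_subdiv_supp q (v : Zd -> 'M[C]_(q, r)) : fsupp v ->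
  exists L, forall n k, k \notin box (M ^ n * L) -> iter n (subdiv M a) v k = 0.
Proof.
move=> [Lv hv]; have [La hLa] := ha; exists (Lv + La)%N => n k.
(* Adding [La] to the radius makes the invariant inductive: (M L + La) + La <= M (L + La) as M >=
   2. *)
suff [Ln Lle] : exists2 L, (L + La <= M ^ n * (Lv + La))%N &
    forall k, k \notin box L -> iter n (subdiv M a) v k = 0.
  move=> hn kb; apply: hn; apply: contraNN kb; apply: box_sub; lia.
elim: n {k} => [|n [L h1 h2]].
  by exists Lv; [rewrite expn0 mul1n|exact: hv].
exists (M * L + La)%N; last exact: subdiv_supp.
rewrite expnS -mulnA; apply: (@leq_trans (M * (L + La))); last by rewrite leq_mul2l h1 orbT.
nia.
Qed.

Lemma fsupp_iter_subdiv q (v : Zd -> 'M[C]_(q, r)) n : fsupp v ->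
  fsupp (iter n (subdiv M a) v).
Proof. by move=> /iter_subdiv_supp[L h]; exists (M ^ n * L)%N => k; exact: h. Qed.

Lemma fsupp_deltaI : fsupp (@deltaI R d r).
Proof.
exists 0%N => k; rewrite /deltaI; case: eqP => // ->.
by rewrite mem_box0 eqxx.
Qed.

Lemma fsupp_fconv p q t (v : Zd -> 'M[C]_(p, q)) (w : Zd -> 'M[C]_(q, t)) :
  fsupp v -> fsupp w -> fsupp (fconv v w).
Proof. by move=> [L h] [L' h']; exists (L + L')%N; exact: fconv_supp. Qed.

(** Linearity and covariance of subdivision: translating the data by z translates the n-th iterate
    by M^n z. *)
Lemma iter_subdivE q (v : Zd -> 'M[C]_(q, r)) Lv n k :
  (forall z, z \notin box Lv -> v z = 0) ->
  iter n (subdiv M a) v k =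
  \sum_(z <- box Lv) v z *m iter n (subdiv M a) (@deltaI R d r) (k - z *+ M ^ n).
Proof.
move=> hv; elim: n k => [|n ih] k /=.
  rewrite expn0; case: (boolP (k \in box Lv)) => kb.
    rewrite (bigD1_seq k)/= ?box_uniq// subrr /deltaI eqxx mulmx1 big1 ?addr0// => z zk.
    by rewrite subr_eq0 eq_sym (negbTE zk) mulmx0.
  rewrite hv// big_seq big1// => z zb; rewrite /deltaI mulr1n subr_eq0.
  by case: eqP => [E|]; rewrite ?mulmx0// E zb in kb *.
have [Ld hd] := fsupp_iter_subdiv n fsupp_deltaI.
rewrite {1}/subdiv.
transitivity (M%:R ^+ d *: \sum_(y \in [set: Zd]) \sum_(z <- box Lv)
    v z *m iter n (subdiv M a) (@deltaI R d r) (y - z *+ M ^ n) *m a (k - y *+ M)).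
  by congr (_ *: _); apply: eq_fsbigr => y _; rewrite ih mulmx_suml.
rewrite fsum_sum; last first.
  move=> z; have [L h] : fsupp (fun k => iter n (subdiv M a) (@deltaI R d r) (k - z *+ M ^ n)).
    by apply: fsupp_shift; exists Ld.
  by exists L => y /h ->; rewrite mulmx0 mul0mx.
rewrite scaler_sumr; apply: eq_bigr => z _.
rewrite -(fsum_shift _ (z *+ M ^ n)) (subdiv_box _ hd) -scalemxAr; congr (_ *: _).
rewrite (@fsum_box _ _ _ Ld) ?mulmx_sumr; last first.
  by move=> y yb; rewrite addrK hd// mulmx0 mul0mx.
apply: eq_bigr => y _; rewrite addrK -mulmxA mulrnDl -mulrnA expnSr opprD.
by rewrite addrA addrAC.
Qed.

Lemma fconv_iter_subdiv q t (v : Zd -> 'M[C]_(q, r)) (u : Zd -> 'M[C]_(r, t)) Lv n k :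
  (forall z, z \notin box Lv -> v z = 0) -> fsupp u ->
  fconv (iter n (subdiv M a) v) u k =
  \sum_(z <- box Lv) v z *m fconv (iter n (subdiv M a) (@deltaI R d r)) u (k - z *+ M ^ n).
Proof.
move=> hv [Lu hu]; rewrite (fconv_boxr _ _ hu).
under eq_bigr => y _ do rewrite (iter_subdivE _ _ hv) mulmx_suml.
rewrite exchange_big; apply: eq_bigr => z _ /=.
rewrite (fconv_boxr _ _ hu) mulmx_sumr; apply: eq_bigr => y _.
by rewrite mulmxA addrAC.
Qed.

Lemma pairing_subdiv q f (v : Zd -> 'M[C]_(q, r)) Lv La :
  (forall z, z \notin box Lv -> v z = 0) -> (forall z, z \notin box La -> a z = 0) ->
  pairing f (subdiv M a v) =
  M%:R ^+ d *: \sum_(y <- box La) \sum_(z <- box Lv) f (z *+ M + y) *: (v z *m a y).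
Proof.
move=> hv hLa; rewrite /pairing.
transitivity (\sum_(k \in [set: Zd]) \sum_(z <- box Lv) M%:R ^+ d *: (f k *: (v z *m a (k - z *+ M)))).
  apply: eq_fsbigr => k _; rewrite (subdiv_box _ hv) !scaler_sumr.
  by apply: eq_bigr => z _; rewrite !scalerA mulrC.
rewrite fsum_sum; last first.
  move=> z; have [L h] : fsupp (fun k => a (k - z *+ M)) by apply: fsupp_shift; exists La.
  by exists L => k /h ->; rewrite mulmx0 !scaler0.
rewrite [in RHS]exchange_big scaler_sumr; apply: eq_bigr => z _.
rewrite -(fsum_shift _ (z *+ M)) (@fsum_box _ _ _ La).
  by rewrite scaler_sumr; apply: eq_bigr => y _; rewrite addrK addrC.
by move=> y yb; rewrite addrK hLa// mulmx0 !scaler0.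
Qed.

Lemma symbol_subdiv q (v : Zd -> 'M[C]_(q, r)) xi : fsupp v ->
  symbol (subdiv M a v) xi = M%:R ^+ d *: (symbol v (M%:R *: xi) *m symbol a xi).
Proof.
move=> [Lv hv]; have [La hLa] := ha; rewrite !symbol_pairing (pairing_subdiv _ hv hLa).
rewrite (pairing_box _ hv) (pairing_box _ hLa) mulmx_sumr; congr (_ *: _).
apply: eq_bigr => y _; rewrite mulmx_suml; apply: eq_bigr => z _.
rewrite -scalemxAl -scalemxAr scalerA zvecD zvecMn dotpDl opprD expiD dotpZl.
by rewrite (dotpC _ (M%:R *: xi)) dotpZl (dotpC xi).
Qed.

Lemma prod_mx_recr (A : nat -> 'M[C]_r) n :
  \prod_(1 <= j < n.+2) A j = (\prod_(1 <= j < n.+1) A j) *m A n.+1.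
Proof. exact: big_nat_recr. Qed.

(** Each further subdivision appends on the right the symbol at the smallest argument, which is the
    order of the matrix product in the statement. *)
Lemma symbol_iter_subdiv n xi :
  symbol (iter n (subdiv M a) (@deltaI R d r)) (M%:R ^- n *: xi) =
  (M%:R ^+ d) ^+ n *: \prod_(1 <= j < n.+1) symbol a (M%:R ^- j *: xi).
Proof.
elim: n => [|n ih] /=.
  rewrite big_nil expr0 scale1r invr1 scale1r.
  have [L h] := fsupp_deltaI; rewrite symbol_pairing (@pairing_box _ _ _ _ 0).
    rewrite big_box0 zvec0 dotp0l oppr0 expi0 scale1r /deltaI eqxx.
    by [].
  move=> z; rewrite /deltaI; case: eqP => // ->.
  by rewrite mem_box0 eqxx.
rewrite symbol_subdiv; last exact/fsupp_iter_subdiv/fsupp_deltaI.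
have -> : M%:R *: (M%:R ^- n.+1 *: xi) = M%:R ^- n *: xi :> V.
  by rewrite scalerA exprS invfM mulrA divff ?mul1r// pnatr_eq0 -lt0n.
rewrite ih.
by rewrite [in RHS]prod_mx_recr -scalemxAl scalerA -exprS.
Qed.

Lemma subdiv_deltaI k : subdiv M a (@deltaI R d r) k = M%:R ^+ d *: a k.
Proof.
rewrite /subdiv (@fsum_box _ _ _ 0); last first.
  move=> z; rewrite /deltaI; case: eqP => [->|_ _]; last by rewrite mul0mx.
  by rewrite mem_box0 eqxx.
by rewrite big_box0 /deltaI eqxx mul1mx mul0rn subr0.
Qed.

Definition fmomM p q (s : seq 'I_d) (v : Zd -> 'M[C]_(p, q)) : 'M[C]_(p, q) :=
  pairing (fun k => wmono s (zvec R k)) v.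

(** Agreement of the symbols at 0 up to O(|xi|^(m+1)), expressed by moments because in this form
    convolution and subdivision preserve it. *)
Definition meq (m : nat) p q (v w : Zd -> 'M[C]_(p, q)) :=
  forall s : seq 'I_d, (size s <= m)%N -> fmomM s v = fmomM s w.

(** The monomial at N z + y expands into monomials at z of no larger degree, so the sum depends only
    on moments of order at most [m]. N = 1 serves convolution, N = M subdivision. *)
Lemma pairing_shift_meq m p q (v w : Zd -> 'M[C]_(p, q)) (N : nat) (s : seq 'I_d) y Lv Lw :
  (forall z, z \notin box Lv -> v z = 0) -> (forall z, z \notin box Lw -> w z = 0) ->
  meq m v w -> (size s <= m)%N ->
  \sum_(z <- box Lv) wmono s (zvec R (z *+ N + y)) *: v z =
  \sum_(z <- box Lw) wmono s (zvec R (z *+ N + y)) *: w z.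
Proof.
move=> hv hw vw sm; have [T hT E] := wmono_shift s (zvec R y).
have {}E z : wmono s (zvec R (z *+ N + y)) =
   rc N%:R ^+ size s * wmono s (zvec R z) +
   \sum_(p <- T) p.1 * rc N%:R ^+ size p.2 * wmono p.2 (zvec R z).
  rewrite zvecD zvecMn E wmonoZ; congr (_ + _); apply: eq_bigr => t _.
  by rewrite wmonoZ mulrA.
have step (v' : Zd -> 'M[C]_(p, q)) L : (forall z, z \notin box L -> v' z = 0) ->
   \sum_(z <- box L) wmono s (zvec R (z *+ N + y)) *: v' z =
   rc N%:R ^+ size s *: fmomM s v' +
   \sum_(p <- T) (p.1 * rc N%:R ^+ size p.2) *: fmomM p.2 v'.
  move=> h; rewrite /fmomM (pairing_box _ h) scaler_sumr.
  under [X in _ = _ + X]eq_bigr => t _ do rewrite (pairing_box _ h) scaler_sumr.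
  rewrite [X in _ = _ + X]exchange_big -big_split; apply: eq_bigr => z _ /=.
  rewrite E scalerDl scalerA scaler_suml; congr (_ + _).
  by apply: eq_bigr => t _; rewrite scalerA.
rewrite !step// vw//; congr (_ + _); rewrite [LHS]big_seq [RHS]big_seq; apply: eq_bigr => t tT.
by rewrite vw// (leq_trans _ sm)// ltnW//; exact: (allP hT).
Qed.

Lemma meq_fconv m p q t (v w : Zd -> 'M[C]_(p, q)) (u : Zd -> 'M[C]_(q, t)) :
  fsupp v -> fsupp w -> fsupp u -> meq m v w -> meq m (fconv v u) (fconv w u).
Proof.
move=> [Lv hv] [Lw hw] [Lu hu] vw s sm.
rewrite /fmomM (pairing_fconv _ hv hu) (pairing_fconv _ hw hu).
apply: eq_bigr => y _.
have := pairing_shift_meq 1 y hv hw vw sm => /(congr1 (mulmx^~ (u y))).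
rewrite !mulmx_suml; under eq_bigr do rewrite mulr1n -scalemxAl.
by move=> ->; apply: eq_bigr => z _; rewrite mulr1n -scalemxAl.
Qed.

Lemma meq_subdiv m q (v w : Zd -> 'M[C]_(q, r)) :
  fsupp v -> fsupp w -> meq m v w -> meq m (subdiv M a v) (subdiv M a w).
Proof.
move=> [Lv hv] [Lw hw] vw s sm; have [La hLa] := ha.
rewrite /fmomM (pairing_subdiv _ hv hLa) (pairing_subdiv _ hw hLa); congr (_ *: _).
apply: eq_bigr => y _.
have := pairing_shift_meq M y hv hw vw sm => /(congr1 (mulmx^~ (a y))).
rewrite !mulmx_suml; under eq_bigr do rewrite -scalemxAl.
by move=> ->; apply: eq_bigr => z _; rewrite -scalemxAl.
Qed.

End Subdivision.
End FilterAlgebra.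

(** * Uniform limits of cascades *)

Section UniformLimits.
Variables (R : realType) (d M : nat).
Local Notation C := R[i].
Local Notation V := 'rV[R]_d.
Local Notation Zd := 'rV[int]_d.
Local Notation rc := (real_complex R).
Local Notation iC := (Complex 0 1 : C).
Hypothesis hM : (1 < M)%N.
Implicit Types (F G : nat -> Zd -> C) (f g : V -> C).

(** Closeness to the samples of [g] on the M-adic mesh of level n, one scalar entry at a time; sums
    and shifts of the index are easily followed in this form. *)
Definition ucvg F g := forall e : R, 0 < e -> exists N, forall n, (N <= n)%N ->
  forall k, normc (F n k - g (M%:R ^- n *: zvec R k)) <= e.

Definition wt (tau : R) (n : nat) : C := rc (M%:R `^ (tau * n%:R)).

Let Mgt0 : (0 : R) < M%:R. Proof. by rewrite ltr0n ltnW. Qed.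

Lemma wtS tau n : wt tau n.+1 = rc (M%:R `^ tau) * wt tau n.
Proof.
by rewrite /wt -rcM -natr1 mulrDr mulr1 addrC powRD// lt0r_neq0// implybT.
Qed.

(** The norm is a finite sum of suprema of nonnegative terms, so it tends to 0 exactly when every
    entry does so uniformly; the extended-real limit also asserts that the norms are eventually
    finite. *)
Lemma rescaled_cvgP tau p q (F : nat -> Zd -> 'M[C]_(p, q)) (g : V -> 'M[C]_(p, q)) :
  rescaled_cvg M tau F g <->
  forall i j, ucvg (fun n k => wt tau n * F n k i j) (fun x => g x i j).
Proof.
have E n k i j : (wt tau n *: F n k - g (M%:R ^- n *: zvec R k)) i j =
    wt tau n * F n k i j - g (M%:R ^- n *: zvec R k) i j by rewrite !mxE.
have sup0 (h : Zd -> R) : (forall k, 0 <= h k) ->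
    (0 <= ereal_sup [set (h k)%:E | k in [set: Zd]])%E.
  move=> h0; apply: (@le_trans _ _ (h 0)%:E); first by rewrite lee_fin.
  by apply: ereal_sup_ubound; exists 0.
split.
  move=> h i j e e0.
  have : \forall n \near \oo, (linf_norm (fun k => (wt tau n *: F n k - g (M%:R ^- n *: zvec R k))%R) < e%:E)%E.
    by apply: (h [set x | (x < e%:E)%E]); apply: open_ereal_lt'; rewrite lte_fin.
  move=> [N _ hN]; exists N => n /hN /= le k; rewrite -E -lee_fin.
  apply: le_trans (ltW le); rewrite /linf_norm (bigD1 i)//= (bigD1 j)//=.
  rewrite -[leLHS]adde0 leeD//; last first.
    apply: sume_ge0 => i' _; apply: sume_ge0 => j' _; apply: sup0 => k'; exact: normc_ge0.
  rewrite -[leLHS]adde0 leeD//; last first.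
    by apply: sume_ge0 => j' _; apply: sup0 => k'; exact: normc_ge0.
  by apply: ereal_sup_ubound; exists k.
move=> h; pose l n := linf_norm (fun k => wt tau n *: F n k - g (M%:R ^- n *: zvec R k)).
have l0 n : (0 <= l n)%E.
  by apply: sume_ge0 => i' _; apply: sume_ge0 => j' _; apply: sup0 => k'; exact: normc_ge0.
have hl (e : R) : 0 < e -> exists N, forall n, (N <= n)%N -> (l n <= e%:E)%E.
  (* One more than the number of entries, so that [K] is nonzero even if a dimension is 0. *)
  move=> e0; pose K := (p * q).+1%:R : R.
  have eK : 0 < e / K by rewrite divr_gt0.
  have [N hN] : exists N, forall n, (N <= n)%N -> forall i j k,
      normc (wt tau n * F n k i j - g (M%:R ^- n *: zvec R k) i j) <= e / K.
    have [N hN] := choice (fun ij => h ij.1 ij.2 _ eK).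
    exists (\max_(ij : 'I_p * 'I_q) N ij)%N => n Nn i j k.
    by apply: (hN (i, j)); apply: leq_trans Nn; exact: (leq_bigmax (i, j)).
  exists N => n /hN hn; rewrite /l /linf_norm.
  apply: (@le_trans _ _ (\sum_(i < p) \sum_(j < q) (e / K)%:E)%E).
    apply: lee_sum => i _; apply: lee_sum => j _; apply: ge_ereal_sup => _ [k _ <-].
    by rewrite lee_fin E.
  under eq_bigr do rewrite sumEFin; rewrite sumEFin lee_fin.
  under eq_bigr do rewrite sumr_const card_ord.
  rewrite sumr_const card_ord -mulrnA -mulr_natl mulrCA ger_pMr// ler_pdivrMr ?ltr0n//.
  by rewrite mul1r ler_nat; lia.
apply/fine_cvgP; split.
  have [N hN] := hl 1 ltr01; exists N => // n /hN ln.
  by rewrite ge0_fin_numE; [exact: le_lt_trans ln (ltry _)|exact: l0].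
apply/cvgrPdist_le => e e0; have [N hN] := hl e e0; exists N => // n /hN ln.
rewrite /= sub0r normrN -/(l n); have lf : l n \is a fin_num.
  by rewrite ge0_fin_numE; [exact: le_lt_trans ln (ltry _)|exact: l0].
rewrite ger0_norm ?fine_ge0; last exact: l0.
by rewrite -lee_fin fineK.
Unshelve.
all: by [].
Qed.

Lemma ucvgD F G f g : ucvg F f -> ucvg G g ->
  ucvg (fun n k => F n k + G n k) (fun x => f x + g x).
Proof.
move=> h h' e e0; have e2 : 0 < e / 2 by rewrite divr_gt0.
have [N hN] := h _ e2; have [N' hN'] := h' _ e2.
exists (maxn N N') => n; rewrite geq_max => /andP[/hN h1 /hN' h2] k.
rewrite opprD addrACA (le_trans (le_normcD _ _))//.
by rewrite [leRHS]splitr lerD.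
Qed.

Lemma ucvgZ (c : C) F f : ucvg F f -> ucvg (fun n k => c * F n k) (fun x => c * f x).
Proof.
move=> h e e0; have c0 : 0 < normc c + 1 by rewrite ltr_wpDl ?normc_ge0.
have [N hN] := h _ (divr_gt0 e0 c0); exists N => n /hN hn k.
rewrite -mulrBr ComplexField.Normc.normcM.
apply: (le_trans (ler_wpM2l (normc_ge0 c) (hn k))).
rewrite mulrCA ger_pMr// ler_pdivrMr// mul1r lerDl//.
Qed.

Lemma ucvg0 : ucvg (fun _ _ => 0) (fun=> 0).
Proof. by move=> e e0; exists 0%N => n _ k; rewrite subrr ComplexField.Normc.normc0 ltW. Qed.

Lemma ucvg_sum I (s : seq I) (F : I -> nat -> Zd -> C) (f : I -> V -> C) :
  (forall i, ucvg (F i) (f i)) ->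
  ucvg (fun n k => \sum_(i <- s) F i n k) (fun x => \sum_(i <- s) f i x).
Proof.
move=> h; elim: s => [|i s ih].
  have := ucvg0; congr ucvg; first by apply/funext => n; apply/funext => k; rewrite big_nil.
  by apply/funext => x; rewrite big_nil.
have := ucvgD (h i) ih; congr ucvg.
  by apply/funext => n; apply/funext => k; rewrite big_cons.
by apply/funext => x; rewrite big_cons.
Qed.

Lemma ucvg_ext F G f : (forall n k, F n k = G n k) -> ucvg F f -> ucvg G f.
Proof. by move=> FG; congr ucvg; apply/funext => n; apply/funext. Qed.

Lemma madic_natmul n (z : Zd) : M%:R ^- n *: zvec R (z *+ M ^ n) = zvec R z.
Proof.
by rewrite zvecMn natrX scalerA mulVf ?scale1r// expf_neq0// lt0r_neq0.
Qed.

(** At every level, a shift of the index by M^n z moves the mesh point by the fixed vector z. *)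
Lemma ucvg_mshift F g (z : Zd) : ucvg F g ->
  ucvg (fun n k => F n (k - z *+ M ^ n)) (fun x => g (x - zvec R z)).
Proof.
move=> h e /h[N hN]; exists N => n /hN /(_ (_ - _)) hn k.
by have := hn k (z *+ M ^ n); rewrite zvecB scalerBr madic_natmul.
Qed.

Lemma madic_small (e : R) : 0 < e -> exists N, forall n, (N <= n)%N -> M%:R ^- n < e.
Proof.
move=> e0; exists (Num.bound e^-1).+1 => n Nn; rewrite -natrX.
by apply: invn_lt => //; apply: (leq_trans Nn); rewrite ltnW// ltn_expl.
Qed.

Lemma madic_approx (x : V) (e : R) : 0 < e -> exists N, forall n, (N <= n)%N ->
  exists k : Zd, `|x - M%:R ^- n *: zvec R k| < e.
Proof.
move=> /madic_small[N hN]; exists N => n /hN ne.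
exists (\row_j Num.floor ((M ^ n)%:R * x 0 j)); apply: le_lt_trans ne.
by rewrite -natrX; apply: grid_approx; rewrite expn_gt0 ltnW.
Qed.

Lemma madic_eq f g : CnC 0 f -> CnC 0 g ->
  (forall n (k : Zd), f (M%:R ^- n *: zvec R k) = g (M%:R ^- n *: zvec R k)) -> f = g.
Proof.
move=> cf cg fg; apply/funext => x; apply/eqP; rewrite -subr_eq0; apply/eqP.
apply: normc_small => e e0.
have [dl dl0 h] := CnC0_unif `|x| (CnC0_sub cf cg) e0.
have [N /(_ N (leqnn N))[k xk]] := madic_approx x dl0.
by have := h _ _ (lexx _) xk; rewrite fg subrr subr0.
Qed.

(** Two continuous limits are compared at M-adic points, each of which lies on all finer meshes. *)
Lemma ucvg_unique F f g : CnC 0 f -> CnC 0 g -> ucvg F f -> ucvg F g -> f = g.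
Proof.
move=> cf cg hf hg; apply: madic_eq => // n0 k0.
apply/eqP; rewrite -subr_eq0; apply/eqP; apply: normc_small => e e0.
have e2 : 0 < e / 2 by rewrite divr_gt0.
have [N1 h1] := hf _ e2; have [N2 h2] := hg _ e2.
pose n := maxn n0 (maxn N1 N2); have n0n : (n0 <= n)%N by rewrite leq_maxl.
have n1 : (N1 <= n)%N by rewrite (leq_trans (leq_maxl N1 N2))// leq_maxr.
have n2 : (N2 <= n)%N by rewrite (leq_trans (leq_maxr N1 N2))// leq_maxr.
have E : M%:R ^- n *: zvec R (k0 *+ M ^ (n - n0)) = M%:R ^- n0 *: zvec R k0.
  rewrite zvecMn natrX scalerA; congr (_ *: _).
  by rewrite -{1}(subnK n0n) exprD invfM mulrC mulrA divff ?mul1r// expf_neq0// lt0r_neq0.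
have := h1 _ n1 (k0 *+ M ^ (n - n0)); have := h2 _ n2 (k0 *+ M ^ (n - n0)); rewrite !E.
set w := F _ _ => a2 a1; apply: (le_trans (normc_distD _ w _)).
by rewrite normcB_sym [leRHS]splitr lerD.
Qed.

(** A shift of the index by a fixed z moves the mesh point by M^(-n) z only, which uniform
    continuity makes negligible. *)
Lemma ucvg_shift F g (z : Zd) : cc g -> ucvg F g -> ucvg (fun n k => F n (k - z)) g.
Proof.
move=> cg h e e0; have e2 : 0 < e / 2 by rewrite divr_gt0.
have [N1 h1] := h _ e2; have [dl dl0 hd] := cc_unif cg e2.
have z0 : 0 < `|zvec R z| + 1 by rewrite ltr_wpDl.
have [N2 h2] := madic_small (divr_gt0 dl0 z0).
exists (maxn N1 N2) => n; rewrite geq_max => /andP[n1 n2] k.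
apply: (le_trans (normc_distD _ (g (M%:R ^- n *: zvec R (k - z))) _)).
rewrite [leRHS]splitr lerD//; first exact: h1.
apply: hd; rewrite zvecB scalerBr addrAC subrr add0r normrN normrZ.
rewrite ger0_norm ?invr_ge0 ?exprn_ge0//.
have := h2 _ n2; rewrite ltr_pdivlMr//; apply: le_lt_trans.
by rewrite ler_wpM2l ?invr_ge0 ?exprn_ge0// lerDl.
Qed.

(** Mesh points close enough to a point beyond radius L are beyond it as well, and there the
    approximants vanish. *)
Lemma ucvg_csupp F g L : CnC 0 g -> ucvg F g ->
  (forall n k, k \notin box (M ^ n * L) -> F n k = 0) -> csupp L g.
Proof.
move=> cg h hF x Lx; apply: normc_small => e e0.
have e2 : 0 < e / 2 by rewrite divr_gt0.
have [dl dl0 hd] := CnC0_unif `|x| cg e2.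
have [N1 h1] := h _ e2.
have dl1 : 0 < Num.min dl (`|x| - L%:R) by rewrite lt_min dl0 subr_gt0.
have [N2 h2] := madic_approx x dl1.
have [k] := h2 (maxn N1 N2) (leq_maxr _ _); rewrite lt_min => /andP[k1 k2].
have kb : k \notin box (M ^ maxn N1 N2 * L).
  rewrite (in_box_norm R) -ltNge natrM natrX -ltr_pdivlMl ?exprn_gt0//.
  have -> : (M%:R ^+ maxn N1 N2)^-1 * `|zvec R k| = `|M%:R ^- maxn N1 N2 *: zvec R k|.
    by rewrite normrZ ger0_norm// invr_ge0 exprn_ge0.
  by have := lerB_dist x (M%:R ^- maxn N1 N2 *: zvec R k); lra.
have := h1 _ (leq_maxl N1 N2) k; rewrite hF// sub0r normcN => h3.
have := hd _ _ (lexx _) k1 => h4.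
have := normc_distD (g x) (g (M%:R ^- maxn N1 N2 *: zvec R k)) 0; rewrite !subr0; lra.
Qed.

(** The sum is the Riemann sum of [g p] of mesh M^(-n) up to an error made of at most M^(nd)
    (2L+1)^d uniformly small terms. *)
Lemma ucvg_pair F g p L : cc g -> ucvg F g -> CnC 0 p ->
  (forall n k, k \notin box (M ^ n * L) -> F n k = 0) ->
  cvgC (fun n => (M%:R ^- n) ^+ d * \sum_(k \in [set: Zd]) F n k * p (M%:R ^- n *: zvec R k))
       (intRn (fun x => g x * p x)).
Proof.
move=> ccg h cp hF; have [cg _] := ccg; have gL := ucvg_csupp cg h hF.
have ccgp := cc_mul ccg cp.
have hM' n : (n <= M ^ n)%N by rewrite ltnW// ltn_expl.
apply: cvgC_near (cvgC_sub hM' (riem_cvg ccgp)) _ => e e0.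
have [P P0 hP] := CnC0_bounded L%:R cp.
pose K := (L.*2.+1 ^ d)%:R * (P + 1) : R.
have K0 : 0 < K by rewrite mulr_gt0 ?ltr0n ?expn_gt0// ltr_wpDl.
have [N hN] := h _ (divr_gt0 e0 K0); exists N => n /hN hn /=; rewrite subr0.
have Mn0 : (0 < M ^ n)%N by rewrite expn_gt0 ltnW.
rewrite /riem (@fsum_box _ _ _ (M ^ n * L)); last by move=> k /hF ->; rewrite mul0r.
rewrite (@fsum_box _ _ _ (M ^ n * L)); last first.
  by move=> k kb; rewrite gL ?mul0r//; exact: notin_box_scaled.
have -> : (M%:R ^- n) ^+ d = (M ^ n)%:R ^- d :> C by rewrite natrX exprVn.
rewrite -mulrBr -sumrB.
have Mr : (0 : R) < (M ^ n)%:R ^+ d by rewrite exprn_gt0// ltr0n.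
rewrite rc_natX ComplexField.Normc.normcM normc_rc (ger0_norm (ltW _)) ?invr_gt0//.
rewrite ler_pdivrMl//; apply: (le_trans (normc_sum _ _ _)).
apply: (@le_trans _ _ (\sum_(k <- box (d := d) (M ^ n * L)) e / K * P)).
  rewrite big_seq [leRHS]big_seq; apply: ler_sum => k kb.
  rewrite natrX -mulrBl ComplexField.Normc.normcM; apply: ler_pM; rewrite ?normc_ge0//.
  apply: hP; rewrite normrZ ger0_norm ?invr_ge0 ?exprn_ge0//.
  by rewrite ler_pdivrMl ?exprn_gt0// -natrX -natrM -in_box_norm.
rewrite big_const_seq count_predT iter_addr_0 size_box -[leLHS]mulr_natl.
have eKP : e / K * P * (L.*2.+1 ^ d)%:R <= e.
  rewrite -mulrA -[leRHS](divfK (lt0r_neq0 K0)) ler_wpM2l ?divr_ge0 ?(ltW e0) ?(ltW K0)//.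
  by rewrite /K mulrC ler_wpM2l// lerDl.
apply: (@le_trans _ _ ((M ^ n)%:R ^+ d * (L.*2.+1 ^ d)%:R * (e / K * P))).
  apply: ler_wpM2r; first by rewrite mulr_ge0// divr_ge0 ?(ltW e0) ?(ltW K0).
  rewrite -natrX -natrM ler_nat -expnMn.
  by case: (posnP d) => [->|d0]; rewrite ?expn0// leq_exp2r//; lia.
by rewrite -mulrA ler_pM2l// mulrC.
Qed.

End UniformLimits.

(** * Properties of the cascade limit *)

Section CascadeLimits.
Variables (R : realType) (d M r : nat).
Local Notation C := R[i].
Local Notation V := 'rV[R]_d.
Local Notation Zd := 'rV[int]_d.
Local Notation rc := (real_complex R).
Local Notation iC := (Complex 0 1 : C).
Hypothesis hM : (1 < M)%N.
Variables (a : Zd -> 'M[C]_r) (u : Zd -> 'cV[C]_r).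
Hypotheses (ha : fsupp a) (hu : fsupp u).
Variables (tau : R) (g : V -> 'cV[C]_r).
Hypothesis hg : forall i j, CnC 0 (fun x => g x i j).
Local Notation casc n := (fconv (iter n (subdiv M a) (@deltaI R d r)) u).
Hypothesis hlim : rescaled_cvg M tau (fun n => casc n) g.

Let Mgt0 : (0 : R) < M%:R. Proof. by rewrite ltr0n ltnW. Qed.
Let MC0 : (M%:R : C) != 0. Proof. by rewrite pnatr_eq0 -lt0n ltnW. Qed.

Lemma mderivM_word p q (nu : 'I_d -> nat) (F : V -> 'M[C]_(p, q)) x i j :
  mderivM nu F x i j = wderiv (word_of nu) (fun y => F y i j) x.
Proof. by rewrite mxE mderivC_word. Qed.

Lemma fconv_iter_supp q (v : Zd -> 'M[C]_(q, r)) : fsupp v ->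
  exists L, forall n k, k \notin box (M ^ n * L) -> fconv (iter n (subdiv M a) v) u k = 0.
Proof.
move=> /(iter_subdiv_supp hM ha)[L hL]; have [Lu hLu] := hu; exists (L + Lu)%N => n k kb.
apply: (fconv_supp (hL n) hLu); apply: contraNN kb; apply: box_sub.
by rewrite mulnDr leq_add2l leq_pmull// expn_gt0 ltnW.
Qed.

Lemma casc_ucvg i j : ucvg M (fun n k => wt M tau n * casc n k i j) (fun x => g x i j).
Proof. exact: (rescaled_cvgP hM tau _ _).1. Qed.

Lemma g_cc i j : cc (fun x => g x i j).
Proof.
split => //; have [L hL] := fconv_iter_supp (fsupp_deltaI R d r).
exists L; apply: (ucvg_csupp hM (hg i j) (casc_ucvg i j)) => n k kb.
by rewrite hL// mxE mulr0.
Qed.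

Lemma semiconv_box p q t (v : Zd -> 'M[C]_(p, q)) (f : V -> 'M[C]_(q, t)) L x :
  (forall z, z \notin box L -> v z = 0) ->
  semiconv v f x = \sum_(z <- box L) v z *m f (x - zvec R z).
Proof. by move=> h; rewrite /semiconv (@fsum_box _ _ _ L)// => z /h ->; rewrite mul0mx. Qed.

Lemma semiconv_entry p q t (v : Zd -> 'M[C]_(p, q)) (f : V -> 'M[C]_(q, t)) L x i j :
  (forall z, z \notin box L -> v z = 0) ->
  semiconv v f x i j = \sum_(z <- box L) \sum_l v z i l * f (x - zvec R z) l j.
Proof.
by move=> h; rewrite (semiconv_box _ _ h) summxE; apply: eq_bigr => z _; rewrite mxE.
Qed.

(** By linearity the iterates of any data are superpositions of M^n-shifted iterates of [deltaI],
    and these shifts turn into integer translations of [g]. *)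
Lemma semiconv_ucvg q (v : Zd -> 'M[C]_(q, r)) i j : fsupp v ->
  ucvg M (fun n k => wt M tau n * fconv (iter n (subdiv M a) v) u k i j)
    (fun x => semiconv v g x i j).
Proof.
move=> [L hL].
have -> : (fun x => semiconv v g x i j) =
    fun x => \sum_(z <- box L) \sum_l v z i l * g (x - zvec R z) l j.
  by apply/funext => x; rewrite (semiconv_entry _ _ _ _ hL).
apply: (@ucvg_ext _ _ _ (fun n k => \sum_(z <- box L) \sum_l v z i l *
   (wt M tau n * casc n (k - z *+ M ^ n) l j))).
  move=> n k; rewrite (fconv_iter_subdiv hM ha _ _ hL hu) summxE mulr_sumr.
  apply: eq_bigr => z _; rewrite mxE mulr_sumr.
  by apply: eq_bigr => l _; rewrite mulrCA.
apply: ucvg_sum => z; apply: ucvg_sum => l; apply: ucvgZ.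
exact: (ucvg_mshift hM z (casc_ucvg l j)).
Qed.

Lemma semiconv_cc q (v : Zd -> 'M[C]_(q, r)) i j : fsupp v ->
  cc (fun x => semiconv v g x i j).
Proof.
move=> [L hL].
have -> : (fun x => semiconv v g x i j) =
    fun x => \sum_(z <- box L) \sum_l v z i l * g (x - zvec R z) l j.
  by apply/funext => x; rewrite (semiconv_entry _ _ _ _ hL).
apply: cc_sum => z; apply: cc_sum => l; apply: cc_scale.
exact: (cc_shift (zvec R z) (g_cc l j)).
Qed.

Lemma intRn_semiconv q (v : Zd -> 'M[C]_(q, r)) p i j L : CnC 0 p ->
  (forall z, z \notin box L -> v z = 0) ->
  intRn (fun x => semiconv v g x i j * p x) =
  \sum_(z <- box L) \sum_l v z i l * intRn (fun x => g x l j * p (x + zvec R z)).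
Proof.
move=> cp hL.
have c1 z l : cc (fun x => g (x - zvec R z) l j * p x).
  apply: (cc_mul _ cp); exact: (cc_shift (zvec R z) (g_cc l j)).
transitivity (intRn (fun x => \sum_(z <- box L) \sum_l v z i l * (g (x - zvec R z) l j * p x))).
  congr intRn; apply/funext => x; rewrite (semiconv_entry _ _ _ _ hL) mulr_suml.
  by apply: eq_bigr => z _; rewrite mulr_suml; apply: eq_bigr => l _; rewrite mulrA.
rewrite intRn_sum; last by move=> z; apply: cc_sum => l; exact: cc_scale.
apply: eq_bigr => z _; rewrite intRn_sum; last by move=> l; exact: cc_scale.
apply: eq_bigr => l _; rewrite intRn_scale//; congr (_ * _).
have c2 : cc (fun x => g x l j * p (x + zvec R z)).
  by have := cc_shift (- zvec R z) (c1 z l); congr cc; apply/funext => x; rewrite opprK addrK.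
by rewrite -(intRn_shift (zvec R z) c2); congr intRn; apply/funext => x; rewrite subrK.
Qed.

Lemma fourier_semiconv q (v : Zd -> 'M[C]_(q, r)) xi : fsupp v ->
  symbol v xi *m fourier g xi = fourier (semiconv v g) xi.
Proof.
move=> hv; have [L hL] := hv; apply/matrixP => i j; rewrite fourierE /ft.
rewrite (intRn_semiconv _ _ _ hL); last exact: cont_cos_line.
rewrite mxE exchange_big; apply: eq_bigr => l _.
rewrite symbol_entry// /sy (@fsum_box _ _ _ L); last by move=> k /hL ->; rewrite mxE mulr0.
rewrite mulr_suml; apply: eq_bigr => z _; rewrite fourierE /ft mulrAC mulrC.
congr (_ * _); rewrite -intRn_scale; last exact/cc_ft/g_cc.
by congr intRn; apply/funext => x; rewrite dotpDl opprD expiD; ring.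
Qed.

(** Pairing the cascade with the exponential of frequency xi gives its symbol at M^(-n) xi, which
    factors into the product of the symbols of [a] and the symbol of [u]. *)
Lemma fourier_limit xi : cvg_mx
  (fun n => real_complex R (M%:R `^ (tau * n%:R)) *:
     ((\prod_(1 <= j < n.+1) symbol a (M%:R ^- j *: xi)) *m symbol u (M%:R ^- n *: xi)))
  (fourier g xi).
Proof.
move=> i j; apply/cvgC_cvg; rewrite fourierE.
have [L hL] := fconv_iter_supp (fsupp_deltaI R d r).
have hL' n k : k \notin box (M ^ n * L) -> wt M tau n * casc n k i j = 0.
  by move=> kb; rewrite hL// mxE mulr0.
apply: cvgC_ext (ucvg_pair hM (g_cc i j) (casc_ucvg i j) (cont_cos_line xi) hL') => n.
have fA := fsupp_iter_subdiv hM ha n (fsupp_deltaI R d r).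
have Mn0 : (M%:R ^+ d) ^+ n != 0 :> C by rewrite !expf_neq0.
have -> : \prod_(1 <= j < n.+1) symbol a (M%:R ^- j *: xi) =
    ((M%:R ^+ d) ^+ n)^-1 *: symbol (iter n (subdiv M a) (@deltaI R d r)) (M%:R ^- n *: xi).
  by rewrite (symbol_iter_subdiv hM ha) scalerA mulVf// scale1r.
rewrite -scalemxAl -symbol_fconv// mxE [in RHS]mxE symbol_entry; last exact: fsupp_fconv.
rewrite -/(wt M tau n) mulrA [X in _ = X * _]mulrC -mulrA -exprM mulnC exprM exprVn.
congr (_ * _); rewrite /sy mulr_fsumr.
apply: eq_fsbigr => k _; rewrite -mulrA; congr (_ * _); rewrite mulrC.
by congr (expi _ * _); rewrite dotpZl dotpZr.
Qed.

(** Level n + 1 of the cascade from [deltaI] is level n from [subdiv M a deltaI]. Read on the mesh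
    M^(-n), one sequence tends to both sides; the weights of the two levels differ by M^tau. *)
Lemma refinement_time x i j :
  g (M%:R^-1 *: x) i j =
  rc (M%:R `^ tau) * semiconv (subdiv M a (@deltaI R d r)) g x i j.
Proof.
pose v := subdiv M a (@deltaI R d r).
have fv : fsupp v by exact: (fsupp_iter_subdiv hM ha 1 (fsupp_deltaI R d r)).
have h1 := ucvgZ (rc (M%:R `^ tau)) (semiconv_ucvg i j fv).
have h2 : ucvg M (fun n k => rc (M%:R `^ tau) * (wt M tau n * fconv (iter n (subdiv M a) v) u k i j))
    (fun x => g (M%:R^-1 *: x) i j).
  move=> e /(casc_ucvg i j)[N hN]; exists N => n Nn k.
  have := hN n.+1 (leqW Nn) k; rewrite iterSr wtS// scalerA -invfM exprS mulrA.
  by [].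
have c1 : CnC 0 (fun x => g (M%:R^-1 *: x) i j) by exact: (@CnC0_comp _ _ (fun x => g x i j) _ (@cont_scale R d M%:R^-1) (hg i j)).
have c2 := CnC0_scale (rc (M%:R `^ tau)) (semiconv_cc i j fv).1.
exact: (congr1 (fun f => f x) (ucvg_unique hM c1 c2 h2 h1)).
Qed.

Lemma subdiv_deltaIE : subdiv M a (@deltaI R d r) = fun k => M%:R ^+ d *: a k.
Proof. by apply/funext => k; rewrite subdiv_deltaI. Qed.

Lemma fsupp_scale p q (c : C) (v : Zd -> 'M[C]_(p, q)) : fsupp v -> fsupp (fun k => c *: v k).
Proof. by move=> fv; apply: fsupp_bound fv _ => k ->; rewrite scaler0. Qed.

Lemma pairing_scale p q f (c : C) (v : Zd -> 'M[C]_(p, q)) : fsupp v ->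
  pairing f (fun k => c *: v k) = c *: pairing f v.
Proof.
move=> [L hL]; rewrite (pairing_box _ hL) (@pairing_box _ _ _ _ f _ L).
  by rewrite scaler_sumr; apply: eq_bigr => k _; rewrite !scalerA mulrC.
by move=> k /hL ->; rewrite scaler0.
Qed.

(** Fourier transform of [refinement_time]: the factor M^d of the change of variables cancels the
    one in the subdivision operator. *)
Lemma fourier_refinable xi : fourier g (M%:R *: xi) =
  rc (M%:R `^ tau) *: (symbol a xi *m fourier g xi).
Proof.
have Md : M%:R ^+ d != 0 :> C by rewrite expf_neq0.
have -> : symbol a xi *m fourier g xi =
    (M%:R ^+ d)^-1 *: (fourier (semiconv (subdiv M a (@deltaI R d r)) g) xi).
  rewrite -fourier_semiconv; last exact: (fsupp_iter_subdiv hM ha 1 (fsupp_deltaI R d r)).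
  have -> : symbol (subdiv M a (@deltaI R d r)) xi = M%:R ^+ d *: symbol a xi.
    by rewrite subdiv_deltaIE; exact: pairing_scale.
  by rewrite -scalemxAl scalerA mulVf ?scale1r.
apply/matrixP => i j; rewrite !mxE /=.
have cg := cc_ft (M%:R *: xi) (g_cc i j).
apply: (mulfI Md); rewrite -(intRn_dilate (ltnW hM) cg) mulrCA mulVKf//.
rewrite -intRn_scale; last first.
  apply: (cc_ft xi); apply: semiconv_cc.
  exact: (fsupp_iter_subdiv hM ha 1 (fsupp_deltaI R d r)).
congr intRn; apply/funext => x; rewrite mulrA -refinement_time.
congr (_ * expi _); congr (- _).
by rewrite dotpZl dotpZr mulKf// lt0r_neq0.
Qed.

(** Convolution with [w] combines bounded shifts of the index, which are invisible in the limit;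
    only the sum of the values of [w] remains. *)
Lemma conv_limit (w : Zd -> 'M[C]_1) : fsupp w -> forall i (j : 'I_1),
  ucvg M (fun n k => wt M tau n * fconv (iter n (subdiv M a) (@deltaI R d r)) (fconv u w) k i j)
   (fun x => symbol w 0 0 0 * g x i j).
Proof.
move=> fw i j; have [L hL] := fw.
have -> : (fun x => symbol w 0 0 0 * g x i j) =
   fun x => \sum_(z <- box L) w z 0 0 * g x i j.
  apply/funext => x; rewrite symbol_entry// /sy (@fsum_box _ _ _ L).
    rewrite mulr_suml; apply: eq_bigr => z _.
    by rewrite dotpC dotp0l oppr0 expi0 mul1r.
  by move=> z /hL ->; rewrite mxE mulr0.
apply: (@ucvg_ext _ _ _ (fun n k => \sum_(z <- box L) w z 0 0 * (wt M tau n * casc n (k - z) i j))).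
  move=> n k; rewrite fconvA//; last exact: (fsupp_iter_subdiv hM ha n (fsupp_deltaI R d r)).
  rewrite (fconv_boxr _ _ hL) summxE mulr_sumr; apply: eq_bigr => z _.
  by rewrite mxE big_ord1 (ord1 j) mulrCA [w z 0 0 * _]mulrC.
apply: ucvg_sum => z; apply: ucvgZ.
exact: (ucvg_shift hM z (g_cc i j) (casc_ucvg i j)).
Qed.

Section Matching.
Variables (m : nat) (ups : Zd -> 'rV[C]_r).
Hypothesis hups : matching_filter M a ups m.+1.

Let fups : fsupp ups. Proof. by case: hups => /l0P. Qed.

Lemma sy_scale c (v : Zd -> C) : sy (fun k => c * v k) = fun xi => c * sy v xi :> C.
Proof.
by apply/funext => xi; rewrite /sy mulr_fsumr; apply: eq_fsbigr => k _; rewrite mulrCA.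
Qed.

Lemma fsupp_entry p q (v : Zd -> 'M[C]_(p, q)) i j : fsupp v -> fsupp (fun k => v k i j).
Proof. by move=> [L h]; exists L => k /h ->; rewrite mxE. Qed.

Lemma fmomM_entry p q s (v : Zd -> 'M[C]_(p, q)) i j : fsupp v ->
  fmomM s v i j = fmom s (fun k => v k i j).
Proof. exact: pairing_entry. Qed.

Lemma iC_neq0 n : (- iC) ^+ n != 0.
Proof.
rewrite expf_neq0// oppr_eq0; apply/eqP => -[] /eqP; rewrite oner_eq0//.
Qed.

(** At omega = 0 the left side of the matching condition is M^(-d) times the symbol of
    [subdiv M a ups]; derivatives of symbols at 0 are moments up to a nonzero factor. *)
Lemma matching_meq : meq m (subdiv M a ups) (fun k => M%:R ^+ d *: ups k).
Proof.
move=> s sm; have Md : M%:R ^+ d != 0 :> C by rewrite expf_neq0.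
have fS := fsupp_iter_subdiv hM ha 1 fups.
have [_ _ /(_ 0)] := hups.
have h0 : Omega M (0 : V).
  split; first by exists 0; rewrite zvec0 scaler0.
  by move=> j; rewrite mxE lexx ltr01.
move=> /(_ h0); pose nu j := count_mem j s => /(_ nu).
have E : mabs nu = size s by rewrite -size_word_of -(perm_size (perm_word_of s)).
rewrite E ltnS => /(_ sm) /matrixP h; rewrite eqxx in h.
rewrite /fmomM; apply/matrixP => i j; have := h i j; rewrite !mderivM_word.
have -> : (fun y => (symbol ups (M%:R *: y) *m symbol a (y + (2 * pi) *: 0)) i j) =
    sy (fun k => (M%:R ^+ d)^-1 * subdiv M a ups k i j).
  rewrite sy_scale; apply/funext => xi; rewrite scaler0 addr0 -symbol_entry//.
  by rewrite (symbol_subdiv M ha xi fups) [in RHS]mxE mulKf.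
have -> : (fun y => ((true%:R : C) *: symbol ups y) i j) = sy (fun k => ups k i j).
  by apply/funext => xi; rewrite scale1r -symbol_entry.
rewrite !wderiv_sy0; [|exact: fsupp_entry|]; last first.
  by apply: fsupp_bound (fsupp_entry i j fS) _ => k ->; rewrite mulr0.
move=> /(mulfI (iC_neq0 _)) h'; rewrite pairing_scale//.
rewrite [RHS]mxE pairing_entry// pairing_entry//.
have P k : wmono s (zvec R k) = wmono (word_of nu) (zvec R k) :> C.
  exact/wmono_perm/perm_word_of.
rewrite (eq_fsbigr (fun k => M%:R ^+ d * (wmono (word_of nu) (zvec R k) * ((M%:R ^+ d)^-1 * subdiv M a ups k i j)))).
  rewrite -mulr_fsumr; transitivity (M%:R ^+ d * fmom (word_of nu) (fun k => ups k i j)).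
    by congr (_ * _); exact: h'.
  congr (_ * _).
  by apply: eq_fsbigr => k _; rewrite P.
by move=> k _; rewrite P mulrCA mulVKf.
Qed.

Lemma iter_matching_meq n :
  meq m (iter n (subdiv M a) ups) (fun k => (M%:R ^+ d) ^+ n *: ups k).
Proof.
elim: n => [|n ih] s sm.
  by congr (fmomM s _); apply/funext => k; rewrite expr0 scale1r.
have f1 := fsupp_iter_subdiv hM ha n fups.
have f2 := fsupp_scale ((M%:R ^+ d) ^+ n) fups.
rewrite (meq_subdiv M ha f1 f2 ih sm).
have -> : subdiv M a (fun k => (M%:R ^+ d) ^+ n *: ups k) =
    fun k => (M%:R ^+ d) ^+ n *: subdiv M a ups k.
  apply/funext => k; have [L hL] := fups.
  rewrite !(@subdiv_box _ _ _ _ _ _ _ L)//; last by move=> z /hL ->; rewrite scaler0.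
  rewrite scalerA mulrC -scalerA; congr (_ *: _); rewrite scaler_sumr.
  by apply: eq_bigr => z _; rewrite scalemxAl.
rewrite /fmomM pairing_scale; last exact: (fsupp_iter_subdiv hM ha 1 fups).
rewrite -/(fmomM s _) matching_meq// /fmomM !pairing_scale// scalerA -exprSr//.
Qed.

(** A monomial of degree |s| on the mesh M^(-n) carries the factor M^(-n|s|), and the moments for
    the n-th iterate of [ups] are M^(dn) times those for [ups]; what remains is M^((tau-|s|)n). *)
Lemma moment_limit s i j : (size s <= m)%N ->
  cvgC (fun n => rc (M%:R `^ ((tau - (size s)%:R) * n%:R)) * fmom s (fun k => fconv ups u k i j))
    (mom s (fun x => semiconv ups g x i j)).
Proof.
move=> sm; have [L hL] := fconv_iter_supp fups.
have hL' n k : k \notin box (M ^ n * L) ->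
   wt M tau n * fconv (iter n (subdiv M a) ups) u k i j = 0.
  by move=> kb; rewrite hL// mxE mulr0.
have h := ucvg_pair hM (semiconv_cc i j fups) (semiconv_ucvg i j fups) (CnC0_wmono R s) hL'.
rewrite (_ : intRn _ = mom s (fun x => semiconv ups g x i j)) in h; last first.
  by congr intRn; apply/funext => x; rewrite mulrC.
apply: (cvgC_ext _ h) => n.
have fn := fsupp_fconv (fsupp_iter_subdiv hM ha n fups) hu.
have Mn0 : (M%:R ^+ n) ^+ d != 0 :> C by rewrite !expf_neq0.
have E : fmom s (fun k => fconv (iter n (subdiv M a) ups) u k i j) =
    (M%:R ^+ n) ^+ d * fmom s (fun k => fconv ups u k i j).
  rewrite -fmomM_entry//.
  rewrite (meq_fconv (fsupp_iter_subdiv hM ha n fups) (fsupp_scale _ fups) hu (iter_matching_meq n) sm).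
  have -> : fconv (fun k => (M%:R ^+ d) ^+ n *: ups k) u =
      fun k => (M%:R ^+ d) ^+ n *: fconv ups u k.
    apply/funext => k; have [Lu hLu] := hu; rewrite !(fconv_boxr _ _ hLu) scaler_sumr.
    by apply: eq_bigr => z _; rewrite scalemxAl.
  rewrite /fmomM pairing_scale; last exact: fsupp_fconv.
  rewrite mxE -/(fmomM s _) fmomM_entry; last exact: fsupp_fconv.
  by congr (_ * _); exact: exprAC.
transitivity ((M%:R ^- n) ^+ d * (wt M tau n * rc (M%:R ^- n) ^+ size s *
    fmom s (fun k => fconv (iter n (subdiv M a) ups) u k i j))).
  congr (_ * _); rewrite /fmom mulr_fsumr; apply: eq_fsbigr => k _.
  by rewrite wmonoZ; ring.
rewrite E exprVn; rewrite mulrCA mulKf//; congr (_ * _).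
rewrite /wt -rcX -rcM; congr rc; rewrite exprVn -exprM mulnC exprM.
rewrite mulrBl powRD; last by rewrite (lt0r_neq0 Mgt0) implybT.
by rewrite powRN -natrM powR_mulrn ?ler0n// exprM.
Qed.

(** The convergent sequence of [moment_limit] is q^n X with q = M^(tau-|s|): q > 1 forces X = 0, and
    for q = 1 the sequence is constant. *)
Lemma moment_relation s i j : (size s <= m)%N -> (size s)%:R <= tau ->
  fmom s (fun k => fconv ups u k i j) =
  if (size s)%:R < tau then 0 else mom s (fun x => semiconv ups g x i j).
Proof.
move=> sm st; have h := moment_limit i j sm.
case: ltP => [lt|ge].
  set X := fmom _ _ in h *; set q := M%:R `^ (tau - (size s)%:R).
  have q1 : 1 < q.
    have -> : 1 = (1 : R) `^ (tau - (size s)%:R) by rewrite powR1.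
    by apply: gt0_ltr_powR; rewrite ?subr_gt0 ?nnegrE ?ler0n ?ltr1n.
  have {}h : cvgC (fun n => rc q ^+ n * X) (mom s (fun x => semiconv ups g x i j)).
    apply: (cvgC_ext _ h) => n; congr (_ * _); rewrite -rcX; congr rc.
    by rewrite powRrM powR_mulrn// powR_ge0.
  (* A limit of q^n X is invariant under multiplication by q > 1, hence zero; afterwards |X| <= |q^n
     X| gives X = 0. *)
  have l0 : mom s (fun x => semiconv ups g x i j) = 0.
    have h1 := cvgC_sub leqnSn h; have h2 := cvgCMl (rc q) h.
    have := cvgC_unique h1 (cvgC_ext _ h2) => E.
    have {}E : mom s (fun x => semiconv ups g x i j) = rc q * mom s (fun x => semiconv ups g x i j).
      by apply: E => n /=; rewrite exprS mulrA.
    apply/eqP; have : (rc q - 1) * mom s (fun x => semiconv ups g x i j) == 0.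
      by rewrite mulrBl mul1r -E subrr.
    rewrite mulf_eq0 => /orP[|//]; rewrite subr_eq0 => /eqP q1'.
    by have := rc_inj (q1' : rc q = rc 1) => q1''; rewrite q1'' ltxx in q1.
  apply: normc_small => e /h[N /(_ N (leqnn N))]; rewrite l0 subr0; apply: le_trans.
  rewrite ComplexField.Normc.normcM normcX normc_rc ger0_norm; last exact: ltW (lt_trans ltr01 q1).
  by rewrite ler_peMl ?normc_ge0// exprn_ege1// ltW.
have E : tau = (size s)%:R by apply/le_anti; rewrite ge st.
have h1 := cvgC_cst (fmom s (fun k => fconv ups u k i j)).
apply: (cvgC_unique h1); apply: (cvgC_ext _ h) => n.
by rewrite E subrr mul0r powRr0 mul1r.
Qed.

End Matching.
End CascadeLimits.

(** * Approximate identities *)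

Section ApproximateIdentity.
Variables (R : realType) (d : nat).
Local Notation C := R[i].
Local Notation V := 'rV[R]_d.
Local Notation rc := (real_complex R).

Lemma geo_small (A q e : R) : 0 <= q < 1 -> 0 < e -> 0 <= A ->
  exists N, forall n, (N <= n)%N -> A * q ^+ n <= e.
Proof.
move=> /andP[q0 q1] e0 A0; have A1 : 0 < A + 1 by rewrite ltr_wpDl.
have /cvgrPdist_le/(_ _ (divr_gt0 e0 A1))[N _ hN] : q ^+ n @[n --> \oo] --> (0 : R).
  by apply: cvg_expr; rewrite ger0_norm.
exists N => n /hN /=; rewrite sub0r normrN ger0_norm ?exprn_ge0// ler_pdivlMr// mulrC.
by apply: le_trans; rewrite ler_wpM2r ?exprn_ge0// lerDl.
Qed.

Section Kernel.
Variables (B : nat) (q : V -> R).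
Hypotheses (B0 : (0 < B)%N) (cq : continuous q) (q0 : q 0 = 1).
Local Notation D := (3 * B%:R : R).
Hypothesis q01 : forall y, `|y| <= D -> 0 <= q y <= 1.
Hypothesis q_peak : forall rho : R, 0 < rho -> exists2 ep : R, 0 < ep &
  forall y, rho <= `|y| -> `|y| <= D -> q y <= 1 - ep.

Let Bpos : (0 : R) < B%:R. Proof. by rewrite ltr0n. Qed.

(** Equal to 1 up to radius 2B and to 0 from 3B on. Differences of points of the cube of radius B
    lie within 2B, so the cutoff leaves the convolutions unchanged there and gives the kernel
    compact support. *)
Definition cutoff (y : V) : R := Num.min 1 (Num.max 0 (3 - `|y| / B%:R)).

Lemma cutoff01 y : 0 <= cutoff y <= 1.
Proof. by rewrite /cutoff le_min ler01 le_max lexx /= ge_min lexx. Qed.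

Lemma cutoff1 y : `|y| <= 2 * B%:R -> cutoff y = 1.
Proof.
move=> yB; have : `|y| / B%:R <= 2 by rewrite ler_pdivrMr.
by move=> h; apply/min_idPl; rewrite le_max; apply/orP; right; lra.
Qed.

Lemma cutoff0 y : D <= `|y| -> cutoff y = 0.
Proof.
move=> yB; have h : 3 <= `|y| / B%:R by rewrite ler_pdivlMr.
rewrite /cutoff (max_idPl _); last by lra.
by apply/min_idPr; rewrite ler01.
Qed.

Lemma cutoff_cont : continuous cutoff.
Proof.
have cn : continuous (fun y : V => 3 - `|y| / B%:R).
  apply: contB; first exact: cont_cst.
  by apply: contM; [exact: norm_continuous|exact: cont_cst].
have cm : continuous (fun y : V => Num.max 0 (3 - `|y| / B%:R)).
  by move=> y; have h := @continuous_max R _ (fun=> 0) (fun y => 3 - `|y| / B%:R) y (@cont_cst R d 0 y) (cn y); exact: h.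
by move=> y; have h := @continuous_min R _ (fun=> 1) _ y (@cont_cst R d 1 y) (cm y); exact: h.
Qed.

Definition peak n (y : V) : R := cutoff y * q y ^+ n.

Lemma peak_ge0 n y : 0 <= peak n y.
Proof.
have [yD|yD] := leP `|y| D; last by rewrite /peak cutoff0 ?mul0r// ltW.
have /andP[? _] := cutoff01 y; have /andP[? _] := q01 yD.
by rewrite mulr_ge0 ?exprn_ge0.
Qed.

Lemma cont_pow (u : V -> R) n : continuous u -> continuous (fun x => u x ^+ n).
Proof.
move=> cu; elim: n => [|n ih].
  by rewrite (_ : (fun x => _) = fun=> 1); [exact: cont_cst|apply/funext => x; rewrite expr0].
rewrite (_ : (fun x => _) = fun x => u x * u x ^+ n); first exact: contM.
by apply/funext => x; rewrite exprS.
Qed.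

Lemma peak_cc n : cc (fun y => rc (peak n y)).
Proof.
split.
  by apply: CnC0_rc; apply: contM; [exact: cutoff_cont|exact: cont_pow].
by exists (3 * B)%N => y; rewrite natrM => yB; rewrite /peak cutoff0 ?mul0r// ltW.
Qed.

Lemma cutoff_cc : cc (fun y => rc (cutoff y)).
Proof.
have := peak_cc 0; congr cc; apply/funext => y; rewrite /peak expr0 mulr1//.
Qed.

Definition mass n : R := rint (peak n).

Lemma peak_near0 (ep : R) : 0 < ep -> exists2 N0, (0 < N0)%N & forall y : V, `|y| <= N0%:R^-1 ->
  1 - ep <= q y /\ cutoff y = 1.
Proof.
move=> ep0; have [dl dl0 h] := unif_cont_compact 1 cq ep0.
exists (Num.bound dl^-1).+1 => // y yN.
have yd : `|y| < dl by apply: le_lt_trans yN _; exact: invn_lt.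
split.
  have := h 0 y; rewrite normr0 sub0r normrN q0 => /(_ ler01 yd).
  by rewrite ler_norml => /andP[]; lra.
apply: cutoff1; apply: (le_trans yN); apply: (@le_trans _ _ 1).
  by rewrite invf_le1// ler1n.
by rewrite mulr_ege1// ler1n.
Qed.

(** On a fixed small cube around 0 the kernel is at least (1 - ep)^n, so the mass cannot decay
    faster than that, whatever [ep]. *)
Lemma mass_lower (ep : R) : 0 < ep <= 1 -> exists2 c : R, 0 < c &
  forall n, c * (1 - ep) ^+ n <= mass n.
Proof.
move=> /andP[ep0 ep1]; have [N0 N00 h] := peak_near0 ep0.
exists (N0%:R ^- d); first by rewrite invr_gt0 exprn_gt0// ltr0n.
move=> n; apply: rint_lower => //; first exact: peak_cc.
- exact: peak_ge0.
- by rewrite exprn_ge0// subr_ge0.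
move=> y /h[h1 h2]; rewrite /peak h2 mul1r lerXn2r ?nnegrE ?subr_ge0//.
by apply: le_trans h1; rewrite subr_ge0.
Qed.

Lemma mass_gt0 n : 0 < mass n.
Proof.
have [c c0 h] := @mass_lower 2^-1 ltac:(by rewrite invr_gt0 ltr0n /= invf_le1// ler1n).
apply: lt_le_trans (h n); rewrite mulr_gt0// exprn_gt0//; lra.
Qed.

(** The integrand contains [q] and not [peak]: if the powers of [q] are combinations of given
    functions, so is the mollified function. *)
Definition mollify n (f : V -> C) (x : V) : C :=
  (rc (mass n))^-1 * intRn (fun y => f y * rc (q (x - y) ^+ n)).

(** Laplace's method: away from 0 the kernel is at most (1 - ep)^n while the mass is at least c (1 -
    ep / 2)^n, so the far part contributes at most a multiple of [th ^+ n]. *)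
Lemma mollify_cvg f : CnC 0 f -> csupp B f -> forall e : R, 0 < e ->
  exists N, forall n, (N <= n)%N -> forall x, `|x| <= B%:R ->
  normc (mollify n f x - f x) <= e.
Proof.
move=> cf fB e e0; have fcc : cc f by split => //; exists B.
have e2 : 0 < e / 2 by rewrite divr_gt0.
have [rho rho0 hrho] := cc_unif fcc e2; have [K K0 hK] := cc_bounded fcc.
have [ep' ep'0 hep'] := q_peak rho0; pose ep := Num.min ep' 1.
have ep0 : 0 < ep by rewrite lt_min ep'0 ltr01.
have ep1 : ep <= 1 by rewrite ge_min lexx orbT.
have hep y : rho <= `|y| -> `|y| <= D -> q y <= 1 - ep.
  move=> h1 h2; apply: (le_trans (hep' y h1 h2)); rewrite lerD2l lerN2 ge_min lexx//.
have ep2 : 0 < ep / 2 <= 1 by apply/andP; split; lra.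
have [c c0 hc] := mass_lower ep2; pose X := rint cutoff.
have X0 : 0 <= X.
  have := mass_gt0 0; rewrite /mass (_ : peak 0 = cutoff) ?/X => [/ltW//|].
  by apply/funext => y; rewrite /peak expr0 mulr1.
pose th := (1 - ep) / (1 - ep / 2).
have th0 : 0 < 1 - ep / 2 by lra.
have th01 : 0 <= th < 1.
  apply/andP; split; first by apply: divr_ge0; lra.
  by rewrite /th ltr_pdivrMr// mul1r; lra.
have A0 : 0 <= 2 * K * X / c by rewrite divr_ge0 ?mulr_ge0// ltW.
have [N hN] := geo_small th01 e2 A0.
exists N => n /hN hn x xB; have m0 := mass_gt0 n.
have pk1 := peak_cc n; have pkx : cc (fun y => rc (peak n (x - y))) by exact: (cc_refl x pk1).
(* Here |x| <= B, and |y| <= B on the support of [f], so the cutoff at [x - y] equals 1. *)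
have E1 : intRn (fun y => f y * rc (q (x - y) ^+ n)) = intRn (fun y => f y * rc (peak n (x - y))).
  congr intRn; apply/funext => y; have [yB|yB] := leP `|y| B%:R; last by rewrite fB ?mul0r.
  rewrite /peak cutoff1 ?mul1r// (le_trans (ler_normB _ _))//; lra.
have E2 : f x * rc (mass n) = intRn (fun y => f x * rc (peak n (x - y))).
  by rewrite intRn_scale// (intRn_refl x pk1) intRn_rc.
have mC : rc (mass n) != 0 by rewrite -normc_eq0 normc_rc normr_eq0 lt0r_neq0.
have -> : mollify n f x - f x =
    (rc (mass n))^-1 * intRn (fun y => (f y - f x) * rc (peak n (x - y))).
  rewrite /mollify E1 -[X in _ - X](mulKf mC) -mulrBr; congr (_ * _).
  rewrite [rc (mass n) * _]mulrC E2 -intRn_sub; last exact: cc_scale.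
    by congr intRn; apply/funext => y; rewrite mulrBl.
  exact: (cc_mul fcc pkx.1).
rewrite ComplexField.Normc.normcM ComplexField.Normc.normcV normc_rc gtr0_norm//.
rewrite ler_pdivrMl//.
have chx : cc (fun y => rc (cutoff (x - y))) by exact: (cc_refl x cutoff_cc).
(* The first term bounds the points near x, where [f] varies by at most e / 2; the second bounds the
   others, where it varies by at most 2 K. *)
pose ub y := e / 2 * peak n (x - y) + 2 * K * (1 - ep) ^+ n * cutoff (x - y).
have c1 : cc (fun y => rc (e / 2 * peak n (x - y))).
  by have := cc_scale (rc (e / 2)) pkx; congr cc; apply/funext => y; rewrite -rcM.
have c2 : cc (fun y => rc (2 * K * (1 - ep) ^+ n * cutoff (x - y))).
  by have := cc_scale (rc (2 * K * (1 - ep) ^+ n)) chx; congr cc; apply/funext => y; rewrite -rcM.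
apply: (@le_trans _ _ (rint ub)).
  apply: intRn_le.
  - have := cc_sub (cc_mul fcc pkx.1) (cc_scale (f x) pkx); congr cc.
    by apply/funext => y; rewrite mulrBl.
  - by have := cc_add c1 c2; congr cc; apply/funext => y; rewrite -rcD.
  move=> y; rewrite ComplexField.Normc.normcM normc_rc (ger0_norm (peak_ge0 _ _)).
  have ch0 := cutoff01 (x - y); have pk0 := peak_ge0 n (x - y).
  have [xy|xy] := ltP `|x - y| rho.
    rewrite /ub; apply: (@le_trans _ _ (e / 2 * peak n (x - y))).
      by rewrite ler_wpM2r// normcB_sym hrho.
    by rewrite lerDl !mulr_ge0 ?exprn_ge0 ?subr_ge0//; case/andP: ch0.
  rewrite /ub; apply: (@le_trans _ _ (2 * K * (1 - ep) ^+ n * cutoff (x - y))); last first.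
    by rewrite lerDr mulr_ge0// ltW.
  have [yD|yD] := leP `|x - y| D; last first.
    by rewrite /peak cutoff0 ?mul0r ?mulr0// ltW.
  rewrite /peak -!mulrA [(1 - ep) ^+ n * _]mulrC !mulrA; apply: ler_pM.
  - by rewrite mulr_ge0 ?normc_ge0//; case/andP: ch0.
  - by rewrite exprn_ge0//; case/andP: (q01 yD).
  - apply: ler_wpM2r; first by case/andP: ch0.
    apply: (le_trans (le_normcD _ _)); rewrite normcN mulr2n mulrDl mul1r lerD//.
  - by rewrite lerXn2r ?nnegrE ?subr_ge0 ?hep//; case/andP: (q01 yD).
rewrite rint_add// !rint_scale//.
have -> : rint (fun y => peak n (x - y)) = mass n.
  by apply: rc_inj; rewrite -!intRn_rc (intRn_refl x pk1).
have -> : rint (fun y => cutoff (x - y)) = X.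
  by apply: rc_inj; rewrite -!intRn_rc (intRn_refl x cutoff_cc).
have h2 : 2 * K * (1 - ep) ^+ n * X <= mass n * (e / 2).
  apply: (@le_trans _ _ (c * (1 - ep / 2) ^+ n * (e / 2))); last first.
    by rewrite ler_wpM2r ?(ltW e2).
  have -> : 2 * K * (1 - ep) ^+ n * X = c * (1 - ep / 2) ^+ n * (2 * K * X / c * th ^+ n).
    have -> : (1 - ep) ^+ n = (1 - ep / 2) ^+ n * th ^+ n.
      by rewrite -exprMn /th mulrC divfK// lt0r_neq0.
    by field; rewrite lt0r_neq0.
  by rewrite ler_wpM2l// mulr_ge0 ?exprn_ge0 ?(ltW c0) ?(ltW th0).
by rewrite [e / 2 * _]mulrC -mulrA -[leRHS]mulr1; move: h2; set z := mass n; lra.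
Qed.

End Kernel.

Section Spans.
Variables (K : Type) (ch : K -> V -> C) (mulK : K -> K -> K) (oneK : K).
Hypothesis chM : forall k l x, ch (mulK k l) x = ch k x * ch l x.
Hypothesis ch1 : forall x, ch oneK x = 1.

(** Finite combinations of functions that multiply according to [mulK]: monomials under
    concatenation of words, exponentials under addition of frequencies. *)
Definition spanned (p : V -> C) := exists L : seq (C * K), forall x,
  p x = \sum_(t <- L) t.1 * ch t.2 x.

Lemma spanned_cst c : spanned (fun=> c).
Proof. by exists [:: (c, oneK)] => x; rewrite big_seq1 /= ch1 mulr1. Qed.

Lemma spannedD p p' : spanned p -> spanned p' -> spanned (fun x => p x + p' x).
Proof. by move=> [L h] [L' h']; exists (L ++ L') => x; rewrite big_cat h h'. Qed.

Lemma spannedM p p' : spanned p -> spanned p' -> spanned (fun x => p x * p' x).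
Proof.
move=> [L h] [L' h'].
exists [seq (t.1 * t'.1, mulK t.2 t'.2) | t <- L, t' <- L'] => x.
rewrite big_allpairs_dep h h' mulr_suml; apply: eq_bigr => t _.
rewrite mulr_sumr; apply: eq_bigr => t' _ /=; rewrite chM; ring.
Qed.

Lemma spanned_sum I (s : seq I) (p : I -> V -> C) : (forall i, spanned (p i)) ->
  spanned (fun x => \sum_(i <- s) p i x).
Proof.
move=> h; elim: s => [|i s ih].
  by have := spanned_cst 0; congr spanned; apply/funext => x; rewrite big_nil.
by have := spannedD (h i) ih; congr spanned; apply/funext => x; rewrite big_cons.
Qed.

Lemma spanned_prod I (s : seq I) (p : I -> V -> C) : (forall i, spanned (p i)) ->
  spanned (fun x => \prod_(i <- s) p i x).
Proof.
move=> h; elim: s => [|i s ih].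
  by have := spanned_cst 1; congr spanned; apply/funext => x; rewrite big_nil.
by have := spannedM (h i) ih; congr spanned; apply/funext => x; rewrite big_cons.
Qed.

Lemma spannedX p n : spanned p -> spanned (fun x => p x ^+ n).
Proof.
move=> h; elim: n => [|n ih].
  by have := spanned_cst 1; congr spanned; apply/funext => x; rewrite expr0.
by have := spannedM h ih; congr spanned; apply/funext => x; rewrite exprS.
Qed.

End Spans.

Section Moments.
Hypothesis d0 : (0 < d)%N.

Let dpos : (0 : R) < d%:R. Proof. by rewrite ltr0n. Qed.

(** Weierstrass approximation with a Landau kernel: the powers of q(y) = 1 - (y_1^2 + ... + y_d^2) /
    K are polynomials, so the mollified [h] is at each point a combination of moments of [h]. *)
Lemma mom_eq0 (h : V -> C) : cc h -> (forall s, mom s h = 0) -> h = fun=> 0.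
Proof.
move=> ch hm; have [cf [B' hB']] := ch; pose B := B'.+1.
have hB : csupp B h by exact: csupp_le hB'.
(* This [K] bounds the sum of squares on the cube of radius 3B, which keeps q within [0, 1]
   there. *)
pose K := d%:R * (3 * B%:R) ^+ 2 : R.
have K0 : 0 < K by rewrite mulr_gt0// exprn_gt0// mulr_gt0// ltr0n.
pose q (y : V) : R := 1 - (\sum_i y 0 i ^+ 2) / K.
have ge_sq (y : V) i : y 0 i ^+ 2 <= \sum_i y 0 i ^+ 2.
  by rewrite (bigD1 i)//= lerDl sumr_ge0// => j _; exact: sqr_ge0.
have cq : continuous q.
  apply: contB; first exact: cont_cst.
  apply: contM; last exact: cont_cst.
  have cs (s : seq 'I_d) : continuous (fun y : V => \sum_(i <- s) y 0 i ^+ 2).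
    elim: s => [|i s ih].
      by rewrite (_ : (fun y : V => _) = fun=> 0); [exact: cont_cst|apply/funext => y; rewrite big_nil].
    rewrite (_ : (fun y : V => _) = fun y : V => y 0 i ^+ 2 + \sum_(j <- s) y 0 j ^+ 2).
      by apply: contD => //; apply: cont_pow; exact: cont_coord.
    by apply/funext => y; rewrite big_cons.
  exact: cs.
have q00 : q 0 = 1.
  by rewrite /q big1 ?mul0r ?subr0// => i _; rewrite mxE expr0n.
have q01 y : `|y| <= 3 * B%:R -> 0 <= q y <= 1.
  move=> yD; apply/andP; split.
    rewrite subr_ge0 ler_pdivrMr// mul1r.
    apply: (@le_trans _ _ (\sum_(i < d) (3 * B%:R : R) ^+ 2)).
      apply: ler_sum => i _; rewrite -real_normK ?num_real// lerXn2r ?nnegrE ?mulr_ge0//.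
      exact: (le_trans (rV_norm_coord _ _)).
    by rewrite sumr_const card_ord -[leLHS]mulr_natl lexx.
  by rewrite gerBl divr_ge0 ?(ltW K0)// sumr_ge0// => i _; exact: sqr_ge0.
have q_peak (rho : R) : 0 < rho -> exists2 ep : R, 0 < ep &
    forall y, rho <= `|y| -> `|y| <= 3 * B%:R -> q y <= 1 - ep.
  move=> rho0; exists ((rho / 2) ^+ 2 / K); first by rewrite divr_gt0// exprn_gt0// divr_gt0.
  move=> y yr _; rewrite lerD2l lerN2 ler_pM2r ?invr_gt0//.
  have [i yi] : exists i, rho / 2 < `|y 0 i|.
    by apply: rV_norm_ltP; [rewrite divr_ge0 ?(ltW rho0)|lra].
  apply: le_trans (ge_sq y i); rewrite -[leRHS]real_normK ?num_real//.
  by rewrite lerXn2r ?nnegrE ?divr_ge0 ?(ltW rho0)// ltW.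
apply/funext => x; have [xB|/hB //] := leP `|x| B%:R.
apply: normc_small => e e0.
have [N /(_ N (leqnn N) x xB)] := mollify_cvg (ltn0Sn _ : (0 < B)%N) cq q00 q01 q_peak cf hB e0.
suff -> : mollify B q N h x = 0 by rewrite sub0r normcN.
rewrite /mollify.
pose sp := @spanned (seq 'I_d) (@wmono R d).
have wM k l (y : V) : wmono (k ++ l) y = wmono k y * wmono l y by rewrite /wmono big_cat.
have w1 (y : V) : wmono [::] y = 1 by exact: wmono_nil.
have [L hL] : sp (fun y => rc (q (x - y) ^+ N)).
  have E : (fun y => rc (q (x - y) ^+ N)) = fun y =>
    (1 + \sum_i rc (- K^-1) * (rc (x 0 i) + (-1) * wmono [:: i] y) ^+ 2) ^+ N.
    apply/funext => y; rewrite rcX /q rcB; congr ((_ + _) ^+ _).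
    rewrite -rcN mulrC -mulNr big_distrr /= rc_sum; apply: eq_bigr => i _.
    by rewrite rcM rcX mxE mxE rcB wmono_cons w1 mulr1 mulN1r.
  rewrite E; apply: (spannedX wM w1); apply: spannedD; first exact: (spanned_cst w1).
  apply: (spanned_sum w1) => i; apply: (spannedM wM); first exact: (spanned_cst w1).
  apply: (spannedX wM w1); apply: spannedD; first exact: (spanned_cst w1).
  apply: (spannedM wM); first exact: (spanned_cst w1).
  by exists [:: (1, [:: i])] => y; rewrite big_seq1 mul1r.
rewrite (_ : intRn _ = \sum_(t <- L) t.1 * mom t.2 h).
  by rewrite big1 ?mulr0// => t _; rewrite hm mulr0.
transitivity (intRn (fun y => \sum_(t <- L) t.1 * (wmono t.2 y * h y))).
  congr intRn; apply/funext => y; rewrite hL mulr_sumr; apply: eq_bigr => t _; ring.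
rewrite intRn_sum; last by move=> t; apply/cc_scale/cc_wmono.
by apply: eq_bigr => t _; rewrite intRn_scale//; exact: cc_wmono.
Qed.

End Moments.
End ApproximateIdentity.

(** * Compactly supported distributions *)

Section Distributions.
Variables (R : realType) (d : nat).
Local Notation C := R[i].
Local Notation V := 'rV[R]_d.
Local Notation rc := (real_complex R).
Local Notation iC := (Complex 0 1 : C).
Implicit Types (F G : V -> C) (s : seq 'I_d).

Lemma wderiv_lin s (c : C) F G : CnC (size s) F -> CnC (size s) G ->
  wderiv s (fun x => c * F x + G x) = fun x => c * wderiv s F x + wderiv s G x.
Proof.
rewrite -[size s]addn0 => cF cG.
pose Rl k (h : V -> C) (FG : (V -> C) * (V -> C)) :=
  [/\ CnC k FG.1, CnC k FG.2 & h = fun x => c * FG.1 x + FG.2 x].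
pose op j (FG : (V -> C) * (V -> C)) := (pderivC j FG.1, pderivC j FG.2).
have E : foldr op (F, G) s = (wderiv s F, wderiv s G) by elim: s {cF cG} => //= j s ->.
have [] := @wderiv_rel R d _ Rl op _ s 0 (fun x => c * F x + G x) (F, G) (And3 cF cG erefl).
  move=> k h [F' G'] [/CnC_S[_ hF] /CnC_S[_ hG] ->] j.
  have [dF cF'] := hF j; have [dG cG'] := hG j; split => //=.
  exact: (DC_pderivC (DC_add (DC_scale c dF) dG)).
by rewrite E.
Qed.

Lemma wderiv_cst0 s (c : C) : wderiv s (fun _ : V => c) = fun=> if s is [::] then c else 0.
Proof.
elim: s => //= j s ->; case: s => [|k s]; exact: (DC_pderivC (@DC_cst R d j _)).
Qed.

Lemma wderiv_sub s F G : CnC (size s) F -> CnC (size s) G ->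
  wderiv s (fun x => F x - G x) = fun x => wderiv s F x - wderiv s G x.
Proof.
move=> cF cG; have := wderiv_lin (-1) cG cF; congr (wderiv s _ = _).
  by apply/funext => x; rewrite mulN1r addrC.
by apply/funext => x; rewrite mulN1r addrC.
Qed.

Lemma wderiv_scale s (c : C) F : CnC (size s) F ->
  wderiv s (fun x => c * F x) = fun x => c * wderiv s F x.
Proof.
move=> cF; have := wderiv_lin c cF (@CnC_cst R d _ 0); rewrite wderiv_cst0.
congr (wderiv s _ = _); apply/funext => x; first by rewrite addr0.
by case: s {cF} => [|j s]; rewrite addr0.
Qed.

Definition echar (xi x : V) : C := expi (- dotp x xi).

Let echar_family s xi (c : C) :
  wderiv s (fun x => c * echar xi x) =
    (fun x => (- iC) ^+ size s * wmono s xi * c * echar xi x) /\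
  smooth (fun x => c * echar xi x).
Proof.
pose fam (c : C) x := c * echar xi x; pose op j (c : C) := - iC * rc (xi 0 j) * c.
have hf h : True -> forall j, True /\ DC j (fam h) (fam (op j h)).
  move=> _ j; split => //; have := DC_scale h (DC_expi j xi).
  by congr DC; apply/funext => x; rewrite /fam /op /echar; ring.
split; last first.
  apply: (@smooth_family R d C (fun=> True) op fam hf) => // h _.
  by apply: CnC0_mul; [exact: CnC0_cst|exact: cont_cos_line].
rewrite (wderiv_family hf)//; apply/funext => x; congr (_ * _).
elim: s => [|j s ih] /=; first by rewrite wmono_nil !mul1r.
by rewrite ih wmono_cons exprS /op; ring.
Qed.

Lemma smooth_echar xi : smooth (echar xi).
Proof. by have [_] := echar_family [::] xi 1; congr smooth; apply/funext => x; rewrite mul1r. Qed.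

Lemma wderiv_echar s xi :
  wderiv s (echar xi) = fun x => (- iC) ^+ size s * wmono s xi * echar xi x.
Proof.
have [h _] := echar_family s xi 1; move: h; congr (wderiv s _ = _).
  by apply/funext => x; rewrite mul1r.
by apply/funext => x; rewrite mulr1.
Qed.

Lemma normc_iC_pow n : normc ((- iC) ^+ n) = 1.
Proof.
have E : normc (- iC) = 1.
  by rewrite normcN /ComplexField.Normc.normc expr0n /= add0r expr1n sqrtr1.
by rewrite normcX E expr1n.
Qed.

Lemma normc_wmono s (xi : V) : normc (wmono s xi) <= `|xi| ^+ size s.
Proof.
elim: s => [|j s ih]; first by rewrite wmono_nil -[1]/(rc 1) normc_rc normr1.
rewrite wmono_cons ComplexField.Normc.normcM normc_rc exprS.
by apply: ler_pM; rewrite ?normc_ge0 ?rV_norm_coord.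
Qed.

Lemma ft_pderivC (B : nat) j F xi : CnC 1 F -> csupp B F ->
  ft (pderivC j F) xi = iC * rc (xi 0 j) * ft F xi.
Proof.
move=> cF hB; rewrite /ft (intRn_by_parts j cF hB)//; last exact: smooth_echar.
have cc1 : cc F by split; [exact: CnC_0 cF|exists B].
rewrite (DC_pderivC (DC_expi j xi)) -intRn_scale; last exact: cc_ft.
rewrite -[- intRn _]mulN1r -intRn_scale; last first.
  have := cc_scale (- iC * rc (xi 0 j)) (cc_ft xi cc1).
  by congr cc; apply/funext => x; ring.
by congr intRn; apply/funext => x; ring.
Qed.

Lemma ft_wderiv (B : nat) s F xi : CnC (size s) F -> csupp B F ->
  ft (wderiv s F) xi = iC ^+ size s * wmono s xi * ft F xi.
Proof.
elim: s => [|j s ih] cF hB; first by rewrite wmono_nil !mul1r.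
have cF' : CnC (size s) F by exact: CnC_mono cF.
have c1 : CnC 1 (wderiv s F) by apply: wderiv_CnC; rewrite addn1.
rewrite /= (ft_pderivC _ _ c1 (wderiv_csupp cF' hB)) ih// wmono_cons exprS; ring.
Qed.

Section ExponentialMollifier.
Variables (L : seq (C * V)) (B : nat).

(** Convolution of [F] with the trigonometric polynomial whose coefficients and frequencies are
    listed in [L]. *)
Let mol F x := \sum_(t <- L) t.1 * ft F (- t.2) * echar t.2 x.

Let mol_smooth F : smooth (mol F).
Proof. by move=> k; apply: CnC_sum => t; apply: CnC_scale; exact: smooth_echar. Qed.

(** The factor -i xi_j that the exponential gains by differentiation is the one that [ft F] at -xi
    gains when [F] is differentiated, by integration by parts. *)
Let wderiv_mol s F : CnC (size s) F -> csupp B F -> wderiv s (mol F) = mol (wderiv s F).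
Proof.
move=> cF hB; apply: (@wderiv_comm _ _ (fun k F => CnC k F /\ csupp B F)) => // k G [cG Gs] j.
have /CnC_S[_ /(_ j)[_ cG']] := cG; have c1 := CnC_mono (ltn0Sn k) cG.
split; first by split => //; exact: (@wderiv_csupp _ _ [:: j] _ _ c1 Gs).
apply: DC_pderivC; apply: DC_sum => t.
have := DC_scale (t.1 * ft G (- t.2)) (DC_expi j t.2); congr DC; apply/funext => x.
by rewrite (ft_pderivC _ _ c1 Gs) mxE rcN /echar; ring.
Qed.

Lemma mollifier_family :
  let mol F x := \sum_(t <- L) t.1 * ft F (- t.2) * echar t.2 x in
  (forall F, smooth (mol F)) /\
  (forall s F, CnC (size s) F -> csupp B F -> wderiv s (mol F) = mol (wderiv s F)).
Proof. by split; [exact: mol_smooth|exact: wderiv_mol]. Qed.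

End ExponentialMollifier.

(** A nonempty word begins with one of finitely many letters, so the thresholds given by induction
    on the length can be maximised. *)
Lemma eventually_words (P : seq 'I_d -> nat -> Prop) :
  (forall s, exists n0, forall n, (n0 <= n)%N -> P s n) ->
  forall N, exists n0, forall n, (n0 <= n)%N -> forall s, (size s <= N)%N -> P s n.
Proof.
move=> hP N; elim: N P hP => [|N ih] P hP.
  by have [n0 h] := hP [::]; exists n0 => n /h hn [].
have /choice[f hf] j : exists n0, forall n, (n0 <= n)%N -> forall s, (size s <= N)%N -> P (j :: s) n.
  by apply: ih => s; exact: hP.
have [n0 h0] := hP [::]; exists (maxn n0 (\max_j f j)) => n; rewrite geq_max => /andP[/h0 n1 n2].
case=> [//|j s] sN; apply: (hf j) => //; apply: leq_trans n2.
exact: (leq_bigmax j).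
Qed.

Section TrigonometricKernel.
Variables (B : nat).
Hypothesis B0 : (0 < B)%N.
Let D : R := 3 * B%:R.
Let D0 : 0 < D. Proof. by rewrite mulr_gt0// ltr0n. Qed.

(** Division by D = 3B keeps the angles within [-1, 1] on the cube of radius D, where each factor
    attains the value 1 only at angle 0. *)
Definition trigker (y : V) : R := \prod_j ((1 + cos (y 0 j / D)) / 2).

Let fac01 (t : R) : 0 <= (1 + cos t) / 2 <= 1.
Proof. by have := cos_max t; rewrite ler_norml => /andP[]; lra. Qed.

Lemma trigker01 y : 0 <= trigker y <= 1.
Proof.
apply/andP; split; first by apply: prodr_ge0 => j _; case/andP: (fac01 (y 0 j / D)).
by apply: prodr_ile1 => j _; exact: fac01.
Qed.

Lemma trigker0 : trigker 0 = 1.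
Proof. by rewrite /trigker big1// => j _; rewrite mxE mul0r cos0; lra. Qed.

Lemma trigker_peak (rho : R) : 0 < rho -> exists2 ep : R, 0 < ep &
  forall y, rho <= `|y| -> `|y| <= D -> trigker y <= 1 - ep.
Proof.
move=> rho0; have p2 := @pi_ge2 R.
(* If D < rho, no point satisfies both bounds and any positive [ep] will do. *)
have [rD|rD] := ltP D rho.
  by exists 1 => // y h1 h2; have := lt_le_trans rD (le_trans h1 h2); rewrite ltxx.
pose t := rho / 2 / D; have t0 : 0 < t by rewrite !divr_gt0.
have t1 : t < 1 by rewrite ltr_pdivrMr//; lra.
have ct : cos t < 1.
  by rewrite -cos0 ltr_cos// in_itv /= ?lexx//; apply/andP; split; lra.
exists ((1 - cos t) / 2); first lra.
move=> y yr yD; have [i yi] : exists i, rho / 2 < `|y 0 i| by apply: rV_norm_ltP; lra.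
rewrite /trigker (bigD1 i)//=.
have h1 : \prod_(j < d | j != i) ((1 + cos (y 0 j / D)) / 2) <= 1.
  by apply: prodr_ile1 => j _; exact: fac01.
have h0 : 0 <= \prod_(j < d | j != i) ((1 + cos (y 0 j / D)) / 2).
  by apply: prodr_ge0 => j _; case/andP: (fac01 (y 0 j / D)).
have ci : cos (y 0 i / D) <= cos t.
  have -> : cos (y 0 i / D) = cos (`|y 0 i| / D).
    by have [_|_] := ger0P (y 0 i); rewrite // mulNr cosN.
  have yiD : `|y 0 i| <= D := le_trans (rV_norm_coord _ _) yD.
  have w1 : `|y 0 i| / D <= 1 by rewrite ler_pdivrMr// mul1r.
  have tw : t < `|y 0 i| / D by rewrite /t ltr_pM2r ?invr_gt0.
  by apply: ltW; rewrite ltr_cos// in_itv /=; apply/andP; split; lra.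
have /andP[f0 f1] := fac01 (y 0 i / D); nra.
Qed.

Lemma trigker_cont : continuous trigker.
Proof.
have cs (s : seq 'I_d) : continuous (fun y : V => \prod_(j <- s) ((1 + cos (y 0 j / D)) / 2)).
  elim: s => [|i s ih].
    by rewrite (_ : (fun y : V => _) = fun=> 1); [exact: cont_cst|apply/funext => y; rewrite big_nil].
  rewrite (_ : (fun y : V => _) = fun y : V => (1 + cos (y 0 i / D)) / 2 *
      \prod_(j <- s) ((1 + cos (y 0 j / D)) / 2)).
    apply: contM => //; apply: contM; last exact: cont_cst.
    apply: contD; first exact: cont_cst.
    move=> y; apply: (@continuous_comp _ _ _ (fun y : V => y 0 i / D) cos); last exact: continuous_cos.
    by apply: contM; [exact: cont_coord|exact: cont_cst].
  by apply/funext => y; rewrite big_cons.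
exact: cs.
Qed.

(** The cosine is the half-sum of two exponentials of opposite frequencies, and exponentials are
    closed under products. *)
Lemma trigker_spanned n : spanned echar (fun y => rc (trigker y ^+ n)).
Proof.
have eM k l x : echar (k + l) x = echar k x * echar l x.
  by rewrite /echar dotpC dotpDl opprD expiD ![dotp _ x]dotpC.
have e1 x : echar 0 x = 1 by rewrite /echar dotpC dotp0l oppr0 expi0.
have E : (fun y => rc (trigker y ^+ n)) = fun y =>
  (\prod_j (2^-1 * (1 + 2^-1 * (echar (- D^-1 *: delta_mx 0 j) y + echar (D^-1 *: delta_mx 0 j) y)))) ^+ n.
  apply/funext => y; rewrite rcX /trigker; congr (_ ^+ _).
  have rcprod (s : seq 'I_d) (f : 'I_d -> R) : rc (\prod_(j <- s) f j) = \prod_(j <- s) rc (f j).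
    by elim: s => [|j s ih]; rewrite ?big_nil// !big_cons rcM ih.
  rewrite rcprod; apply: eq_bigr => j _.
  have -> : (1 + cos (y 0 j / D)) / 2 = 2^-1 * (1 + cos (y 0 j / D)) by rewrite mulrC.
  rewrite rcM rcV rc_natr rcD; congr (_ * (_ + _)).
  rewrite /echar !dotpZr ![dotp y _]dotpC dotp_ej mulNr opprK ![D^-1 * _]mulrC.
  have -> : 2^-1 = rc 2^-1 by rewrite rcV rc_natr.
  apply: complexP; rewrite ?cReM ?cImM !cReD !cImD /= cosN sinN; lra.
rewrite E; apply: (spannedX eM e1); apply: (spanned_prod eM e1) => j.
apply: (spannedM eM); first exact: (spanned_cst e1).
apply: spannedD; first exact: (spanned_cst e1).
apply: (spannedM eM); first exact: (spanned_cst e1).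
by apply: spannedD; [exists [:: (1, - D^-1 *: delta_mx 0 j)]|exists [:: (1, D^-1 *: delta_mx 0 j)]];
  move=> y; rewrite big_seq1 mul1r.
Qed.

End TrigonometricKernel.

Lemma smooth0 : smooth (fun _ : V => 0 : C).
Proof. by move=> k; exact: CnC_cst. Qed.

Section Linear.
Variable T : (V -> C) -> C.
Hypothesis hT : forall (c : C) F G, smooth F -> smooth G ->
  T (fun x => c * F x + G x) = c * T F + T G.

Lemma dist0 : T (fun=> 0) = 0.
Proof.
have := @hT 1 (fun=> 0) (fun=> 0) smooth0 smooth0; rewrite mul1r.
rewrite [X in T X = _](_ : _ = fun=> 0); last by apply/funext => x; ring.
by move=> h; apply: (addrI (T (fun=> 0))); rewrite addr0 [RHS]h mul1r.
Qed.

Lemma dist_sub F G : smooth F -> smooth G -> T (fun x => F x - G x) = T F - T G.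
Proof.
move=> sF sG; have := hT (-1) sG sF; rewrite mulN1r [_ + T F]addrC => <-.
by congr T; apply/funext => x; rewrite mulN1r addrC.
Qed.

Lemma dist_echar_sum (L : seq (C * V)) :
  T (fun x => \sum_(t <- L) t.1 * echar t.2 x) = \sum_(t <- L) t.1 * T (echar t.2).
Proof.
elim: L => [|t L ih].
  by rewrite big_nil -[RHS]dist0; congr T; apply/funext => x; rewrite big_nil.
rewrite big_cons -ih -hT; first by congr T; apply/funext => x; rewrite big_cons.
  exact: smooth_echar.
by move=> k; apply: CnC_sum => t'; apply: CnC_scale; exact: smooth_echar.
Qed.

End Linear.

(** Mollification approximates [psi] together with all derivatives up to the order of [T], uniformly
    on the ball that controls [T]; the approximants are combinations of characters, on which [T]
    vanishes. *)
Lemma distribution_density (T : (V -> C) -> C) : compact_distribution T ->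
  (forall xi, T (echar xi) = 0) ->
  forall psi, smooth psi -> compact_support psi -> T psi = 0.
Proof.
move=> [hT [B' [N [K hK]]]] T0 psi sp /compact_supportP[B1 hB1].
(* The cube contains both the support of [psi] and the ball on which the seminorms of [T] are
   taken. *)
pose B := (B1 + Num.bound `|B'|).+1.
have hB : csupp B psi by apply: csupp_le hB1; rewrite /B; lia.
have B'B x : x <= B' -> x <= B%:R.
  move=> h; apply: (le_trans h); apply: (le_trans (ler_norm _)).
  apply: ltW; apply: (lt_le_trans (archi_boundP (normr_ge0 _))).
  by rewrite ler_nat /B ltnW// ltnS leq_addl.
have B0 : (0 < B)%N by [].
(* The list depends on [n] but not on [F]: the same one has to serve [psi] and its derivatives. *)
have key n : exists L : seq (C * V), forall F x, cc F ->
   mollify B (trigker B) n F x = \sum_(t <- L) t.1 * ft F (- t.2) * echar t.2 x.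
  have [L hL] := trigker_spanned B n.
  exists [seq ((rc (mass B (trigker B) n))^-1 * t.1, t.2) | t <- L] => F x cF.
  rewrite big_map /mollify.
  transitivity ((rc (mass B (trigker B) n))^-1 *
     intRn (fun y => \sum_(t <- L) t.1 * echar t.2 x * (F y * expi (- dotp y (- t.2))))).
    congr (_ * intRn _); apply/funext => y; rewrite hL mulr_sumr; apply: eq_bigr => t _.
    rewrite /echar dotpDl dotpNl opprD expiD [dotp y (- _)]dotpC dotpNl ![dotp t.2 _]dotpC opprK; ring.
  rewrite intRn_sum; last by move=> t; apply/cc_scale/cc_ft.
  rewrite mulr_sumr; apply: eq_bigr => t _ /=.
  rewrite intRn_scale; last exact: cc_ft.
  by rewrite /ft; ring.
have {key} /choice[L hL] := key.
pose mol n F x := \sum_(t <- L n) t.1 * ft F (- t.2) * echar t.2 x.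
have smol n F : smooth (mol n F) by have [h _] := mollifier_family (L n) B; exact: h.
have dmol n s F : CnC (size s) F -> csupp B F -> wderiv s (mol n F) = mol n (wderiv s F).
  by have [_ h] := mollifier_family (L n) B; exact: h.
have Tmol n F : T (mol n F) = 0.
  have := dist_echar_sum hT [seq (t.1 * ft F (- t.2), t.2) | t <- L n].
  rewrite big_map big1 => [<-|t _]; last by rewrite T0 mulr0.
  by congr T; apply/funext => x; rewrite big_map.
have cs s : CnC 0 (wderiv s psi) by apply: wderiv_CnC; exact: sp.
have ss s : csupp B (wderiv s psi) by exact: wderiv_csupp.
apply: normc_small => e e0.
have K1 : 0 < `|K| + 1 by rewrite ltr_wpDl.
have ev s : exists n0, forall n, (n0 <= n)%N -> forall x, `|x| <= B%:R ->
    normc (mol n (wderiv s psi) x - wderiv s psi x) <= e / (`|K| + 1).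
  have [n0 h] := mollify_cvg B0 (@trigker_cont B) (trigker0 B) (fun y _ => trigker01 B y)
    (@trigker_peak B B0) (cs s) (ss s) (divr_gt0 e0 K1).
  exists n0 => n /h hn x /hn; rewrite hL//; split => //; by exists B.
have [n0 /(_ n0 (leqnn _)) h] := eventually_words ev N.
have E : T psi = T (fun x => psi x - mol n0 psi x) by rewrite dist_sub// Tmol subr0.
rewrite E; apply: (le_trans (hK _ (e / (`|K| + 1)) _ _)).
- by move=> k; apply: CnC_sub; [exact: sp|exact: smol].
- move=> al x alN xB; rewrite mderivC_word wderiv_sub; [|exact: sp|exact: smol].
  rewrite (dmol _ _ _ (sp _) hB).
  rewrite normcB_sym; apply: h; last exact: B'B.
  by rewrite size_word_of.
rewrite mulrCA ler_piMr ?(ltW e0)// ler_pdivrMr// mul1r.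
by have := ler_norm K; lra.
Qed.

(* On the ball |x| <= B every derivative of e^{-i x.xi} - 1 is at most a constant times |xi|. *)
Lemma distribution_lipschitz0 (T : (V -> C) -> C) : compact_distribution T ->
  exists2 K : R, 0 <= K & forall xi, `|xi| <= 1 -> normc (T (echar xi) - T (echar 0)) <= K * `|xi|.
Proof.
move=> [hT [B [N [K hK]]]]; pose A := 2 * (d%:R * `|B|) + 1.
have A0 : 0 <= A by rewrite addr_ge0// mulr_ge0// mulr_ge0.
exists (`|K| * A); first by rewrite mulr_ge0.
move=> xi xi1; rewrite -dist_sub//; try exact: smooth_echar.
have sd : smooth (fun x => echar xi x - echar 0 x).
  by move=> k; apply: CnC_sub; exact: smooth_echar.
apply: (le_trans (hK _ (A * `|xi|) sd _)); last first.
  by rewrite -mulrA; apply: ler_wpM2r; [rewrite mulr_ge0|exact: ler_norm].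
move=> al x _ xB; rewrite mderivC_word.
set s := word_of al; rewrite wderiv_sub; try exact: smooth_echar.
rewrite !wderiv_echar; case: s => [|j s].
  rewrite !wmono_nil !mul1r /echar [dotp x 0]dotpC dotp0l oppr0 expi0.
  apply: (le_trans (expi_sub1 _)); rewrite normrN.
  apply: (@le_trans _ _ (2 * (d%:R * (`|B| * `|xi|)))).
    rewrite ler_wpM2l//; apply: (le_trans (dotp_bound _ _)); rewrite ler_wpM2l// ler_wpM2r//.
    exact: le_trans xB (ler_norm _).
  by rewrite /A; have := normr_ge0 xi; lra.
rewrite [wmono _ 0]wmono_cons mxE -[rc 0]/(0 : C) mul0r mulr0 mul0r subr0.
rewrite !ComplexField.Normc.normcM normc_iC_pow normc_expi mul1r mulr1.
apply: (le_trans (normc_wmono _ _)); apply: (@le_trans _ _ `|xi|).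
  by rewrite /= exprS ler_piMr// exprn_ile1.
by rewrite ler_peMl// /A lerDr mulr_ge0// mulr_ge0.
Qed.

End Distributions.

(** * Test functions *)

Section BumpFunctions.
Variables (R : realType) (d : nat).
Local Notation C := R[i].
Local Notation V := 'rV[R]_d.
Local Notation rc := (real_complex R).

(** Differentiating exp(-1/t) produces powers of 1/t; the index [n] makes the family stable under
    differentiation. *)
Definition flat n (t : R) : R := if 0 < t then t ^- n * expR (- t^-1) else 0.

Lemma flat_ge0 n t : 0 <= flat n t.
Proof.
by rewrite /flat; case: ifP => // t0; rewrite mulr_ge0 ?expR_ge0// invr_ge0 exprn_ge0// ltW.
Qed.

Lemma flat_gt0 t : 0 < t -> 0 < flat 0 t.
Proof. by move=> t0; rewrite /flat t0 expr0 invr1 mul1r expR_gt0. Qed.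

(** From exp(s) >= s^(n+2) / (n+2)! at s = 1/t. The square of t is what gives a zero derivative at
    0. *)
Lemma flat_bound n (t : R) : flat n t <= (n.+2)`!%:R * t ^+ 2.
Proof.
rewrite /flat; case: ifP => [t0|_]; last by rewrite mulr_ge0// sqr_ge0.
have s0 : 0 <= t^-1 by rewrite invr_ge0 ltW.
have := expR_ge1Dxn n.+1 s0; rewrite expRN ler_pdivrMr ?expR_gt0// => h.
have h1 : t ^- n.+2 <= expR t^-1 * (n.+2)`!%:R.
  by rewrite -exprVn -ler_pdivrMr ?ltr0n ?fact_gt0//; apply: le_trans h; rewrite lerDr.
have -> : t ^- n = t ^- n.+2 * t ^+ 2.
  by rewrite -addn2 exprD invfM -mulrA mulVf ?mulr1// expf_neq0// lt0r_neq0.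
by rewrite mulrAC ler_wpM2r ?sqr_ge0// mulrC.
Qed.

(** For t <= 0 by the quadratic bound, for t > 0 by the chain rule applied to s^n exp(-s) at s =
    1/t. *)
Lemma is_derive_flat n (t : R) :
  is_derive t 1 (flat n) (flat n.+2 t - n%:R * flat n.+1 t).
Proof.
have [t0|t0] := leP t 0.
  apply: (@is_derive_of_bound R R^o _ _ _ _ (n.+2)`!%:R) => h.
  have E k : flat k t = 0 by rewrite /flat ltNge t0.
  rewrite !E mulr0 !subr0 mulr0 subr0 ger0_norm ?flat_ge0// [h *: _]mulr1.
  have [h0|h0] := leP (t + h) 0.
    by rewrite /flat ltNge h0 /= mulr_ge0// sqr_ge0.
  apply: (le_trans (flat_bound _ _)); rewrite ler_wpM2l// lerXn2r ?nnegrE//; lra.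
pose G (s : R) := s ^+ n * expR (- s).
have dG (s : R) : is_derive s 1 G (n%:R * s ^+ n.-1 * expR (- s) - s ^+ n * expR (- s)).
  have dE : is_derive s 1 (fun x : R => expR (- x)) (expR (- s) * - 1).
    by apply: (@is_derive1_comp _ expR -%R s _ _ _ _).
  have -> : G = id ^+ n * (fun x : R => expR (- x)).
    by rewrite /G mulrfctE exprfctE.
  have := is_deriveM (@is_deriveX R R^o id n s 1 1 (is_derive_id _ _)) dE.
  move=> h; apply: (is_derive_eq h); rewrite /GRing.scale /= exprfctE; ring.
have dV : is_derive t 1 (fun x : R => x^-1) (- t ^- 2).
  have h := @is_deriveV R id t 1 1 (lt0r_neq0 t0) (is_derive_id _ _).
  by apply: (is_derive_eq h); rewrite [_ *: _]mulr1.
have := @is_derive1_comp R G (fun x : R => x^-1) t _ _ (dG _) dV.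
move=> h; apply: (@near_eq_is_derive _ R^o R^o (G \o (fun x : R => x^-1))) => //.
  have : \forall x \near t, 0 < x by exact: lt_nbhsr.
  by apply: filterS => x x0; rewrite /flat x0 /G /= exprVn.
apply: is_derive_eq h _; rewrite /flat t0 -!exprVn; set s := t^-1.
by case: n G {dG} => [|n] G /=; rewrite !exprS; ring.
Qed.

Lemma smooth_flat n (L : V -> R) : continuous L ->
  (forall j, exists l : R, forall x h, L (h *: delta_mx 0 j + x) = h * l + L x) ->
  smooth (fun x => rc (flat n (L x))).
Proof.
move=> cL hL k; have cf n' : continuous (flat n').
  move=> y; have [h _] := is_derive_flat n' y.
  by apply/differentiable_continuous; rewrite -derivable1_diffP.
elim: k n => [|k ih] n.
  apply: CnC0_rc => x; apply: (@continuous_comp _ _ _ L (flat n)); [exact: cL|exact: cf].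
apply: CnC_DC; first exact: (CnC_0 (ih n)).
move=> j; have [l hl] := hL j.
exists (fun x => rc l * (rc (flat n.+2 (L x)) - rc n%:R * rc (flat n.+1 (L x)))).
  have h : isD j (fun x => flat n (L x)) (fun x => l * (flat n.+2 (L x) - n%:R * flat n.+1 (L x))).
    by move=> x; exact: (is_derive_comp_affine (is_derive_flat n) (hl x)).
  have := DC_rc h; congr DC; apply/funext => x; by rewrite rcM rcB rcM.
by apply: CnC_scale; apply: CnC_sub; last apply: CnC_scale; exact: ih.
Qed.

Variable rho : R.
Hypothesis rho0 : 0 < rho.

Definition cube_bump (x : V) : R := \prod_j (flat 0 (x 0 j + rho) * flat 0 (rho - x 0 j)).

Lemma smooth_bump : smooth (fun x => rc (cube_bump x)).
Proof.
have h (s : seq 'I_d) : smooth (fun x => rc (\prod_(j <- s) (flat 0 (x 0 j + rho) * flat 0 (rho - x 0 j)))).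
  elim: s => [|j s ih] k.
    by have := @CnC_cst R d k 1; congr CnC; apply/funext => x; rewrite big_nil.
  have h1 : CnC k (fun x : V => rc (flat 0 (x 0 j + rho))).
    apply: (smooth_flat 0 (L := fun x => x 0 j + rho)).
      by apply: contD; [exact: cont_coord|exact: cont_cst].
    by move=> i; exists ((j == i)%:R) => x t; rewrite !mxE addrA.
  have h2 : CnC k (fun x : V => rc (flat 0 (rho - x 0 j))).
    apply: (smooth_flat 0 (L := fun x => rho - x 0 j)).
      by apply: contB; [exact: cont_cst|exact: cont_coord].
    by move=> i; exists (- (j == i)%:R) => x t; rewrite !mxE eqxx /=; ring.
  have := CnC_mul (CnC_mul h1 h2) (ih k); congr CnC.
  by apply/funext => x; rewrite big_cons !rcM.
exact: h.
Qed.

Lemma bump_ge0 x : 0 <= cube_bump x.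
Proof. by apply: prodr_ge0 => j _; rewrite mulr_ge0 ?flat_ge0. Qed.

Lemma bump_out x : rho < `|x| -> cube_bump x = 0.
Proof.
move=> xr; have [j] := rV_norm_ltP (ltW rho0) xr.
rewrite /cube_bump (bigD1 j)//= lter_normr => /orP[h|h].
  by rewrite [flat 0 (rho - _)]/flat ifF ?mulr0 ?mul0r//; apply/negbTE; rewrite -leNgt; lra.
by rewrite [flat 0 (_ + rho)]/flat ifF ?mul0r//; apply/negbTE; rewrite -leNgt; lra.
Qed.

Lemma bump_cc : cc (fun x => rc (cube_bump x)).
Proof.
split; first exact: (smooth_bump 0).
apply/compact_supportP; exists rho => x /bump_out -> //.
Qed.

(** On the cube of radius rho / 2 the arguments of all factors are at least rho / 2, and [flat 0] is
    increasing on positive numbers. *)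
Lemma rint_bump_gt0 : 0 < rint cube_bump.
Proof.
have [N N0 hN] : exists2 N, (0 < N)%N & N%:R^-1 <= rho / 2.
  exists (Num.bound (rho / 2)^-1).+1 => //; by apply/ltW/invn_lt; rewrite ?ltnSn ?divr_gt0.
have f0 : 0 < flat 0 (rho / 2) by apply: flat_gt0; rewrite divr_gt0.
have fmono (s t : R) : 0 < s -> s <= t -> flat 0 s <= flat 0 t.
  move=> s0 st; have t0 := lt_le_trans s0 st.
  by rewrite /flat s0 t0 !expr0 !invr1 !mul1r ler_expR lerN2 lef_pV2.
apply: (@lt_le_trans _ _ (N%:R ^- d * \prod_(j < d) (flat 0 (rho / 2) * flat 0 (rho / 2)))).
  rewrite mulr_gt0 ?invr_gt0 ?exprn_gt0 ?ltr0n//.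
  by apply: prodr_gt0 => j _; rewrite mulr_gt0.
apply: rint_lower => //; [exact: bump_cc|exact: bump_ge0| |].
  by apply: prodr_ge0 => j _; rewrite mulr_ge0 ?flat_ge0.
move=> x xN; apply: ler_prod => j _; rewrite mulr_ge0 ?flat_ge0//=.
have := le_trans (rV_norm_coord x j) (le_trans xN hN); rewrite ler_norml => /andP[h1 h2].
have rp := rho0; by apply: ler_pM; rewrite ?flat_ge0// fmono//; lra.
Qed.

End BumpFunctions.

(** Near a point x0 with h(x0) nonzero, a narrow bump sees [h] as almost constant, so its integral
    against [h] cannot vanish. *)
Lemma du_Bois_Reymond (R : realType) (d : nat) (h : 'rV[R]_d -> R[i]) : CnC 0 h ->
  (forall psi, smooth psi -> compact_support psi -> intRn (fun x => h x * psi x) = 0) ->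
  h = fun=> 0.
Proof.
move=> ch h0; apply/funext => x0; apply/eqP; apply: contraT => hx0.
have n0 : 0 < normc (h x0) by rewrite lt_def normc_ge0 normc_eq0 hx0.
have [rho rho0 hr] := CnC0_unif `|x0| ch (divr_gt0 n0 (ltr0n R 2)).
pose b := @cube_bump R d (rho / 2); have r2 : 0 < rho / 2 by rewrite divr_gt0.
have cb := bump_cc d r2; have cbs := cc_shift x0 cb.
pose k x := real_complex R (b (x - x0)).
have hk : intRn (fun x => h x * k x) = 0.
  apply: h0; first by move=> n; apply: (CnC_shift (F := fun x => real_complex R (b x))); exact: smooth_bump.
  by apply/compact_supportP; have [_] := cbs.
have chk : cc (fun x => h x * k x).
  by have := cc_mul cbs ch; congr cc; apply/funext => x; rewrite mulrC.
have ckx : cc (fun x => h x0 * k x) by exact: cc_scale.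
have E : normc (intRn (fun x => (h x - h x0) * k x)) = normc (h x0) * rint b.
  rewrite (_ : (fun x => (h x - h x0) * k x) = fun x => h x * k x - h x0 * k x); last first.
    by apply/funext => x; rewrite mulrBl.
  rewrite intRn_sub// hk sub0r normcN intRn_scale// (intRn_shift x0 cb) intRn_rc.
  by rewrite ComplexField.Normc.normcM normc_rc gtr0_norm ?rint_bump_gt0.
have : normc (intRn (fun x => (h x - h x0) * k x)) <= rint (fun x => normc (h x0) / 2 * b (x - x0)).
  apply: intRn_le.
  - have := cc_sub chk ckx; congr cc; apply/funext => x; rewrite mulrBl//.
  - have := cc_scale (real_complex R (normc (h x0) / 2)) cbs; congr cc.
    by apply/funext => x; rewrite [RHS]rcM.
  move=> x; rewrite ComplexField.Normc.normcM normc_rc ger0_norm ?bump_ge0//.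
  have [xr|xr] := leP `|x - x0| (rho / 2); last by rewrite /b bump_out ?mulr0.
  rewrite ler_wpM2r ?bump_ge0// normcB_sym hr//.
  by rewrite -normrN opprB (le_lt_trans xr)//; lra.
rewrite E rint_scale// (_ : rint (fun x => b (x - x0)) = rint b); last first.
  by apply: rc_inj; rewrite -!intRn_rc (intRn_shift x0 cb).
have := rint_bump_gt0 d r2; rewrite -/b; nra.
Qed.

(** * Integrable functions with a compactly supported derivative *)

Section IntegrableVanishing.
Variables (R : realType) (d : nat).
Local Notation C := R[i].
Local Notation V := 'rV[R]_d.
Local Notation rc := (real_complex R).
Local Notation iC := (Complex 0 1 : C).
Local Notation rt := (@row_of_tuple R d).
Implicit Types (F : V -> C) (s : seq 'I_d).

Lemma bump_le1 (rho : R) (x : V) : cube_bump rho x <= 1.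
Proof.
have f1 (t : R) : flat 0 t <= 1.
  rewrite /flat; case: ifP => // t0; rewrite expr0 invr1 mul1r -expR0 ler_expR.
  by rewrite oppr_le0 invr_ge0 ltW.
by apply: prodr_ile1 => j _; rewrite mulr_ge0 ?flat_ge0//= mulr_ile1 ?flat_ge0.
Qed.

(* The translates of a small bump by n v, |v| >= 1, are disjoint, so that their sum is at most 1. *)
Lemma bump_translates_le1 (rho : R) (v y : V) N : 0 < rho <= 4^-1 -> 1 <= `|v| ->
  \sum_(n < N) cube_bump rho (y - n%:R *: v) <= 1.
Proof.
move=> /andP[r0 r4] v1.
have out (n : 'I_N) : cube_bump rho (y - n%:R *: v) != 0 -> `|y - n%:R *: v| <= rho.
  by apply: contra_neqT; rewrite -ltNge => /(bump_out r0).
have [[n0 hn0]|h] := pselect (exists n : 'I_N, cube_bump rho (y - n%:R *: v) != 0); last first.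
  rewrite big1 ?ler01// => n _; apply/eqP; apply: contra_notT h => h; by exists n.
rewrite (bigD1 n0)//= big1 ?addr0 ?bump_le1// => n nn0.
apply/eqP; apply: contraT => hn; have h1 := out _ hn; have h0 := out _ hn0.
have : `|(n%:R - n0%:R) *: v| <= rho + rho.
  rewrite (_ : _ *: v = (y - n0%:R *: v) - (y - n%:R *: v)); last first.
    by rewrite scalerBl opprB [RHS]addrC addrA subrK.
  by apply: (le_trans (ler_normB _ _)); exact: lerD.
rewrite normrZ; have : 1 <= `|n%:R - n0%:R : R|.
  rewrite -[n%:R]/((n : int)%:~R) -[n0%:R]/((n0 : int)%:~R) -rmorphB -intr_norm ler1z.
  by rewrite -gtz0_ge1 normr_gt0 subr_eq0; apply: contra nn0 => /eqP[/eqP].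
move=> h3 h4; have : 1 <= `|n%:R - n0%:R : R| * `|v| by rewrite mulr_ege1.
by move: h3; lra.
Qed.

(** Let kappa be the integral of |u| against a bump at x0. For every n the relation bounds kappa by
    a fixed combination of integrals of |u| against the bump translated by n p. Summed over n < N,
    each of these is at most the integral of |u|, as the translates are disjoint. So N kappa is
    bounded and kappa cannot be positive. *)
Lemma integrable_translates_eq0 (u : V -> R) (H : V -> Prop) (L : seq (R * V)) (x0 : V) :
  continuous u -> (lebesgue_Rn R d).-integrable setT (fun t => (u (rt t))%:E) ->
  all (fun p => 1 <= `|p.2|) L ->
  (forall n x, H x -> u x = \sum_(p <- L) p.1 * u (x + n%:R *: p.2)) ->
  (exists2 rho : R, 0 < rho & forall x, `|x - x0| <= rho -> H x) -> u x0 = 0.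
Proof.
move=> cu iu hL hu [rho' rho'0 hrho]; apply/eqP; apply: contraT => ux0.
have n0 : 0 < `|u x0| by rewrite normr_gt0.
have [dl dl0 hdl] := unif_cont_compact `|x0| cu (divr_gt0 n0 (ltr0n R 2)).
(* The bump has to fit where the relation holds and where |u| >= |u x0| / 2, and to be narrow enough
   for disjoint translates. *)
have [rho [r0 rr' rd r4]] : exists rho : R, [/\ 0 < rho, rho <= rho', rho <= dl / 2 & rho <= 4^-1].
  exists (Num.min (Num.min rho' (dl / 2)) 4^-1).
  split; try by rewrite !ge_min lexx ?orbT.
  by rewrite !lt_min rho'0 divr_gt0//= invr_gt0.
have rr : 0 < rho <= 4^-1 by rewrite r0.
pose b (z x : V) := cube_bump rho (x - z); have cb := bump_cc d r0.
have cbz z : cc (fun x => rc (b z x)) by exact: (cc_shift z cb).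
have b0 z x : 0 <= b z x by exact: bump_ge0.
have bH z x : b z x != 0 -> `|x - z| <= rho.
  by apply: contra_neqT; rewrite -ltNge => /(bump_out r0).
have cw (z : V) : CnC 0 (fun x : V => rc `|u (x - z)|).
  have cuz : continuous (fun x : V => u (x - z)) by exact: (CnC0_shift z (CnC0_rc cu)).1.
  by apply: CnC0_rc => x; have h := @continuous_comp _ _ _ (fun x : V => u (x - z)) _ x (cuz x) (@norm_continuous _ R^o _); exact: h.
have ccm z z' (c : R) : cc (fun x => rc (c * (`|u (x - z)| * b z' x))).
  have := cc_scale (rc c) (cc_mul (cbz z') (cw z)); congr cc; apply/funext => x.
  by rewrite !rcM [rc (b _ _) * _]mulrC.
have ccm1 z z' : cc (fun x => rc (`|u (x - z)| * b z' x)).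
  by have := ccm z z' 1; congr cc; apply/funext => x; rewrite mul1r.
pose W := rint (fun x => `|u x|).
have hb (z : V) (v : V) N : 1 <= `|v| ->
    rint (fun y => `|u y| * \sum_(n < N) b (z + n%:R *: v) y) <= W.
  move=> v1.
  have hs y : 0 <= \sum_(n < N) b (z + n%:R *: v) y <= 1.
    rewrite sumr_ge0//=; apply: le_trans (bump_translates_le1 (y - z) N rr v1).
    by apply: ler_sum => n _; rewrite /b opprD addrA.
  have [cc0 [B hB]] : cc (fun y => rc (`|u y| * \sum_(n < N) b (z + n%:R *: v) y)).
    have := cc_sum (index_enum 'I_N) (fun n : 'I_N => ccm1 0 (z + n%:R *: v)); congr cc.
    apply/funext => y; rewrite mulr_sumr rc_sum; apply: eq_bigr => n _; by rewrite subr0.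
  apply: le_Rintegral => //.
  - apply: (@rcs_rintegrable _ _ (fun y => `|u y| * \sum_(n < N) b (z + n%:R *: v) y) B).
      by move=> x /hB [].
    by have [] := cc0.
  - exact: integrable_norm.
  by move=> t _; rewrite ler_piMr//; case/andP: (hs (rt t)).
pose kappa := rint (fun x => `|u x| * b x0 x).
have ck : cc (fun x => rc (`|u x| * b x0 x)).
  by have := ccm1 0 x0; congr cc; apply/funext => x; rewrite subr0.
have kappa_lower : `|u x0| / 2 * rint (b x0) <= kappa.
  rewrite -rint_scale//; apply: rint_le => //.
    have := cc_scale (rc (`|u x0| / 2)) (cbz x0); congr cc; apply/funext => x; by rewrite [RHS]rcM.
  move=> x; have [->|/bH xr] := eqVneq (b x0 x) 0; first by rewrite !mulr0.
  apply: ler_wpM2r => //; have : `|u x0 - u x| <= `|u x0| / 2.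
    by apply: hdl => //; rewrite -normrN opprB; apply: (le_lt_trans xr); lra.
  by have := ler_normB (u x0 - u x) (- u x); rewrite opprK subrK normrN; lra.
have rb : rint (b x0) = rint (@cube_bump R d rho).
  apply: rc_inj; apply: etrans (esym (intRn_rc (b x0))) _.
  exact: etrans (intRn_shift x0 cb) (intRn_rc _).
have k0 : 0 < kappa.
  apply: lt_le_trans kappa_lower; rewrite rb; apply: mulr_gt0; first exact: divr_gt0.
  exact: rint_bump_gt0.
have step n : kappa <= \sum_(p <- L) `|p.1| * rint (fun y => `|u y| * b (x0 + n%:R *: p.2) y).
  have E p : rint (fun y => `|u y| * b (x0 + n%:R *: p) y) =
      rint (fun x => `|u (x + n%:R *: p)| * b x0 x).
    have cz : cc (fun y => rc (`|u y| * b (x0 + n%:R *: p) y)).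
      by have := ccm1 0 (x0 + n%:R *: p); congr cc; apply/funext => x; rewrite subr0.
    have e1 := intRn_rc (fun y => `|u y| * b (x0 + n%:R *: p) y).
    have e2 := intRn_rc (fun x => `|u (x + n%:R *: p)| * b x0 x).
    apply: rc_inj; apply: etrans (esym e1) _; apply: etrans e2.
    apply: etrans (esym (intRn_shift (- (n%:R *: p)) cz)) _; congr intRn; apply/funext => x; rewrite opprK /b.
    by have -> : x + n%:R *: p - (x0 + n%:R *: p) = x - x0 by rewrite opprD addrACA subrr addr0.
  under eq_bigr do rewrite E.
  have cE (p : R * V) : cc (fun x => rc (`|p.1| * (`|u (x + n%:R *: p.2)| * b x0 x))).
    by have := ccm (- (n%:R *: p.2)) x0 `|p.1|; congr cc; apply/funext => x; rewrite opprK.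
  have cE1 (p : R * V) : cc (fun x => rc (`|u (x + n%:R *: p.2)| * b x0 x)).
    by have := ccm1 (- (n%:R *: p.2)) x0; congr cc; apply/funext => x; rewrite opprK.
  have -> : \sum_(p <- L) `|p.1| * rint (fun x => `|u (x + n%:R *: p.2)| * b x0 x) =
      rint (fun x => \sum_(p <- L) `|p.1| * (`|u (x + n%:R *: p.2)| * b x0 x)).
    apply: etrans (esym (rint_sum L cE)); apply: eq_bigr => p _.
    exact: esym (rint_scale `|p.1| (cE1 p)).
  apply: rint_le; first exact: ck.
    by have := cc_sum L cE; congr cc; apply/funext => x; rewrite rc_sum.
  move=> x; have [->|/bH xr] := eqVneq (b x0 x) 0.
    rewrite mulr0 big1; first exact: lexx.
    by move=> p _; rewrite !mulr0.
  have -> : \sum_(p <- L) `|p.1| * (`|u (x + n%:R *: p.2)| * b x0 x) =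
      (\sum_(p <- L) `|p.1| * `|u (x + n%:R *: p.2)|) * b x0 x.
    by rewrite mulr_suml; apply: eq_bigr => p _; rewrite mulrA.
  apply: ler_wpM2r; first exact: b0.
  rewrite (hu n x); last by apply: hrho; exact: le_trans xr rr'.
  apply: (le_trans (ler_norm_sum _ _ _)); apply: ler_sum => p _; by rewrite normrM.
have bound N : N%:R * kappa <= (\sum_(p <- L) `|p.1|) * W.
  apply: (@le_trans _ _ (\sum_(n < N) \sum_(p <- L) `|p.1| *
      rint (fun y => `|u y| * b (x0 + n%:R *: p.2) y))).
    have -> : N%:R * kappa = \sum_(n < N) kappa by rewrite sumr_const card_ord mulr_natl.
    by apply: ler_sum => n _; exact: step.
  rewrite exchange_big mulr_suml big_seq [leRHS]big_seq; apply: ler_sum => p pL.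
  rewrite -mulr_sumr; apply: ler_wpM2l; first exact: normr_ge0.
  apply: le_trans (hb x0 p.2 N (allP hL p pL)).
  have cn (n : 'I_N) : cc (fun y => rc (`|u y| * b (x0 + n%:R *: p.2) y)).
    by have := ccm1 0 (x0 + n%:R *: p.2); congr cc; apply/funext => x; rewrite subr0.
  rewrite le_eqVlt; apply/orP; left; apply/eqP.
  apply: etrans (esym (rint_sum (index_enum 'I_N) cn)) _; congr rint.
  by apply/funext => y; rewrite mulr_sumr.
set A := (_ * W) in bound; move: A kappa k0 bound {kappa_lower ck step} => A kappa k0 bound.
have := bound (Num.bound (`|A| / kappa)).
have := archi_boundP (divr_ge0 (normr_ge0 A) (ltW k0)); rewrite ltr_pdivrMr; last exact: k0.
by move=> h1 h2; have := le_lt_trans (le_trans h2 (ler_norm A)) h1; rewrite ltxx.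
Qed.

Lemma wderiv_shift s F y : CnC (size s) F ->
  wderiv s (fun x => F (x - y)) = fun x => wderiv s F (x - y).
Proof.
move=> cF; apply: (@wderiv_comm R d (fun k F => CnC k F) (fun F x => F (x - y))) => // k G.
move=> /CnC_S[_ hG] j; have [dG cG] := hG j; split => //.
exact: (DC_pderivC (DC_shift y dG)).
Qed.

Section HalfSpace.
Variables (i : 'I_d) (sg B : R).
Hypotheses (sg1 : `|sg| = 1) (B0 : 0 <= B).
Local Notation H := (fun x : V => B < sg * x 0 i).
Local Notation ej j := (delta_mx 0 j : V).

Let sg2 : sg * sg = 1. Proof. by rewrite -expr2 -real_normK ?num_real// sg1 expr1n. Qed.

(** A move in the direction sg e_j never leaves the half-space, including for j = i, where it goes
    inwards. *)
Lemma half_space_cst j F (t : R) x : 0 <= t -> CnC 1 F ->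
  (forall x, H x -> pderivC j F x = 0) -> H x -> F (x + (t * sg) *: ej j) = F x.
Proof.
move=> t0 /CnC_S[_ /(_ j)[[d1 d2] _]] hF Hx.
(* [isD_MVT] locates the intermediate point on either side of its base point; taking the midpoint
   [c] as base keeps both sides in the half-space. *)
have key (u u' : V -> R) : isD j u u' -> (forall x, H x -> u' x = 0) ->
    u (x + (t * sg) *: ej j) = u x.
  move=> du hu'; pose c := x + (t * sg / 2) *: ej j.
  have hc (h : R) : `|h| <= t / 2 -> u (c + h *: ej j) = u c.
    move=> ht; have [t' tt' E] := isD_MVT c h du; apply/eqP; rewrite -subr_eq0 E hu' ?mulr0//.
    rewrite /c !mxE !eqxx /=; apply: (lt_le_trans Hx).
    have : `|sg * t'| <= t / 2 by rewrite normrM sg1 mul1r (le_trans tt').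
    rewrite ler_norml => /andP[h1 h2].
    have -> : sg * (x 0 i + t * sg / 2 * (i == j)%:R + t' * (i == j)%:R) =
       sg * x 0 i + (t / 2 * (sg * sg) + sg * t') * (i == j)%:R by ring.
    rewrite sg2 mulr1 lerDl mulr_ge0//; lra.
  have ht : `|t * sg / 2| <= t / 2 by rewrite !normrM sg1 mulr1 normfV !ger0_norm.
  have h1 := hc _ ht; have h2 := hc (- (t * sg / 2)); rewrite normrN in h2; have := h2 ht.
  rewrite /c scaleNr addrK => ->; rewrite -h1 /c -addrA -scalerDl; congr (u (_ + _ *: _)); lra.
apply: complexP; first by apply: (key _ _ d1) => y /hF E; rewrite /comp E.
by apply: (key _ _ d2) => y /hF E; rewrite /comp E.
Qed.

Let nonneg (v : V) := forall j, 0 <= sg * v 0 j.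

(** For the word j :: s, [wderiv s F] is constant along w = sg e_j in the half-space, so G(x) = F(x)
    - F(x + t w) satisfies the hypothesis for s; the relation for G, expanded, is one for F. The
    list depends neither on F nor on t, so t can run through the integers. *)
Lemma half_space_differences s : exists L : seq (R * V),
  all (fun p => 1 <= `|p.2|) L /\
  forall F, CnC (size s) F -> (forall x, H x -> wderiv s F x = 0) ->
  forall (t : R) x, 0 <= t -> H x -> F x = \sum_(p <- L) rc p.1 * F (x + t *: p.2).
Proof.
(* Nonnegativity of the directions is added to the induction so that p + w keeps a coordinate of
   modulus at least 1. *)
suff [L [hL1 [hL2 h]]] : exists L : seq (R * V), all (fun p => 1 <= `|p.2|) L /\
    (forall p, p \in L -> nonneg p.2) /\
    forall F, CnC (size s) F -> (forall x, H x -> wderiv s F x = 0) ->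
    forall (t : R) x, 0 <= t -> H x -> F x = \sum_(p <- L) rc p.1 * F (x + t *: p.2).
  by exists L.
elim: s => [|j s [L [hL1 [hL2 h]]]].
  by exists [::]; split => //; split => // F _ hF t x _ /hF /= ->; rewrite big_nil.
pose w : V := sg *: ej j.
have w0 : nonneg w by move=> k; rewrite !mxE mulrA sg2 mul1r.
exists ((1, w) :: L ++ [seq (- p.1, p.2 + w) | p <- L]); split; [|split].
- rewrite /= all_cat hL1 all_map /=; apply/andP; split.
    apply: le_trans (rV_norm_coord _ j); by rewrite !mxE !eqxx mulr1 sg1.
  apply/allP => p pL /=; apply: le_trans (rV_norm_coord _ j).
  rewrite -[leRHS]mul1r -[X in _ <= X * _]sg1 -normrM; apply: le_trans (ler_norm _).
  by rewrite mxE mulrDr [w _ _]mxE !mxE !eqxx mulr1 sg2 lerDr; exact: hL2.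
- move=> p; rewrite inE mem_cat => /orP[/eqP -> //|/orP[/hL2//|/mapP[q /hL2 hq -> k]]].
  by rewrite mxE mulrDr addr_ge0 ?w0 ?hq.
move=> F cF hF t x t0 Hx.
have cF' : CnC (size s) F by exact: CnC_mono cF.
pose y : V := - (t *: w); pose G x := F x - F (x - y).
have cG : CnC (size s) G by apply: CnC_sub => //; exact: CnC_shift.
have hG z : H z -> wderiv s G z = 0.
  move=> Hz; rewrite /G wderiv_sub//; last exact: CnC_shift.
  rewrite wderiv_shift// /y opprK /w scalerA half_space_cst ?subrr//.
  by apply: wderiv_CnC; rewrite addn1.
have := h G cG hG t x t0 Hx; rewrite /G /y opprK big_cons big_cat big_map /= => E.
have -> : F x = F (x + t *: w) + (F x - F (x + t *: w)) by rewrite addrC subrK.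
rewrite mul1r E; congr (_ + _); rewrite -big_split; apply: eq_bigr => p _ /=.
by rewrite rcN mulNr -mulrBr scalerDr addrA.
Qed.

End HalfSpace.

(** A point outside the cube has a coordinate of modulus above B, hence lies in a half-space where
    the derivative vanishes. There F is a combination of its translates by arbitrarily large
    multiples of fixed vectors, so integrability forces it to vanish. *)
Lemma integrable_csupp s F (B : nat) : CnC (size s) F -> csupp B (wderiv s F) ->
  (lebesgue_Rn R d).-integrable setT (fun t => (complex.Re (F (rt t)))%:E) ->
  (lebesgue_Rn R d).-integrable setT (fun t => (complex.Im (F (rt t)))%:E) ->
  csupp B F.
Proof.
move=> cF hB i1 i2 x xB; have [i xi] := rV_norm_ltP (ler0n R B) xB.
have [sg sg1 sx] : exists2 sg : R, `|sg| = 1 & sg * x 0 i = `|x 0 i|.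
  have [h|h] := ger0P (x 0 i); first by exists 1; rewrite ?normr1 ?mul1r.
  by exists (-1); rewrite ?normrN1 ?mulN1r.
have [L [hL1 hL2]] := half_space_differences i B%:R sg1 s.
have hH (y : V) : B%:R < sg * y 0 i -> wderiv s F y = 0.
  move=> h; apply: hB; apply: (lt_le_trans h); apply: le_trans (rV_norm_coord y i).
  by apply: (le_trans (ler_norm _)); rewrite normrM sg1 mul1r.
have rel n (y : V) : B%:R < sg * y 0 i -> F y = \sum_(p <- L) rc p.1 * F (y + n%:R *: p.2).
  by move=> hy; apply: hL2.
have open : exists2 rho : R, 0 < rho & forall y, `|y - x| <= rho -> B%:R < sg * y 0 i.
  exists ((`|x 0 i| - B%:R) / 2); first by rewrite divr_gt0// subr_gt0.
  move=> y yr; have := le_trans (rV_norm_coord (y - x) i) yr; rewrite !mxE => h.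
  have : `|sg * (y 0 i - x 0 i)| <= (`|x 0 i| - B%:R) / 2 by rewrite normrM sg1 mul1r.
  by rewrite mulrBr sx ler_norml => /andP[]; lra.
have [c1 c2] := CnC_0 cF.
apply: complexP => /=.
  apply: (integrable_translates_eq0 c1 i1 hL1 _ open) => n y /(rel n) E.
  by rewrite /= [in LHS]E cRe_sum; apply: eq_bigr => p _; rewrite cReM /= mul0r subr0.
apply: (integrable_translates_eq0 c2 i2 hL1 _ open) => n y /(rel n) E.
by rewrite /= [in LHS]E cIm_sum; apply: eq_bigr => p _; rewrite cImM /= mul0r addr0.
Qed.

(** The multi-index factorial mu! when the word [s] has letter counts mu. *)
Definition word_fact s : C := \prod_j ((count_mem j s)`!)%:R.

Lemma DC_wmono j s : DC j (wmono s) (fun x : V => (count_mem j s)%:R * wmono (rem j s) x).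
Proof.
elim: s => [|k s ih].
  have := @DC_cst R d j 1; congr DC; apply/funext => x; by rewrite ?wmono_nil ?mul0r.
have := DC_mul (DC_rc (isD_coord j k)) ih; congr DC; apply/funext => x.
  by rewrite wmono_cons.
rewrite /=; have [<-{j ih}|kj] := eqVneq k j; last first.
  by rewrite -[rc 0]/(0 : C) mul0r !add0r mulrCA wmono_cons.
rewrite -[rc 1]/(1 : C) mul1r natrD mulrDl mul1r; congr (_ + _).
have [ks|ks] := boolP (k \in s); last first.
  by move/count_memPn: ks => ->; rewrite !mul0r mulr0.
by rewrite mulrCA -wmono_cons (wmono_perm _ (perm_to_rem ks)).
Qed.

(* Leibniz' rule at a zero of high order: only the monomial is differentiated. *)
Lemma wderiv_wmono_mul0 t s (h : V -> C) : (size t <= size s)%N -> CnC (size t) h ->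
  wderiv t (fun x => wmono s x * h x) 0 = if perm_eq t s then word_fact s * h 0 else 0.
Proof.
elim/last_ind: t s h => [|t j ih] s h.
  case: s => [|k s] _ _ /=.
    by rewrite wmono_nil /word_fact big1.
  by rewrite wmono_cons mxE -[rc 0]/(0 : C) !mul0r; case: ifP => // /perm_size.
rewrite size_rcons => ts ch; have /CnC_S[_ /(_ j)[dh cdh]] := ch.
have ch' : CnC (size t) h by exact: CnC_mono ch.
have cw s' k : CnC k (wmono s' : V -> C).
  elim: k s' => [|k ihk] s'; first exact: CnC0_wmono.
  apply: CnC_DC; first exact: CnC0_wmono.
  by move=> l; eexists; [exact: DC_wmono|apply: CnC_scale; exact: ihk].
rewrite /wderiv foldr_rcons -/(wderiv _ _) (DC_pderivC (DC_mul (DC_wmono j s) dh)).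
rewrite (_ : (fun x : V => _) = fun x => (count_mem j s)%:R * (wmono (rem j s) x * h x) +
   wmono s x * pderivC j h x); last by apply/funext => x; rewrite mulrA.
rewrite wderiv_lin; [|exact: CnC_mul|exact: CnC_mul].
rewrite (ih s _ (ltnW ts) cdh).
have -> : perm_eq t s = false.
  by apply/negbTE; apply: contraL ts => /perm_size ->; rewrite ltnn.
rewrite addr0; have [js|js] := boolP (j \in s); last first.
  rewrite (_ : perm_eq (rcons t j) s = false).
    by move/count_memPn: js => ->; rewrite mul0r.
  by apply/negbTE; apply: contra js => /perm_mem <-; rewrite mem_rcons mem_head.
rewrite ih//; last by rewrite size_rem//; case: (s) ts.
have -> : perm_eq (rcons t j) s = perm_eq t (rem j s).
  by rewrite (permPr (perm_to_rem js)) perm_rcons perm_cons.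
case: ifP => _; last by rewrite mulr0.
rewrite mulrA; congr (_ * _); rewrite /word_fact [RHS](bigD1 j)// [X in _ * X = _](bigD1 j)//.
rewrite mulrA; congr (_ * _).
  rewrite -natrM (permP (perm_to_rem js)) /= eqxx add1n factS; reflexivity.
apply: eq_bigr => k /= kj; rewrite (permP (perm_to_rem js)) /= eq_sym (negbTE kj) add0n//.
Qed.

End IntegrableVanishing.

(** * Simple eigenvalues and powers of matrices *)

Section CharacteristicPolynomial.
Variable F : fieldType.

Lemma char_poly_tr n (A : 'M[F]_n) : char_poly A^T = char_poly A.
Proof.
rewrite /char_poly -[RHS]det_tr; congr (\det _).
by rewrite /char_poly_mx linearB /= tr_scalar_mx map_trmx.
Qed.

Lemma root_char_poly_col n (A : 'M[F]_n) (v : 'cV[F]_n) x :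
  A *m v = x *: v -> v != 0 -> root (char_poly A) x.
Proof.
move=> Av v0; rewrite -char_poly_tr -eigenvalue_root_char; apply/eigenvalueP.
exists v^T; last by apply: contra v0 => /eqP h; rewrite -[v]trmxK h trmx0.
by rewrite -trmx_mul Av linearZ.
Qed.

(** Matrix determinant lemma, by triangularising one block matrix in two ways. The factor [t] on the
    left avoids a division, since the lemma is applied over polynomials. *)
Lemma det_scalar_rank1 (K : comNzRingType) n (t : K) (v : 'cV[K]_n) (w : 'rV[K]_n) :
  t * \det (t%:M + v *m w) = (t + (w *m v) 0 0) * t ^+ n.
Proof.
pose B : 'M[K]_(1 + n) := block_mx 1%:M (- w) v t%:M.
have E1 : \det B = \det (t%:M + v *m w).
  have := det_mulmx (block_mx 1%:M 0 (- v) 1%:M) B.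
  rewrite det_lblock !det1 mulr1 mul1r => <-.
  rewrite /B mulmx_block !mul0mx !mul1mx !addr0 mulmx1 addNr det_ublock det1 mul1r.
  by rewrite mulNmx mulmxN opprK addrC.
have E2 : \det B * t = (t + (w *m v) 0 0) * t ^+ n.
  have := det_mulmx B (block_mx t%:M 0 (- v) 1%:M).
  rewrite det_lblock det1 mulr1 det_scalar1 => <-.
  rewrite /B mulmx_block !mulmx0 !add0r !mulmx1 mul1mx mulNmx mulmxN opprK.
  rewrite mul_mx_scalar mulmxN mul_scalar_mx subrr det_ublock det_scalar det_mx11.
  by rewrite !mxE eqxx mulr1n.
by rewrite -E1 mulrC E2.
Qed.

(* Deflating the right eigenvector v turns one factor X - 1 of the characteristic polynomial
   into X; the left eigenvector u survives since u v = 0, so 1 was a double root. *)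
Lemma simple_eigenvector n (A : 'M[F]_n) (u : 'rV[F]_n) (v : 'cV[F]_n) :
  mup 1 (char_poly A) = 1%N -> u *m A = u -> u != 0 -> A *m v = v -> u *m v = 0 -> v = 0.
Proof.
move=> mu uA u0 Av uv; apply/eqP; apply: contraT => v0.
have [i vi] : exists i, v i 0 != 0.
  apply/existsP; apply: contraNT v0 => /existsPn h; apply/eqP/matrixP => i j.
  by rewrite ord1 mxE; apply/eqP; have := h i; rewrite negbK.
(* A row with w v = 1: then A - v w sends v to 0 and still has the left eigenvector [u], because u v
   = 0. *)
pose w : 'rV[F]_n := (v i 0)^-1 *: delta_mx 0 i.
have wv : (w *m v) 0 0 = 1 by rewrite -scalemxAl -rowE !mxE mulVf.
pose A' := A - v *m w; pose t : {poly F} := 'X - 1%:P.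
pose vP := map_mx polyC v; pose wP := map_mx polyC w.
have E1 : char_poly_mx A' = char_poly_mx A + vP *m wP.
  by rewrite /char_poly_mx /A' map_mxB map_mxM opprB addrA addrAC.
have E2 : char_poly_mx A *m vP = t *: vP.
  by rewrite /char_poly_mx mulmxBl mul_scalar_mx -map_mxM Av scalerBl scale1r.
have E3 : char_poly_mx A *m (t%:M + vP *m wP) = t *: char_poly_mx A'.
  by rewrite mulmxDr mul_mx_scalar mulmxA E2 -scalemxAl -scalerDr E1.
have t0 : t != 0 by rewrite polyXsubC_eq0.
have E4 : t * char_poly A' = 'X * char_poly A.
  have := congr1 (fun B => t * \det B) E3; rewrite /= det_mulmx detZ mulrCA det_scalar_rank1.
  rewrite -map_mxM mxE wv /t subrK mulrA [t ^+ n * _]mulrC mulrA -/(char_poly A) -/(char_poly A').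
  by move/(mulIf (expf_neq0 n t0)); rewrite mulrC => <-.
have r1 : t %| char_poly A'.
  rewrite dvdp_XsubCl -eigenvalue_root_char; apply/eigenvalueP; exists u => //.
  by rewrite /A' mulmxBr mulmxA uv mul0mx subr0 scale1r.
have : t ^+ 2 %| 'X * char_poly A by rewrite -E4 expr2 dvdp_mul.
rewrite Gauss_dvdpr; last first.
  by rewrite coprimep_expl// -['X]subr0 -polyC0 coprimep_XsubC rootE hornerXsubC sub0r oppr_eq0 oner_eq0.
by rewrite -mup_geq ?monic_neq0 ?char_poly_monic// mu.
Qed.

End CharacteristicPolynomial.

Section PowerBound.
Variable R : realType.
Local Notation C := R[i].

(** The sum of the moduli of all entries, which is submultiplicative for rectangular products
    too. *)
Definition nrm p q (A : 'M[C]_(p, q)) : R := \sum_i \sum_j normc (A i j).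

Lemma nrm_ge0 p q (A : 'M[C]_(p, q)) : 0 <= nrm A.
Proof. by apply: sumr_ge0 => i _; apply: sumr_ge0 => j _; exact: normc_ge0. Qed.

Lemma nrm_entry p q (A : 'M[C]_(p, q)) i j : normc (A i j) <= nrm A.
Proof.
rewrite /nrm (bigD1 i)//= (bigD1 j)//= -addrA lerDl addr_ge0//.
  by apply: sumr_ge0 => k _; exact: normc_ge0.
by apply: sumr_ge0 => k _; apply: sumr_ge0 => l _; exact: normc_ge0.
Qed.

Lemma nrmD p q (A B : 'M[C]_(p, q)) : nrm (A + B) <= nrm A + nrm B.
Proof.
rewrite /nrm -big_split; apply: ler_sum => i _; rewrite -big_split; apply: ler_sum => j _.
by rewrite mxE; exact: le_normcD.
Qed.

Lemma nrmZ p q c (A : 'M[C]_(p, q)) : nrm (c *: A) = normc c * nrm A.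
Proof.
rewrite /nrm mulr_sumr; apply: eq_bigr => i _; rewrite mulr_sumr; apply: eq_bigr => j _.
by rewrite mxE ComplexField.Normc.normcM.
Qed.

Lemma nrmM p q s (A : 'M[C]_(p, q)) (B : 'M[C]_(q, s)) : nrm (A *m B) <= nrm A * nrm B.
Proof.
rewrite /nrm mulr_suml; apply: ler_sum => i _.
apply: (@le_trans _ _ (\sum_(j < s) \sum_(k < q) normc (A i k) * normc (B k j))).
  apply: ler_sum => j _; rewrite mxE; apply: (le_trans (normc_sum _ _ _)).
  by apply: ler_sum => k _; rewrite ComplexField.Normc.normcM.
rewrite exchange_big mulr_suml; apply: ler_sum => k _.
rewrite -mulr_sumr ler_wpM2l ?normc_ge0//.
rewrite (bigD1 k)//= lerDl; apply: sumr_ge0 => l _; apply: sumr_ge0 => j _; exact: normc_ge0.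
Qed.

(* If (A - z) Y grows at most like (3/2)^k under the powers of A and |z| <= 1, then so does Y;
   Cayley-Hamilton starts the induction over the list of eigenvalues. *)
Lemma iter_mulmx_bound n (A : 'M[C]_n) :
  (forall z, root (char_poly A) z -> normc z <= 1) ->
  exists2 D : R, 0 <= D & forall k, nrm (iter k (mulmx A) 1%:M) <= D * (3 / 2) ^+ k.
Proof.
case: n A => [|n] A hA.
  by exists 0 => // k; rewrite mul0r /nrm big_ord0.
have [s hs] := closed_field_poly_normal (char_poly A).
rewrite (monicP (char_poly_monic A)) scale1r in hs.
have hz : all (fun z => normc z <= 1) s.
  by apply/allP => z zs; apply: hA; rewrite hs root_prod_XsubC.
have CH : horner_mx A (\prod_(z <- s) ('X - z%:P)) * 1 = 0.
  by rewrite -hs Cayley_Hamilton mul0r.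
have iterE k (Y : 'M[C]_n.+1) : iter k (mulmx A) Y = A ^+ k * Y.
  by elim: k => [|k ih]; rewrite ?expr0 ?mul1r//= ih exprS -mulrA.
suff key Y : horner_mx A (\prod_(z <- s) ('X - z%:P)) * Y = 0 ->
    exists2 D : R, 0 <= D & forall k, nrm (A ^+ k * Y) <= D * (3 / 2) ^+ k.
  by have [D D0 hD] := key 1 CH; exists D => // k; rewrite iterE.
elim: s hz Y {hs CH} => [|z s ih] /= hz Y.
  rewrite big_nil rmorph1 mul1r => ->; exists 0 => // k.
  by rewrite mulr0 mul0r /nrm big1// => i _; rewrite big1// => j _; rewrite mxE ComplexField.Normc.normc0.
have /andP[z1 hz'] := hz.
rewrite big_cons mulrC rmorphM -mulrA rmorphB /= horner_mx_X horner_mx_C => /(ih hz')[D D0 hD].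
(* Writing E for this constant, D <= E / 2, so that E + D <= (3/2) E closes the induction. *)
exists (nrm Y + 2 * D); first by rewrite addr_ge0 ?nrm_ge0 ?mulr_ge0.
have Y0 := nrm_ge0 Y.
elim=> [|k ihk]; first by rewrite !expr0 mul1r mulr1 lerDl mulr_ge0.
have -> : A ^+ k.+1 * Y = z *: (A ^+ k * Y) + A ^+ k * ((A - z%:M) * Y).
  by rewrite mulrBl mulrBr -[z%:M * Y]/(z%:M *m Y) mul_scalar_mx -scalerAr addrC subrK mulrA -exprSr.
apply: (le_trans (nrmD _ _)); rewrite nrmZ exprS.
have := hD k; have := nrm_ge0 (A ^+ k * Y); have := normc_ge0 z.
have p0 : 0 <= (3 / 2 : R) ^+ k by rewrite exprn_ge0// divr_ge0.
move: ihk; set a := nrm (A ^+ k * Y);  set p := (3 / 2) ^+ k in p0 *.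
move=> h1 h2 h3 h4; have h5 : normc z * a <= a by rewrite ler_piMl.
apply: (le_trans (lerD h5 h4)); apply: (le_trans (lerD h1 (lexx _))).
rewrite -subr_ge0 (_ : _ - _ = nrm Y * p / 2); last by rewrite -/p; field.
by rewrite divr_ge0// mulr_ge0.
Qed.

Lemma iter_mulmx_col n (A : 'M[C]_n) (D : R) (v : 'cV[C]_n) k :
  (forall k, nrm (iter k (mulmx A) 1%:M) <= D * (3 / 2) ^+ k) ->
  nrm (iter k (mulmx A) v) <= D * (3 / 2) ^+ k * nrm v.
Proof.
move=> hD; have -> : iter k (mulmx A) v = iter k (mulmx A) 1%:M *m v.
  by elim: k => [|k ih] /=; rewrite ?mul1mx// ih mulmxA.
by apply: (le_trans (nrmM _ _)); rewrite ler_wpM2r ?nrm_ge0.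
Qed.

End PowerBound.

(** * Uniqueness for the refinement equation *)

Section RefinableUniqueness.
Variables (R : realType) (d M r : nat).
Local Notation C := R[i].
Local Notation V := 'rV[R]_d.
Local Notation Zd := 'rV[int]_d.
Local Notation rc := (real_complex R).
Hypothesis hM : (1 < M)%N.

Lemma sy_lipschitz0 (c : Zd -> C) : fsupp c ->
  exists2 K : R, 0 <= K & forall xi : V, normc (sy c xi - sy c 0) <= K * `|xi|.
Proof.
move=> [L hL]; exists (\sum_(k <- box L) 2 * (d%:R * `|zvec R k|) * normc (c k)).
  by apply: sumr_ge0 => k _; rewrite !mulr_ge0// normc_ge0.
move=> xi; have E z : sy c z = \sum_(k <- box L) expi (- dotp (zvec R k) z) * c k.
  by rewrite /sy (@fsum_box _ _ _ L)// => k /hL ->; rewrite mulr0.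
rewrite !E -sumrB mulr_suml; apply: (le_trans (normc_sum _ _ _)); apply: ler_sum => k _.
rewrite -mulrBl ComplexField.Normc.normcM mulrAC ler_wpM2r ?normc_ge0//.
rewrite [dotp _ 0]dotpC dotp0l oppr0 expi0; apply: (le_trans (expi_sub1 _)).
by rewrite normrN -!mulrA ler_wpM2l// dotp_bound.
Qed.

Lemma symbol_lipschitz0 p q (b : Zd -> 'M[C]_(p, q)) : fsupp b ->
  exists2 K : R, 0 <= K & forall xi : V, nrm (symbol b xi - symbol b 0) <= K * `|xi|.
Proof.
move=> fb; have /choice[K hK] (ij : 'I_p * 'I_q) : exists K : R, 0 <= K /\
    forall xi : V, normc (symbol b xi ij.1 ij.2 - symbol b 0 ij.1 ij.2) <= K * `|xi|.
  have [K K0 h] := sy_lipschitz0 (fsupp_entry ij.1 ij.2 fb).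
  by exists K; split => // xi; rewrite !symbol_entry.
exists (\sum_i \sum_j K (i, j)).
  by apply: sumr_ge0 => i _; apply: sumr_ge0 => j _; have [] := hK (i, j).
move=> xi; rewrite mulr_suml; apply: ler_sum => i _; rewrite mulr_suml; apply: ler_sum => j _.
by rewrite !mxE; have [_] := hK (i, j).
Qed.

Variable a : Zd -> 'M[C]_r.
Hypothesis ha : fsupp a.
Local Notation A := (symbol a 0).
Hypothesis hA : forall z, root (char_poly A) z -> normc z <= 1.

Let M0 : (0 : R) < M%:R. Proof. by rewrite ltr0n ltnW. Qed.

Let iter_mulmxD k (x y : 'cV[C]_r) :
  iter k (mulmx A) (x + y) = iter k (mulmx A) x + iter k (mulmx A) y.
Proof. by elim: k => //= k ->; rewrite mulmxDr. Qed.

(* Unrolling f = a^(./M) f(./M), the perturbations a^(M^-k xi) - A are O(M^-k) and f(M^-k xi) is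
   O(M^-k), whereas A^k grows at most like (3/2)^k: the Lipschitz bound of f improves by 1/2. *)
Lemma refinable_eq0 (f : V -> 'cV[C]_r) (B : R) :
  (forall xi, f (M%:R *: xi) = symbol a xi *m f xi) ->
  0 <= B -> (forall xi, `|xi| <= 1 -> nrm (f xi) <= B * `|xi|) ->
  forall xi, f xi = 0.
Proof.
move=> fM B0 fB; have [D D0 hD] := iter_mulmx_bound hA.
have [K K0 hK] := symbol_lipschitz0 ha.
(* On the ball of this radius the perturbation constant D K |xi| is at most 1/4. *)
pose dl : R := (4 * (D * K) + 1)^-1; have DK0 : 0 <= D * K by rewrite mulr_ge0.
have dl0 : 0 < dl by rewrite invr_gt0; lra.
have dl1 : dl <= 1 by rewrite invf_le1//; lra.
have dlK : D * K * dl <= 4^-1.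
  by rewrite /dl ler_pdivrMr; lra.
have Minv n (xi : V) : `|M%:R ^- n *: xi| <= 2^-1 ^+ n * `|xi|.
  rewrite normrZ ger0_norm ?invr_ge0 ?exprn_ge0// ler_wpM2r//.
  rewrite -exprVn lerXn2r ?nnegrE ?invr_ge0// lef_pV2 ?posrE ?ltr0n// ?ler_nat//.
  by rewrite ltnW.
have half b : 0 <= b -> (forall xi, `|xi| <= dl -> nrm (f xi) <= b * `|xi|) ->
    forall xi, `|xi| <= dl -> nrm (f xi) <= b / 2 * `|xi|.
  move=> b0 hb xi xdl; have x0 := normr_ge0 xi.
  (* Telescoping: the perturbation at step n is at most (1/4) (3/4)^n times b |xi| / 4, where 3/4 =
     (3/2) (1/2). *)
  have rec n : nrm (f xi - iter n (mulmx A) (f (M%:R ^- n *: xi))) <=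
      (1 - (3 / 4) ^+ n) * (b * `|xi| / 4).
    elim: n => [|n ih].
      rewrite !expr0 invr1 scale1r /= !subrr mul0r /nrm big1// => i _.
      by rewrite big1// => j _; rewrite mxE ComplexField.Normc.normc0.
    pose y := M%:R ^- n.+1 *: xi.
    have My : M%:R ^- n *: xi = M%:R *: y.
      by rewrite scalerA exprS invfM mulVKf ?lt0r_neq0.
    have Ey : f (M%:R ^- n *: xi) = A *m f y + (symbol a y - A) *m f y.
      by rewrite My fM -mulmxDl addrC subrK.
    have -> : f xi - iter n.+1 (mulmx A) (f y) =
        (f xi - iter n (mulmx A) (f (M%:R ^- n *: xi))) +
        iter n (mulmx A) ((symbol a y - A) *m f y).
      by rewrite Ey iter_mulmxD iterSr opprD addrA subrK.
    apply: (le_trans (nrmD _ _)); apply: (le_trans (lerD ih (iter_mulmx_col _ n hD))).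
    have y1 : `|y| <= 2^-1 ^+ n.+1 * `|xi| by exact: Minv.
    have p2 : (2^-1 : R) ^+ n <= 1 by rewrite exprn_ile1 ?invr_ge0// invf_le1// ler1n.
    have p20 : 0 <= (2^-1 : R) ^+ n by rewrite exprn_ge0// invr_ge0.
    have y2 : `|y| <= dl / 2.
      apply: (le_trans y1); rewrite exprS; have := mulr_ge0 p20 x0.
      have : 2^-1 ^+ n * `|xi| <= dl by apply: le_trans xdl; rewrite ler_piMl.
      lra.
    have e1 : nrm ((symbol a y - A) *m f y) <= K * b * (dl / 2 * (2^-1 ^+ n.+1 * `|xi|)).
      apply: (le_trans (nrmM _ _)); apply: (@le_trans _ _ (K * `|y| * (b * `|y|))).
        by apply: ler_pM; rewrite ?nrm_ge0 ?hK// hb//; move: y2; lra.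
      rewrite mulrACA; apply: ler_wpM2l; first by rewrite mulr_ge0.
      exact: ler_pM.
    have p30 : 0 <= (3 / 2 : R) ^+ n by rewrite exprn_ge0// divr_ge0.
    have e2 : D * (3 / 2) ^+ n * nrm ((symbol a y - A) *m f y) <=
        D * K * dl * (b * `|xi| / 4 * (3 / 4) ^+ n).
      apply: (@le_trans _ _ (D * (3 / 2) ^+ n * (K * b * (dl / 2 * (2^-1 ^+ n.+1 * `|xi|))))).
        by apply: ler_wpM2l => //; rewrite mulr_ge0.
      have -> : (3 / 4 : R) ^+ n = (3 / 2) ^+ n * 2^-1 ^+ n.
        by rewrite -exprMn; congr (_ ^+ n); lra.
      rewrite le_eqVlt; apply/orP; left; apply/eqP; by rewrite exprS; field.
    apply: (le_trans (lerD (lexx _) e2)).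
    have z0 : 0 <= b * `|xi| / 4 * (3 / 4) ^+ n.
      by rewrite mulr_ge0 ?divr_ge0 ?mulr_ge0 ?exprn_ge0.
    have := ler_wpM2r z0 dlK; move: z0; rewrite [(3 / 4) ^+ n.+1]exprS.
    set z := (3 / 4) ^+ n; set w := b * `|xi| / 4 => z0; nra.
  (* With this [N] the remaining term is at most b |xi| / 4, like the telescoped sum; together they
     give b |xi| / 2. *)
  have [N hN] : exists N, forall n, (N <= n)%N -> D * (3 / 4) ^+ n <= 4^-1.
    by apply: geo_small => //; lra.
  have := rec N; have := hN N (leqnn N) => hN' hr.
  have e3 : nrm (iter N (mulmx A) (f (M%:R ^- N *: xi))) <= D * (3 / 4) ^+ N * (b * `|xi|).
    apply: (le_trans (iter_mulmx_col _ N hD)).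
    have p2 : (2^-1 : R) ^+ N <= 1 by rewrite exprn_ile1 ?invr_ge0// invf_le1// ler1n.
    have hy : nrm (f (M%:R ^- N *: xi)) <= b * (2^-1 ^+ N * `|xi|).
      apply: (@le_trans _ _ (b * `|M%:R ^- N *: xi|)); last by rewrite ler_wpM2l// Minv.
      apply: hb; apply: (le_trans (Minv _ _)); apply: le_trans xdl; by rewrite ler_piMl.
    have -> : (3 / 4 : R) ^+ N = (3 / 2) ^+ N * 2^-1 ^+ N.
      by rewrite -exprMn; congr (_ ^+ N); lra.
    rewrite -mulrA -[leRHS]mulrA; apply: ler_wpM2l => //.
    have -> : (3 / 2) ^+ N * 2^-1 ^+ N * (b * `|xi|) =
      (3 / 2) ^+ N * (b * (2^-1 ^+ N * `|xi|)) by ring.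
    by apply: ler_wpM2l => //; rewrite exprn_ge0// divr_ge0.
  have bx : 0 <= b * `|xi| by rewrite mulr_ge0.
  have := ler_wpM2r bx hN'.
  have p40 : 0 <= (3 / 4 : R) ^+ N by rewrite exprn_ge0// divr_ge0.
  have : nrm (f xi) <= nrm (f xi - iter N (mulmx A) (f (M%:R ^- N *: xi))) +
      nrm (iter N (mulmx A) (f (M%:R ^- N *: xi))).
    by apply: le_trans (nrmD _ _); rewrite subrK.
  move: hr e3; set P := (3 / 4) ^+ N in p40 *; set w := b * `|xi| in bx *.
  set n1 := nrm _; set n2 := nrm _; set n3 := nrm _ => h1 h2 h3 h4; rewrite mulrAC -/w.
  have := mulr_ge0 p40 bx; lra.
have ball xi : `|xi| <= dl -> f xi = 0.
  move=> xdl; have hk k : forall xi, `|xi| <= dl -> nrm (f xi) <= B * 2^-1 ^+ k * `|xi|.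
    elim: k => [|k ih]; first by move=> z zd; rewrite expr0 mulr1; apply: fB; exact: le_trans zd dl1.
    move=> z zd; rewrite exprSr mulrA; apply: (half (B * 2^-1 ^+ k)) => //.
    by rewrite mulr_ge0// exprn_ge0// invr_ge0.
  apply/matrixP => i j; rewrite mxE; apply: normc_small => e e0.
  apply: (le_trans (nrm_entry _ _ _)).
  have [N hN] : exists N, forall n, (N <= n)%N -> B * `|xi| * 2^-1 ^+ n <= e.
    by apply: geo_small => //; [lra|rewrite mulr_ge0].
  by apply: (le_trans (hk N _ xdl)); rewrite mulrAC hN.
(* An arbitrary point is contracted into the small ball, and the zero is carried back by the
   equation. *)
move=> xi; have [N hN] : exists N, forall n, (N <= n)%N -> `|xi| * 2^-1 ^+ n <= dl.
  by apply: geo_small => //; lra.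
have {hN} h0 : f (M%:R ^- N *: xi) = 0.
  by apply: ball; apply: (le_trans (Minv _ _)); rewrite mulrC hN.
have up k (z : V) : f z = 0 -> f (M%:R ^+ k *: z) = 0.
  move=> fz; elim: k => [|k ih]; first by rewrite expr0 scale1r.
  by rewrite exprS -scalerA fM ih mulmx0.
by have := up N _ h0; rewrite scalerA divff ?scale1r// expf_neq0// lt0r_neq0.
Qed.

Lemma compact_distribution_int (h : V -> C) : cc h ->
  compact_distribution (fun psi => intRn (fun x => h x * psi x)).
Proof.
move=> ch; have [_ [B hB]] := ch; have [K K0 hK] := cc_bounded ch.
have cp psi : smooth psi -> cc (fun x => h x * psi x).
  by move=> sp; apply: cc_mul => //; exact: sp.
split.
  move=> c F G sF sG; rewrite -(intRn_scale c (cp _ sF)) -(intRn_add (cc_scale c (cp _ sF)) (cp _ sG)).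
  by congr intRn; apply/funext => x; rewrite mulrDr mulrCA.
exists B%:R, 0%N, ((B.*2.+1 ^ d)%:R * K) => psi b sp hb.
have hb' x : `|x| <= B%:R -> normc (psi x) <= b.
  move=> xB; have := hb (fun=> 0%N) x; rewrite mderivC_word.
  have -> : word_of (fun _ : 'I_d => 0%N) = [::].
    by apply/eqP; rewrite -size_eq0 size_word_of /mabs big1.
  by apply => //; rewrite /mabs big1.
have b0 : 0 <= b.
  by apply: le_trans (hb' 0 _); [exact: normc_ge0|rewrite normr0].
rewrite -mulrA; apply: intRn_bound; first exact: cp.
- by move=> x /hB ->; rewrite mul0r.
- exact: mulr_ge0.
move=> x; rewrite ComplexField.Normc.normcM.
have [xB|/hB ->] := leP `|x| B%:R; last by rewrite ComplexField.Normc.normc0 mul0r mulr_ge0.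
by apply: ler_pM; rewrite ?normc_ge0 ?hK ?hb'.
Qed.

Lemma compact_distribution_sub (T U : (V -> C) -> C) c :
  compact_distribution T -> compact_distribution U ->
  compact_distribution (fun psi => T psi - c * U psi).
Proof.
move=> [hT [B1 [N1 [K1 h1]]]] [hU [B2 [N2 [K2 h2]]]]; split.
  by move=> e F G sF sG; rewrite hT// hU//; ring.
exists (Num.max B1 B2), (maxn N1 N2), (K1 + normc c * K2) => psi b sp hb.
apply: (le_trans (le_normcD _ _)); rewrite normcN ComplexField.Normc.normcM mulrDl -mulrA.
apply: lerD.
  by apply: h1 => // al x al1 xB; apply: hb; rewrite ?leq_max ?al1// le_max xB.
apply: ler_wpM2l; first exact: normc_ge0.
by apply: h2 => // al x al1 xB; apply: hb; rewrite ?leq_max ?al1 ?orbT// le_max xB orbT.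
Qed.

Variable ups0 : 'rV[C]_r.
Hypotheses (h1 : mup 1 (char_poly A) = 1%N) (uA : ups0 *m A = ups0) (u0 : ups0 != 0).

(** A vector fixed by [symbol a 0] and annihilated by [ups0] is zero, by simplicity of the
    eigenvalue. Applied to the transform of [eta] at 0 this gives c != 0; applied to T = phi -
    c^(-1) eta it makes the transform of T vanish at 0, hence everywhere, and then T vanishes on
    test functions. *)
Lemma refinable_distribution_unique (phi : 'I_r -> (V -> C) -> C) (eta : V -> 'cV[C]_r) :
  (forall i, compact_distribution (phi i)) ->
  (forall xi, fourier_dist phi (M%:R *: xi) = symbol a xi *m fourier_dist phi xi) ->
  ups0 *m fourier_dist phi 0 = 1%:M ->
  (forall i, cc (fun x => eta x i 0)) ->
  (forall xi, fourier eta (M%:R *: xi) = symbol a xi *m fourier eta xi) ->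
  fourier eta 0 != 0 ->
  (ups0 *m fourier eta 0) 0 0 != 0 /\
  forall i psi, smooth psi -> compact_support psi ->
    intRn (fun x => eta x i 0 * psi x) = (ups0 *m fourier eta 0) 0 0 * phi i psi.
Proof.
move=> cphi phiM phi0 ceta etaM eta0; set c := (_ *m _) 0 0.
have fix0 (f : V -> 'cV[C]_r) : (forall xi, f (M%:R *: xi) = symbol a xi *m f xi) ->
    A *m f 0 = f 0 by move=> /(_ 0); rewrite scaler0 => <-.
have cE : ups0 *m fourier eta 0 = c%:M by rewrite [LHS]mx11_scalar.
have c0 : c != 0.
  apply: contra eta0 => /eqP c0; apply/eqP; apply: (simple_eigenvector h1 uA u0 (fix0 _ etaM)).
  by rewrite cE c0 -scalemx1 scale0r.
split => // i psi sp cp.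
pose T i psi := phi i psi - c^-1 * intRn (fun x => eta x i 0 * psi x).
have cT k : compact_distribution (T k).
  by apply: compact_distribution_sub => //; exact: compact_distribution_int.
have TE xi : fourier_dist T xi = fourier_dist phi xi - c^-1 *: fourier eta xi.
  by apply/matrixP => k j; rewrite !mxE ord1.
have TM xi : fourier_dist T (M%:R *: xi) = symbol a xi *m fourier_dist T xi.
  by rewrite !TE mulmxBr -scalemxAr phiM etaM.
have T0 : fourier_dist T 0 = 0.
  apply: (simple_eigenvector h1 uA u0 (fix0 _ TM)).
  by rewrite TE mulmxBr phi0 -scalemxAr cE scale_scalar_mx mulVf// subrr.
have /choice[K hK] k : exists K : R, 0 <= K /\ forall xi, `|xi| <= 1 ->
    normc (T k (echar xi) - T k (echar 0)) <= K * `|xi|.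
  by have [K K0 h] := distribution_lipschitz0 (cT k); exists K.
have Tz xi : fourier_dist T xi = 0.
  apply: (refinable_eq0 (B := \sum_k K k) TM).
    by apply: sumr_ge0 => k _; have [] := hK k.
  move=> z z1; rewrite mulr_suml; apply: ler_sum => k _.
  rewrite big_ord_recl big_ord0 addr0 mxE; have [_ /(_ z z1)] := hK k.
  have -> : T k (echar 0) = 0; last by rewrite subr0.
  by have /matrixP/(_ k 0) := T0; rewrite !mxE.
have : T i psi = 0.
  apply: (distribution_density (cT i)) => // xi.
  by have /matrixP/(_ i 0) := Tz xi; rewrite !mxE.
by rewrite /T => /eqP; rewrite subr_eq0 => /eqP ->; rewrite mulVKf.
Qed.

End RefinableUniqueness.

(** * Derivatives of transforms and semi-convolutions *)

Section MoreDerivatives.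
Variables (R : realType) (d : nat).
Local Notation C := R[i].
Local Notation V := 'rV[R]_d.
Local Notation Zd := 'rV[int]_d.
Local Notation rc := (real_complex R).
Local Notation iC := (Complex 0 1 : C).
Implicit Types (F : V -> C) (s : seq 'I_d).

Lemma wderiv_sum s I (L : seq I) (f : I -> V -> C) : (forall i, CnC (size s) (f i)) ->
  wderiv s (fun x => \sum_(i <- L) f i x) = fun x => \sum_(i <- L) wderiv s (f i) x.
Proof.
move=> hf; elim: L => [|i L ih].
  rewrite (_ : (fun x : V => _) = fun=> 0); last by apply/funext => x; rewrite big_nil.
  by rewrite wderiv_cst0; apply/funext => x; rewrite big_nil; case: (s).
rewrite (_ : (fun x : V => _) = fun x => 1 * f i x + \sum_(k <- L) f k x); last first.
  by apply/funext => x; rewrite big_cons mul1r.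
rewrite wderiv_lin ?ih//; last by apply: CnC_sum.
by apply/funext => x; rewrite big_cons mul1r.
Qed.

Lemma smooth_ft (h : V -> C) : cc h -> smooth (ft h).
Proof.
apply: (@smooth_family R d _ (@cc R d) (@ft_op R d) (@ft R d)) => h' ch'.
  by move=> j; split; [exact: cc_ft_op|exact: DC_ft].
exact: ft_cont.
Qed.

Lemma smooth_sy (c : Zd -> C) : fsupp c -> smooth (@sy R d c).
Proof.
apply: (@smooth_family R d _ (@fsupp d C) (@sy_op R d) (@sy R d)) => c' fc'.
  by move=> j; split; [exact: fsupp_sy_op|exact: DC_sy].
exact: sy_cont.
Qed.

(* The points with no zero coordinate are dense. *)
Lemma wmono_cancel s (w : V -> C) : CnC 0 w -> (forall x, wmono s x * w x = 0) -> w = fun=> 0.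
Proof.
move=> cw h; apply/funext => x; apply: normc_small => e e0.
have [dl dl0 hdl] := CnC0_unif `|x| cw e0.
pose y : V := \row_j (if x 0 j == 0 then dl / 2 else x 0 j).
have y0 j : y 0 j != 0.
  by rewrite mxE; case: ifP => [_|->//]; rewrite mulf_neq0 ?invr_eq0 ?lt0r_neq0.
have wy : w y = 0.
  have := h y; move/eqP; rewrite mulf_eq0 => /orP[|/eqP //].
  rewrite /wmono prodf_seq_eq0 => /hasP[j _ /= /eqP E].
  by have := y0 j; rewrite (rc_inj (E : rc _ = rc 0)) eqxx.
have := hdl x y (lexx _); rewrite wy subr0; apply.
apply: (@le_lt_trans _ _ (dl / 2)); last lra.
apply: rV_norm_le; first lra.
move=> j; rewrite !mxE; case: eqP => [->|_]; last by rewrite subrr normr0; lra.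
by rewrite sub0r normrN ger0_norm; lra.
Qed.

Lemma CnC_semiconv p q t k (v : Zd -> 'M[C]_(p, q)) (f : V -> 'M[C]_(q, t)) i j :
  fsupp v -> CnM k f -> CnC k (fun x => semiconv v f x i j).
Proof.
move=> [L hL] cf; rewrite (_ : (fun x => _) =
    fun x => \sum_(z <- box L) \sum_l v z i l * f (x - zvec R z) l j); last first.
  by apply/funext => x; rewrite (semiconv_entry _ _ _ _ hL).
apply: CnC_sum => z; apply: CnC_sum => l; apply: CnC_scale.
by apply: (CnC_shift (F := fun x => f x l j)); exact: cf.
Qed.

Lemma mderivM_semiconv p q t (mu : 'I_d -> nat) (v : Zd -> 'M[C]_(p, q)) (f : V -> 'M[C]_(q, t)) :
  fsupp v -> CnM (mabs mu) f -> mderivM mu (semiconv v f) = semiconv v (mderivM mu f).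
Proof.
move=> fv cf; have [L hL] := fv; apply/funext => x; apply/matrixP => i j.
rewrite mderivM_word (semiconv_entry _ _ _ _ hL).
rewrite (_ : (fun x => _) = fun x => \sum_(z <- box L) \sum_l v z i l * f (x - zvec R z) l j).
  have c1 z l : CnC (size (word_of mu)) (fun x : V => f (x - zvec R z) l j).
    by rewrite size_word_of; apply: (CnC_shift (F := fun x => f x l j)); exact: cf.
  rewrite wderiv_sum; last by move=> z; apply: CnC_sum => l; exact: CnC_scale.
  apply: eq_bigr => z _; rewrite wderiv_sum; last by move=> l; exact: CnC_scale.
  apply: eq_bigr => l _; rewrite wderiv_scale//; congr (_ * _).
  rewrite mderivM_word (@wderiv_shift _ _ _ (fun x => f x l j))//.
  by rewrite size_word_of; exact: cf.
by apply/funext => y; rewrite (semiconv_entry _ _ _ _ hL).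
Qed.

Lemma mderivM_scale p q (mu : 'I_d -> nat) (c : C) (f : V -> 'M[C]_(p, q)) x :
  CnM (mabs mu) f -> mderivM mu (fun y => c *: f y) x = c *: mderivM mu f x.
Proof.
move=> cf; apply/matrixP => i j; rewrite [RHS]mxE !mderivM_word.
rewrite (_ : (fun y => _) = fun y => c * f y i j); last by apply/funext => y; rewrite mxE.
by rewrite wderiv_scale// size_word_of; exact: cf.
Qed.

Lemma ipowE (mu : 'I_d -> nat) (xi : V) :
  ipow mu xi = iC ^+ mabs mu * wmono (word_of mu) xi.
Proof.
have -> : wmono (word_of mu) xi = \prod_j (rc (xi 0 j)) ^+ mu j.
  rewrite /wmono /word_of big_flatten big_map big_enum /=; apply: eq_bigr => j _.
  by elim: (mu j) => [|n ih]; rewrite ?big_nil// big_cons ih exprS.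
rewrite /mabs expr_sum -big_split; apply: eq_bigr => j _; exact: exprMn.
Qed.

Lemma word_fact_word (mu : 'I_d -> nat) : word_fact R (word_of mu) = (mfact mu)%:R.
Proof. by rewrite /mfact natr_prod; apply: eq_bigr => j _; rewrite count_word_of. Qed.

Lemma mfact_neq0 (mu : 'I_d -> nat) : (mfact mu)%:R != 0 :> C.
Proof. by rewrite pnatr_eq0 -lt0n prodn_gt0// => j; exact: fact_gt0. Qed.

Lemma perm_word_of_eq (nu mu : 'I_d -> nat) : perm_eq (word_of nu) (word_of mu) -> nu = mu.
Proof.
by move=> /permP h; apply/funext => j; rewrite -[LHS]count_word_of h count_word_of.
Qed.

Lemma mom_perm s t (h : V -> C) : perm_eq s t -> mom s h = mom t h.
Proof. by move=> st; congr intRn; apply/funext => x; rewrite (wmono_perm _ st). Qed.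

End MoreDerivatives.

(** * Moments of lowest order *)

Section LowestMoment.
Variables (R : realType) (d M r : nat).
Local Notation C := R[i].
Local Notation V := 'rV[R]_d.
Local Notation Zd := 'rV[int]_d.
Local Notation rc := (real_complex R).
Local Notation iC := (Complex 0 1 : C).
Hypotheses (hd : (0 < d)%N) (hM : (1 < M)%N).
Variables (a : Zd -> 'M[C]_r) (u : Zd -> 'cV[C]_r).
Hypotheses (ha : fsupp a) (hu : fsupp u).
Variables (tau : R) (g : V -> 'cV[C]_r).
Hypothesis hg : forall i j, CnC 0 (fun x => g x i j).
Hypothesis hlim :
  rescaled_cvg M tau (fun n => fconv (iter n (subdiv M a) (@deltaI R d r)) u) g.
Local Notation gi i := (fun x => g x i 0).

Let cg i : cc (gi i). Proof. exact: (g_cc hM ha hu hg hlim). Qed.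
Let M0 : (0 : R) < M%:R. Proof. by rewrite ltr0n ltnW. Qed.
Let MC0 : (M%:R : C) != 0. Proof. by rewrite pnatr_eq0 -lt0n ltnW. Qed.

(** The moment of g(x / M) is computed by change of variables and by the refinement relation. In the
    second way, translating the monomial creates only moments of smaller degree, which vanish, so
    that [symbol a 0] alone acts. *)
Lemma lowest_moment_eigen N s : (forall s' i, (size s' < N)%N -> mom s' (gi i) = 0) ->
  size s = N ->
  symbol a 0 *m (\col_i mom s (gi i)) = rc (M%:R `^ (N%:R - tau)) *: (\col_i mom s (gi i)).
Proof.
move=> h0 sN; apply/matrixP => i j; rewrite !mxE; set mi := mom s (gi i).
have E1 : mom s (fun x => g (M%:R^-1 *: x) i 0) = M%:R ^+ d * (M%:R ^+ N * mi).
  rewrite /mi /mom -(intRn_scale _ (cc_wmono s (cg i))) -intRn_dilate//; last 2 first.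
  - exact: ltnW.
  - exact/cc_scale/cc_wmono.
  congr intRn; apply/funext => x; rewrite wmonoZ mulrA sN mulrA -exprMn rcV rc_natr mulfV//.
  by rewrite expr1n mul1r.
have [L hL] := ha.
have hv z : z \notin box L -> subdiv M a (@deltaI R d r) z = 0.
  by rewrite subdiv_deltaIE => /hL ->; rewrite scaler0.
have E2 : mom s (fun x => g (M%:R^-1 *: x) i 0) =
    rc (M%:R `^ tau) * (M%:R ^+ d * \sum_l symbol a 0 i l * mom s (gi l)).
  rewrite /mom; transitivity (rc (M%:R `^ tau) *
      intRn (fun x => semiconv (subdiv M a (@deltaI R d r)) g x i 0 * wmono s x)).
    rewrite -intRn_scale; last first.
      apply: cc_mul; last exact: CnC0_wmono.
      by apply: (semiconv_cc hM ha hu hg hlim); exists L.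
    congr intRn; apply/funext => x; rewrite (refinement_time hM ha hu hg hlim); ring.
  congr (_ * _); rewrite (intRn_semiconv hM ha hu hg hlim i 0 (CnC0_wmono R s) hv).
  rewrite exchange_big mulr_sumr; apply: eq_bigr => l _.
  rewrite symbol_entry// /sy (@fsum_box _ _ _ L); last by move=> k /hL ->; rewrite mxE mulr0.
  rewrite mulr_suml mulr_sumr; apply: eq_bigr => z _.
  rewrite dotpC dotp0l oppr0 expi0 mul1r subdiv_deltaIE mxE -mulrA; congr (_ * (_ * _)).
  have [Ls hLs hsh] := wmono_shift s (zvec R z).
  transitivity (intRn (fun x => wmono s x * g x l 0 + \sum_(p <- Ls) p.1 * (wmono p.2 x * g x l 0))).
    congr intRn; apply/funext => x; rewrite hsh mulrDr mulr_sumr mulrC; congr (_ + _).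
    by apply: eq_bigr => p _; ring.
  have cs : cc (fun x => \sum_(p <- Ls) p.1 * (wmono p.2 x * g x l 0)).
    by apply: cc_sum => p; apply/cc_scale/cc_wmono.
  rewrite intRn_add//; last exact: cc_wmono.
  rewrite intRn_sum; last by move=> p; apply/cc_scale/cc_wmono.
  rewrite big1_seq ?addr0// => p /andP[_ pL].
  rewrite intRn_scale; last exact: cc_wmono.
  by rewrite -/(mom _ _) h0 ?mulr0// -sN (allP hLs).
have Md0 : M%:R ^+ d != 0 :> C by rewrite expf_neq0.
have T0 : rc (M%:R `^ tau) != 0.
  by apply/eqP => /(@rc_inj R _ 0)/eqP; rewrite powR_eq0 (gt_eqF M0).
apply: (mulfI T0); apply: (mulfI Md0).
under eq_bigr => l _ do rewrite mxE.
rewrite mulrCA -E2 E1; congr (_ * _); rewrite mulrA -rcM -powRD; last first.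
  by rewrite (gt_eqF M0) implybT.
by rewrite addrC subrK powR_mulrn ?ler0n// rcX rc_natr.
Qed.

Lemma lowest_moment_order m : tau <= m%:R -> simple_dominant_one (symbol a 0) (M%:R ^- m) ->
  (exists x, g x <> 0) ->
  exists N, [/\ tau = N%:R, exists s i, size s = N /\ mom s (gi i) != 0 &
    forall s i, (size s < N)%N -> mom s (gi i) = 0].
Proof.
move=> tm [_ hev] [x gx].
pose P N := `[< exists s i, size s = N /\ mom s (gi i) != 0 >].
have exP : exists N, P N.
  apply: contrapT => h; apply: gx; apply/matrixP => i j; rewrite ord1 mxE.
  suff h0 : gi i = fun=> 0 by exact: (congr1 (fun f => f x) h0).
  apply: (mom_eq0 hd (cg i)) => s; apply/eqP; apply: contrapT => hs; apply: h; exists (size s); apply/asboolP.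
  by exists s, i; split => //; apply/negP.
have [N /asboolP[s [i [sN hs]]] hmin] := ex_minnP exP.
have low s' k : (size s' < N)%N -> mom s' (gi k) = 0.
  move=> s'N; apply/eqP; apply: contraT => h.
  by move: s'N; rewrite ltnNge hmin//; apply/asboolP; exists s', k.
have := lowest_moment_eigen low sN; set v := \col_i _ => Av.
have v0 : v != 0.
  by apply: contra hs => /eqP/matrixP/(_ i 0); rewrite !mxE => ->.
have rt := root_char_poly_col Av v0; rewrite -eigenvalue_root_char in rt.
exists N; split => //; last by exists s, i.
have [E|E] := eqVneq (rc (M%:R `^ (N%:R - tau))) 1.
  have := congr1 (@ln R) (@rc_inj R _ 1 E); rewrite ln_powR ln1 => /eqP.
  by rewrite mulf_eq0 (gt_eqF (ln_gt0 _)) ?ltr1n// orbF subr_eq0 => /eqP.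
have := hev _ rt E; rewrite normc_rc ger0_norm ?powR_ge0// ltNge => /negP[].
rewrite -powR_mulrn ?ler0n// -powRN; apply: ler_powR; first by rewrite ler1n ltnW.
by rewrite -subr_ge0 opprK; have := ler0n R N; lra.
Qed.

End LowestMoment.

(** * Derivatives at the origin and the integrable case *)

Section IntegrableSolution.
Variables (R : realType) (d M r m : nat).
Local Notation C := R[i].
Local Notation V := 'rV[R]_d.
Local Notation Zd := 'rV[int]_d.
Local Notation rc := (real_complex R).
Local Notation iC := (Complex 0 1 : C).
Hypotheses (hd : (0 < d)%N) (hM : (1 < M)%N).
Variables (a : Zd -> 'M[C]_r) (u : Zd -> 'cV[C]_r) (ups : Zd -> 'rV[C]_r).
Hypotheses (ha : fsupp a) (hu : fsupp u) (hups : matching_filter M a ups m.+1).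
Variables (tau : R) (mu : 'I_d -> nat) (eta : V -> 'cV[C]_r).
Hypothesis heta : CnM (mabs mu) eta.
Local Notation g := (mderivM mu eta).
Local Notation w := (word_of mu).
Hypothesis hlim :
  rescaled_cvg M tau (fun n => fconv (iter n (subdiv M a) (@deltaI R d r)) u) g.

Lemma mderivM_CnC0 i j : CnC 0 (fun x => g x i j).
Proof.
rewrite (_ : (fun x => _) = wderiv w (fun y => eta y i j)).
  by apply: wderiv_CnC; rewrite addn0 size_word_of; exact: heta.
by apply/funext => x; rewrite mderivM_word.
Qed.

Let cg i j : cc (fun x => g x i j). Proof. exact: (g_cc hM ha hu mderivM_CnC0 hlim). Qed.

Lemma mderivM_fourier nu i j :
  mderivM nu (fourier g) 0 i j = (- iC) ^+ mabs nu * mom (word_of nu) (fun x => g x i j).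
Proof.
rewrite mderivM_word -size_word_of -wderiv_ft0//; congr (wderiv _ _ _).
by apply/funext => xi; rewrite fourierE.
Qed.

(** [moment_relation] in terms of transforms: derivatives at 0 are moments up to the common factor
    (-i)^|nu|. *)
Lemma matching_derivative nu i j : (mabs nu <= m)%N -> (mabs nu)%:R <= tau ->
  mderivM nu (fun xi => symbol ups xi *m symbol u xi) 0 i j =
  if (mabs nu)%:R < tau then 0
  else mderivM nu (fun xi => symbol ups xi *m fourier g xi) 0 i j.
Proof.
have fups : fsupp ups by case: hups => /l0P.
move=> num nut; rewrite !mderivM_word.
have -> : (fun y => (symbol ups y *m symbol u y) i j) = sy (fun k => fconv ups u k i j).
  by apply/funext => y; rewrite -symbol_fconv// symbol_entry//; exact: fsupp_fconv.
have -> : (fun y => (symbol ups y *m fourier g y) i j) = ft (fun x => semiconv ups g x i j).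
  by apply/funext => y; rewrite (fourier_semiconv hM ha hu mderivM_CnC0 hlim)// fourierE.
rewrite wderiv_sy0; last exact/fsupp_entry/fsupp_fconv.
rewrite wderiv_ft0; last exact: (semiconv_cc hM ha hu mderivM_CnC0 hlim).
rewrite (moment_relation hM ha hu mderivM_CnC0 hlim hups) ?size_word_of//.
by case: ifP => _; rewrite ?mulr0.
Qed.

Lemma matching_symbol0 : symbol ups 0 *m symbol a 0 = symbol ups (0 : V).
Proof.
have [_ _ /(_ 0)] := hups.
have h0 : Omega M (0 : V).
  split; first by exists 0; rewrite zvec0 scaler0.
  by move=> j; rewrite mxE lexx ltr01.
move=> /(_ h0 (fun=> 0%N)); rewrite /mabs big1// => /(_ (ltn0Sn m))/matrixP h.
have w0 : word_of (fun _ : 'I_d => 0%N) = [::].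
  by apply/eqP; rewrite -size_eq0 size_word_of /mabs big1.
apply/matrixP => i j; have := h i j; rewrite !mderivM_word w0 /= eqxx scale1r.
by rewrite !scaler0 addr0.
Qed.

Hypothesis hint : integrableM eta.

Lemma integrable_eta_cc i : cc (fun x => eta x i 0).
Proof.
split; first exact: (CnC_0 (heta i 0)).
have [_ [B hB]] := cg i 0; exists B.
have [h1 h2] := hint i 0; apply: (integrable_csupp (s := w)) h1 h2.
  by rewrite size_word_of; exact: heta.
by move=> x /hB; rewrite mderivM_word.
Qed.

Lemma ft_mderivM i xi :
  ft (fun x => g x i 0) xi = wmono w xi * (iC ^+ mabs mu * ft (fun x => eta x i 0) xi).
Proof.
have [_ [B hB]] := integrable_eta_cc i.
have c1 : CnC (size w) (fun x => eta x i 0) by rewrite size_word_of; exact: heta.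
have -> : (fun x => g x i 0) = wderiv w (fun x => eta x i 0).
  by apply/funext => x; rewrite mderivM_word.
by rewrite (ft_wderiv xi c1 hB) size_word_of; ring.
Qed.

Lemma wderiv_ft_mderivM t i : (size t <= mabs mu)%N ->
  wderiv t (ft (fun x => g x i 0)) 0 =
  if perm_eq t w then word_fact R w * (iC ^+ mabs mu * ft (fun x => eta x i 0) 0) else 0.
Proof.
move=> tm; rewrite (_ : ft (fun x => g x i 0) = fun xi =>
    wmono w xi * (iC ^+ mabs mu * ft (fun x => eta x i 0) xi)); last first.
  by apply/funext => xi; rewrite ft_mderivM.
apply: (wderiv_wmono_mul0 (h := fun xi => iC ^+ mabs mu * ft (fun x => eta x i 0) xi)).
  by rewrite size_word_of.
by apply: CnC_scale; apply: smooth_ft; exact: integrable_eta_cc.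
Qed.

Let iC0 n : iC ^+ n != 0.
Proof. by rewrite expf_neq0//; apply/eqP => -[] /eqP; rewrite oner_eq0. Qed.

(** Multiplied by the monomial of mu, both sides agree by the equation for g, whose factor M^tau is
    absorbed by the homogeneity of the monomial. The monomial is cancelled off the coordinate
    hyperplanes, and continuity does the rest. *)
Lemma fourier_eta_refinable : tau = (mabs mu)%:R ->
  forall xi, fourier eta (M%:R *: xi) = symbol a xi *m fourier eta xi.
Proof.
move=> taum xi; apply/matrixP => i j; rewrite ord1 !mxE.
have MC0 : (M%:R : C) != 0 by rewrite pnatr_eq0 -lt0n ltnW.
have cE (y : V) : (symbol a y *m fourier eta y) i 0 =
    \sum_l sy (fun k => a k i l) y * ft (fun x => eta x l 0) y.
  by rewrite mxE; apply: eq_bigr => l _; rewrite symbol_entry// fourierE.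
pose D (xi : V) := ft (fun x => eta x i 0) (M%:R *: xi) -
  \sum_l sy (fun k => a k i l) xi * ft (fun x => eta x l 0) xi.
have cD : CnC 0 D.
  apply: (@CnC_sub _ _ 0).
    apply: (@CnC0_comp _ _ (ft (fun x => eta x i 0)) (fun xi => M%:R *: xi)).
      by move=> x; exact: scaler_continuous.
    exact/ft_cont/integrable_eta_cc.
  apply: CnC0_sum => l; apply: CnC0_mul; last exact/ft_cont/integrable_eta_cc.
  exact/sy_cont/fsupp_entry.
suff D0 : D = fun=> 0.
  have := congr1 (fun f => f xi) D0; rewrite /D /= => /eqP; rewrite subr_eq0 => /eqP E.
  by rewrite -[LHS]/(ft _ _) E -cE mxE.
apply: (wmono_cancel (s := w) cD) => y.
have /matrixP/(_ i 0) := fourier_refinable hM ha hu mderivM_CnC0 hlim y.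
rewrite fourierE ft_mderivM wmonoZ [RHS]mxE mxE size_word_of taum powR_mulrn ?ler0n//.
rewrite rcX => E.
have {}E : wmono w y * ft (fun x => eta x i 0) (M%:R *: y) =
    wmono w y * \sum_l sy (fun k => a k i l) y * ft (fun x => eta x l 0) y.
  have q0 : rc M%:R ^+ mabs mu * iC ^+ mabs mu != 0.
    by rewrite mulf_neq0// rc_natr expf_neq0.
  apply: (mulfI q0); transitivity (rc M%:R ^+ mabs mu * wmono w y *
     (iC ^+ mabs mu * ft (fun x => eta x i 0) (M%:R *: y))); first ring.
  rewrite E -[RHS]mulrA; congr (_ * _); rewrite mulrA mulr_sumr; apply: eq_bigr => l _.
  by rewrite symbol_entry// fourierE ft_mderivM; ring.
by rewrite /D mulrBr E subrr.
Qed.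

Section LowestOrder.
Variable N : nat.
Hypotheses (tN : tau = N%:R)
  (hN : exists s i, size s = N /\ mom s (fun x => g x i 0) != 0)
  (lowN : forall s i, (size s < N)%N -> mom s (fun x => g x i 0) = 0).

(** The transform of g is a monomial of degree |mu| times a smooth function, so its derivatives of
    smaller order vanish at 0. *)
Lemma order_ge : (mabs mu <= N)%N.
Proof.
have [s [i [sN hs]]] := hN; rewrite leqNgt; apply: contra hs => Nm.
have sm : (size s < mabs mu)%N by rewrite sN.
have := wderiv_ft_mderivM i (ltnW sm); rewrite wderiv_ft0//.
rewrite ifF; last by apply/negbTE; apply: contraL sm => /perm_size ->; rewrite size_word_of ltnn.
by move=> /eqP; rewrite mulf_eq0 (negbTE (iC_neq0 R _)).
Qed.

(** The derivative of order mu at 0 of the transform of g is mu! i^|mu| times the transform of eta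
    at 0; it would vanish if N exceeded |mu|. *)
Lemma order_eq : fourier eta 0 <> 0 -> N = mabs mu.
Proof.
move=> eta0; apply/eqP; rewrite eqn_leq order_ge andbT leqNgt; apply/negP => mN.
apply: eta0; apply/matrixP => i j; rewrite ord1 fourierE mxE; apply/eqP.
have := wderiv_ft_mderivM i (t := w); rewrite size_word_of leqnn => /(_ isT).
rewrite wderiv_ft0// lowN ?size_word_of// mulr0 perm_refl word_fact_word => /esym/eqP.
by rewrite !mulf_eq0 (negbTE (iC0 _)) (negbTE (mfact_neq0 _ _)).
Qed.

(** At order |mu| = tau the symbol of [u] may be replaced by the transform of g, and Leibniz' rule
    at 0 leaves the cofactor of the monomial undifferentiated. *)
Lemma order_fourier_eta : N = mabs mu -> (mabs mu <= m)%N ->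
  beta_coef ups u mu = (symbol ups 0 *m fourier eta 0) 0 0.
Proof.
have fups : fsupp ups by case: hups => /l0P.
move=> Nm mm; rewrite /beta_coef matching_derivative ?tN ?Nm ?lexx// ltxx mderivM_word.
have -> : (fun y => (symbol ups y *m fourier g y) 0 0) = fun y =>
    wmono w y * \sum_l sy (fun k => ups k 0 l) y * (iC ^+ mabs mu * ft (fun x => eta x l 0) y).
  apply/funext => y; rewrite mxE mulr_sumr; apply: eq_bigr => l _.
  by rewrite symbol_entry// fourierE ft_mderivM; ring.
rewrite wderiv_wmono_mul0//; last first.
  apply: CnC_sum => l; apply: CnC_mul; first exact/smooth_sy/fsupp_entry.
  exact/CnC_scale/smooth_ft/integrable_eta_cc.
rewrite perm_refl word_fact_word mxE.
rewrite (eq_bigr (fun l => iC ^+ mabs mu * (symbol ups 0 0 l * fourier eta 0 l 0))); last first.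
  by move=> l _; rewrite symbol_entry// fourierE; ring.
rewrite -mulr_sumr mulrA [_ * iC ^+ _]mulrC mulrAC mulfV ?mul1r//.
by rewrite mulf_neq0 ?mfact_neq0 ?iC0.
Qed.

(** Orders below tau vanish. At order tau the derivatives are read on the transform of g, where only
    nu = mu survives, and there the coefficient is [beta_coef] by definition. *)
Lemma matching_bigO : (mabs mu <= m)%N ->
  eq_bigO (fun xi => symbol ups xi *m symbol u xi)
          (fun xi => (beta_coef ups u mu * ipow mu xi)%:M) (mabs mu).+1.
Proof.
have fups : fsupp ups by case: hups => /l0P.
move=> mm nu; rewrite ltnS => num; apply/matrixP => i j; rewrite !ord1.
have numN : (mabs nu)%:R <= tau by rewrite tN ler_nat (leq_trans num order_ge).
have -> : mderivM nu (fun xi => (beta_coef ups u mu * ipow mu xi)%:M : 'M[C]_1) 0 0 0 =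
    if perm_eq (word_of nu) w then (mfact mu)%:R * (beta_coef ups u mu * iC ^+ mabs mu) else 0.
  rewrite mderivM_word (_ : (fun y => _) = fun y =>
      wmono w y * (beta_coef ups u mu * iC ^+ mabs mu)); last first.
    by apply/funext => y; rewrite mxE eqxx mulr1n ipowE; ring.
  rewrite (wderiv_wmono_mul0 (h := fun=> _)) ?size_word_of ?word_fact_word//.
  exact: CnC_cst.
have [/perm_word_of_eq -> |np] := boolP (perm_eq _ _).
  rewrite /beta_coef [_ * (mfact mu)%:R]mulrC.
  have q0 : (mfact mu)%:R * iC ^+ mabs mu != 0 by rewrite mulf_neq0 ?mfact_neq0 ?iC0.
  by rewrite mulrCA divfK.
rewrite matching_derivative ?(leq_trans num mm)//; case: ifP => // _.
rewrite mderivM_word (_ : (fun y => (symbol ups y *m fourier g y) 0 0) = fun y =>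
    wmono w y * \sum_l sy (fun k => ups k 0 l) y * (iC ^+ mabs mu * ft (fun x => eta x l 0) y)).
  rewrite wderiv_wmono_mul0 ?size_word_of ?(negbTE np)//.
  apply: CnC_sum => l; apply: CnC_mul; first exact/smooth_sy/fsupp_entry.
  exact/CnC_scale/smooth_ft/integrable_eta_cc.
apply/funext => y; rewrite mxE mulr_sumr; apply: eq_bigr => l _.
by rewrite symbol_entry// fourierE ft_mderivM; ring.
Qed.

End LowestOrder.
End IntegrableSolution.

Theorem theorem3p1 (R : realType) (d M r m : nat)
    (hd : (0 < d)%N) (hM : (1 < M)%N) (hr : (0 < r)%N)
    (u : 'rV[int]_d -> 'cV[R[i]]_r) (hu : l0 u)
    (a : 'rV[int]_d -> 'M[R[i]]_r) (ha : l0 a)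
    (ups : 'rV[int]_d -> 'rV[R[i]]_r) (hups : matching_filter M a ups m.+1)
    (tau : R) (htau : 0 <= tau)
    (m0 : nat) (hm0 : (m0 <= m)%N)
    (mu : 'I_d -> nat) (hmu : mabs mu = m0)
    (eta : 'rV[R]_d -> 'cV[R[i]]_r) (heta : CnM m0 eta)
    (hlim : rescaled_cvg M tau
       (fun n => fconv (iter n (subdiv M a) (@deltaI R d r)) u) (mderivM mu eta)) :
  (* (1) *)
  (forall nu : 'I_d -> nat, (mabs nu <= m)%N -> (mabs nu)%:R <= tau ->
     mderivM nu (fun xi => symbol ups xi *m symbol u xi) 0 =
       if (mabs nu)%:R < tau then 0
       else mderivM nu
              (fun xi => symbol ups xi *m fourier (mderivM mu eta) xi) 0) /\
  (* (2) *)
  (compact_support (mderivM mu eta) /\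
   (forall xi : 'rV[R]_d,
      cvg_mx
        (fun n => real_complex R (M%:R `^ (tau * n%:R)) *:
           ((\prod_(1 <= j < n.+1) symbol a (M%:R ^- j *: xi))
              *m symbol u (M%:R ^- n *: xi)))
        (fourier (mderivM mu eta) xi)) /\
   (forall xi : 'rV[R]_d,
      fourier (mderivM mu eta) (M%:R *: xi) =
        real_complex R (M%:R `^ tau) *:
          (symbol a xi *m fourier (mderivM mu eta) xi))) /\
  (* (3) *)
  (forall w : 'rV[int]_d -> 'M[R[i]]_1, l0 w ->
     rescaled_cvg M tau
       (fun n => fconv (iter n (subdiv M a) (@deltaI R d r)) (fconv u w))
       (fun x => symbol w 0 0 0 *: mderivM mu eta x)) /\
  (tau <= m%:R -> (exists x, mderivM mu eta x <> 0) ->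
   simple_dominant_one (symbol a 0) (M%:R ^- m) ->
     (* (4) *)
     ((integrableM eta -> m0%:R <= tau) /\
      tau%:E = ereal_inf [set (N%:R)%:E | N in
        [set N : nat |
          (exists nu : 'I_d -> nat, mabs nu = N /\
             mderivM nu (fourier (mderivM mu eta)) 0 <> 0) /\
          (forall al : 'I_d -> nat, (mabs al < N)%N ->
             mderivM al (fourier (mderivM mu eta)) 0 = 0)]] /\
      (integrableM eta -> fourier eta 0 <> 0 -> tau = (mabs mu)%:R) /\
      (forall phi : 'I_r -> ('rV[R]_d -> R[i]) -> R[i],
         refinable_vector M a ups phi ->
         integrableM eta -> fourier eta 0 <> 0 ->
         exists g : 'rV[R]_d -> 'cV[R[i]]_r,
           [/\ CnM m0 g, represented_by phi g &
               exists2 c : R[i], c != 0 & forall x, eta x = c *: g x])) /\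
     (* (5) *)
     ((integrableM eta ->
         eq_bigO (fun xi => symbol ups xi *m symbol u xi)
                 (fun xi => (beta_coef ups u mu * ipow mu xi)%:M) m0.+1) /\
      (forall v : 'rV[int]_d -> 'rV[R[i]]_r, l0 v ->
         rescaled_cvg M tau (fun n => fconv (iter n (subdiv M a) v) u)
           (mderivM mu (semiconv v eta))) /\
      (forall phi : 'I_r -> ('rV[R]_d -> R[i]) -> R[i],
         refinable_vector M a ups phi ->
         integrableM eta -> fourier eta 0 <> 0 ->
         forall g : 'rV[R]_d -> 'cV[R[i]]_r,
           CnM m0 g -> represented_by phi g ->
           (forall x, eta x = beta_coef ups u mu *: g x) /\
           (forall v : 'rV[int]_d -> 'rV[R[i]]_r, l0 v ->
              rescaled_cvg M ((mabs mu)%:R : R)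
                (fun n => fconv (iter n (subdiv M a) v) u)
                (fun x => beta_coef ups u mu *: mderivM mu (semiconv v g) x))))).
Proof.
move/l0P: hu => fu; move/l0P: ha => fa.
have fups : fsupp ups by case: hups => /l0P.
have heta' : CnM (mabs mu) eta by rewrite hmu.
have hg := mderivM_CnC0 heta'; pose g := mderivM mu eta.
have cg i : cc (fun x => g x i 0) by exact: (g_cc hM fa fu hg hlim).
have h5b (v : 'rV[int]_d -> 'rV[R[i]]_r) : l0 v ->
    rescaled_cvg M tau (fun n => fconv (iter n (subdiv M a) v) u) (mderivM mu (semiconv v eta)).
  move=> /l0P fv; rewrite mderivM_semiconv//; apply/(rescaled_cvgP hM) => i j.
  exact: (semiconv_ucvg hM fa fu hlim).
split; [|split; [split; [|split]|split]].
- move=> nu num nut; apply/matrixP => i j.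
  rewrite (matching_derivative hM fa fu hups heta' hlim)//; case: ifP => // _.
  by rewrite mxE.
- have /choice[B hB] i : exists B, csupp B (fun x => g x i 0) by have [_] := cg i.
  apply/compact_supportP; exists (\max_i B i)%N => x xB; apply/matrixP => i j.
  rewrite ord1 [RHS]mxE; exact: (csupp_le (leq_bigmax i) (hB i) xB).
- move=> xi; exact: (fourier_limit hM fa fu hg hlim).
- move=> xi; exact: (fourier_refinable hM fa fu hg hlim).
- move=> w /l0P fw; apply/(rescaled_cvgP hM) => i j.
  have := conv_limit hM fa fu hg hlim fw i j; congr ucvg.
  by apply/funext => x; rewrite [RHS]mxE.
move=> taum gne sd.
have [N [tN hN lowN]] := lowest_moment_order hd hM fa fu hg hlim taum sd gne.
have [h1 hev] := sd.
(* Since M^(-m) <= 1, all eigenvalues lie in the closed unit disc, as the bound on the powers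
   requires. *)
have hA z : root (char_poly (symbol a 0)) z -> normc z <= 1.
  rewrite -eigenvalue_root_char => ez; have [->|z1] := eqVneq z 1.
    by rewrite -[1]/(real_complex R 1) normc_rc normr1.
  apply: (le_trans (ltW (hev _ ez z1))).
  by rewrite invf_le1 ?exprn_ege1 ?exprn_gt0 ?ltr0n ?ler1n// ltnW.
have uA := matching_symbol0 hups; have [_ u0 _] := hups.
have mm : (mabs mu <= m)%N by rewrite hmu.
have Nmu : integrableM eta -> fourier eta 0 <> 0 -> N = mabs mu.
  move=> hint; exact: (order_eq hM fa fu heta' hlim hint hN lowN).
(* The scalar between [eta] and [phi] is identified with [beta_coef] by [order_fourier_eta]; both
   (4) and (5) rest on this identity. *)
have main (phi : 'I_r -> ('rV[R]_d -> R[i]) -> R[i]) : refinable_vector M a ups phi ->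
    integrableM eta -> fourier eta 0 <> 0 -> beta_coef ups u mu != 0 /\
    forall i psi, smooth psi -> compact_support psi ->
      intRn (fun x => eta x i 0 * psi x) = beta_coef ups u mu * phi i psi.
  move=> [cphi phiM phi0] hint eta0; have Nm := Nmu hint eta0.
  have -> := order_fourier_eta hM fa fu hups heta' hlim hint tN Nm mm.
  apply: (refinable_distribution_unique hM fa hA h1 uA u0 cphi phiM phi0).
  - exact: (integrable_eta_cc hM fa fu heta' hlim hint).
  - by apply: (fourier_eta_refinable hM fa fu heta' hlim hint); rewrite tN Nm.
  - exact/eqP.
split; split.
- move=> hint; rewrite tN ler_nat -hmu.
  exact: (order_ge hM fa fu heta' hlim hint hN).
- split.
    (* The two conditions single out one order, that of the lowest nonzero moments, so the infimum
       is taken over a singleton. *)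
    rewrite (_ : [set _ | _ in _] = [set tau%:E]) ?ereal_inf1//.
    have cvt s i : mom s (fun x => g x i 0) = mom (word_of (fun j => count_mem j s)) (fun x => g x i 0).
      exact/mom_perm/perm_word_of.
    have sz s : mabs (fun j : 'I_d => count_mem j s) = size s.
      by rewrite -size_word_of -(perm_size (perm_word_of s)).
    have dv nu i j := mderivM_fourier hM fa fu heta' hlim nu i j.
    apply/seteqP; split => [_ [K [[nu [nuK hnu]] hal] <-]|_ ->] /=.
      have [i hi] : exists i, mom (word_of nu) (fun x => g x i 0) != 0.
        apply: contrapT => h; apply: hnu; apply/matrixP => i j; rewrite ord1 dv mxE.
        have [->|hi] := eqVneq (mom (word_of nu) (fun x => g x i 0)) 0; first by rewrite mulr0.
        by case: h; exists i.
      have NK : (N <= K)%N.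
        by rewrite leqNgt; apply: contra hi => KN; rewrite lowN// size_word_of nuK.
      have KN : (K <= N)%N.
        rewrite leqNgt; apply/negP => NK'; have [s [k [sN /eqP[]]]] := hN.
        have := hal (fun j => count_mem j s); rewrite sz sN => /(_ NK')/matrixP/(_ k 0)/eqP.
        by rewrite dv mxE mulf_eq0 (negbTE (iC_neq0 R _)) /= -cvt => /eqP.
      by rewrite tN; congr (_%:R%:E); apply/eqP; rewrite eqn_leq NK KN.
    exists N; last by rewrite tN.
    split.
      have [s [k [sN hs]]] := hN; exists (fun j => count_mem j s); split; first by rewrite sz.
      move=> /matrixP/(_ k 0)/eqP; rewrite dv mxE mulf_eq0 (negbTE (iC_neq0 R _)) /= -cvt.
      by rewrite (negbTE hs).
    move=> al alN; apply/matrixP => i j; rewrite ord1 dv mxE lowN ?mulr0//.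
    by rewrite size_word_of.
  split; first by move=> hint eta0; rewrite tN (Nmu hint eta0).
  move=> phi hphi hint eta0; have [c0 hc] := main phi hphi hint eta0.
  set c := beta_coef _ _ _ in c0 hc.
  (* The density of [phi] is [eta] divided by [beta_coef]. *)
  exists (fun x => c^-1 *: eta x); split.
  + move=> i j; rewrite (_ : (fun x => _) = fun x => c^-1 * eta x i j).
      by apply: CnC_scale; exact: heta.
    by apply/funext => x; rewrite mxE.
  + move=> i psi sp cp; apply: (mulfI c0); rewrite -hc// -intRn_scale.
      by congr intRn; apply/funext => x; rewrite mxE !mulrA mulfV// mul1r.
    have := cc_scale c^-1 (cc_mul (integrable_eta_cc hM fa fu heta' hlim hint i) (sp 0%N)).
    by congr cc; apply/funext => x; rewrite mxE mulrA.
  + by exists c => // x; rewrite scalerA mulfV// scale1r.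
- move=> hint; rewrite -hmu.
  exact: (matching_bigO hM fa fu hups heta' hlim hint tN hN mm).
split; first exact: h5b.
move=> phi hphi hint eta0 g' cg' rg'; have [c0 hc] := main phi hphi hint eta0.
set c := beta_coef _ _ _ in c0 hc *.
(* The density [g'] is known only through test functions; continuity of both sides upgrades the
   identity to a pointwise one. *)
have etaE x : eta x = c *: g' x.
  apply/matrixP => i j; rewrite ord1 mxE; apply/eqP; rewrite -subr_eq0; apply/eqP.
  have cgi : CnC 0 (fun x => g' x i 0) by exact: (CnC_0 (cg' i 0)).
  have ce := integrable_eta_cc hM fa fu heta' hlim hint i.
  have h0 : (fun x => eta x i 0 - c * g' x i 0) = fun=> 0.
    apply: du_Bois_Reymond.
      by apply: (@CnC_sub _ _ 0); [exact: ce.1|exact: CnC_scale].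
    move=> psi sp cp; have cpsi : cc psi by split; [exact: (sp 0%N)|exact/compact_supportP].
    have cgp : cc (fun x => g' x i 0 * psi x).
      by have := cc_mul cpsi cgi; congr cc; apply/funext => z; rewrite mulrC.
    transitivity (intRn (fun x => eta x i 0 * psi x - c * (g' x i 0 * psi x))).
      by congr intRn; apply/funext => z; rewrite mulrBl mulrA.
    rewrite intRn_sub; [|exact: (cc_mul ce (sp 0%N))|exact: cc_scale].
    by rewrite intRn_scale// hc// (rg' i psi sp cp) subrr.
  exact: (congr1 (fun f => f x) h0).
split => // v hv; have := h5b v hv; rewrite tN (Nmu hint eta0).
have /l0P fv := hv; have cg2 : CnM (mabs mu) g' by rewrite hmu.
congr rescaled_cvg; apply/funext => x; rewrite -mderivM_scale.
  congr (mderivM mu _ x); apply/funext => y; have [L hL] := fv.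
  rewrite !(semiconv_box _ _ hL) scaler_sumr.
  by apply: eq_bigr => k _; rewrite etaE -scalemxAr.
by move=> i j; exact: CnC_semiconv.
Qed.
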